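(* Let $X=X(Q_0)$ be a rearrangement invariant space. If $T$ is a bounded operator on the pair $(L^1,BMO)=(L^1(Q_0),BMO(Q_0))$, then $T$ is a bounded operator in the space $GaRo_X$.
   Context: $Q_0\subset\mathbb R^n$ is a fixed cube with $|Q_0|=1$; all cubes have sides parallel to the coordinate axes. $P=P(Q_0)$ is the set of all countable (possibly finite) families $\{Q_i\}$ of subcubes of $Q_0$ with pairwise disjoint interiors. $f_Q=\frac1{|Q|}\int_Qf$. Rearrangement invariant (r.i.) space $X$ on $Q_0$: a Banach function space on $(Q_0,dx)$ which is either separable or has the Fatou property ($0\le f_n\uparrow f\in X$ implies $\|f_n\|_X\uparrow\|f\|_X$), such that $g\in X$ and $f^*=g^*$ imply $f\in X$ and $\|f\|_X=\|g\|_X$, where $f^*$ denotes the decreasing rearrangement of $|f|$. One has $L^\infty\subset X\subset L^1$ with continuous embeddings. Convention: $\|g\|_X=\infty$ if $g\notin X$. $\|f\|_{BMO}=\sup_{Q\subset Q_0}\frac1{|Q|}\int_Q|f-f_Q|\,dx$. The pair $(L^1,BMO)$ is understood modulo constants, i.e. constant functions are factored out (equivalently one restricts to functions of mean zero on $Q_0$). ''Bounded operator on the pair'' is meant in the usual sense of interpolation theory: $T$ is bounded on $L^1$ and on $BMO$. The property of such operators that is used is that $K(t,Tf;L^1,BMO)\le c\,K(t,f;L^1,BMO)$ for all $t>0$, with $c$ independent of $f$ and $t$, where $K(t,f;L^1,BMO)=\inf\{\|f_0\|_{L^1}+t\|f_1\|_{BMO}: f=f_0+f_1\}$. For $f\in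 L^1(Q_0)$, $\Gamma_f$ is the class of integrable functions $\gamma$ on $Q_0$ such that for all $\{Q_i\}\in P$ $$\sum_i\frac1{|Q_i|}\int_{Q_i}\int_{Q_i}|f(x)-f(y)|\,dx\,dy\le\sum_i\int_{Q_i}\gamma(x)\,dx .$$ $\|f\|_{GaRo_X}=\inf\{\|\gamma\|_X:\gamma\in\Gamma_f\}$ (equal to $\infty$ if $\Gamma_f=\varnothing$), and $GaRo_X=\{f\in L^1(Q_0):\|f\|_{GaRo_X}<\infty\}$. This functional is invariant under adding constants to $f$. $T$ bounded in $GaRo_X$ means that there is a constant $C>0$ with $\|Tf\|_{GaRo_X}\le C\|f\|_{GaRo_X}$ for all $f\in GaRo_X$. *)

(* Defs.v *)
From HB Require Import structures.
From mathcomp Require Import all_boot all_order all_algebra.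
From mathcomp Require Import all_classical all_reals all_analysis.

Set Implicit Arguments.
Unset Strict Implicit.
Unset Printing Implicit Defensive.

Import Order.TTheory GRing.Theory Num.Theory.
Import numFieldNormedType.Exports.

Local Open Scope classical_set_scope.
Local Open Scope ring_scope.
Local Open Scope ereal_scope.

(* R^n is the type of n-tuples of reals; the library equips it with the
   product of the Borel sigma-algebras. *)
Notation Rn R n := (n.-tuple (measurableTypeR R)).

Section lebesgue_measure_step.
Context (R : realType) (n : nat).
Variable mu : {sigma_finite_measure set (Rn R n) -> \bar R}.

Definition Rn_cons (z : measurableTypeR R * Rn R n) : Rn R n.+1 :=
  [the n.+1.-tuple (measurableTypeR R) of z.1 :: z.2].

Lemma measurable_Rn_cons : measurable_fun setT Rn_cons.
Proof. exact: measurable_cons. Qed.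

Definition lebesgue_Rn_step : set (Rn R n.+1) -> \bar R :=
  pushforward ((@lebesgue_measure R) \x mu) Rn_cons.

Let step0 : lebesgue_Rn_step set0 = 0.
Proof. by rewrite /lebesgue_Rn_step /pushforward preimage_set0 measure0. Qed.

Let step_ge0 A : 0 <= lebesgue_Rn_step A.
Proof. by rewrite /lebesgue_Rn_step /pushforward; exact: measure_ge0. Qed.

Let step_sigma_additive : semi_sigma_additive lebesgue_Rn_step.
Proof.
move=> F mF tF mUF; rewrite /lebesgue_Rn_step /pushforward preimage_bigcup.
apply: measure_semi_sigma_additive.
- by move=> k; rewrite -[X in measurable X]setTI; exact: measurable_Rn_cons.
- apply/trivIsetP => /= i j _ _ ij; rewrite -preimage_setI.
  by move/trivIsetP : tF => /(_ _ _ _ _ ij) ->//; rewrite preimage_set0.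
- rewrite -preimage_bigcup -[X in measurable X]setTI.
  exact: measurable_Rn_cons.
Qed.

HB.instance Definition _ := isMeasure.Build _ _ _ lebesgue_Rn_step
  step0 step_ge0 step_sigma_additive.

Lemma sigma_finite_lebesgue_Rn_step : sigma_finite setT lebesgue_Rn_step.
Proof.
have [F FT Ffin] : sigma_finite setT ((@lebesgue_measure R) \x mu).
  have /sigma_finiteP[F [TF ndF Foo]] := sigma_finiteT (@lebesgue_measure R).
  have /sigma_finiteP[G [TG ndG Goo]] := sigma_finiteT mu.
  exists (fun k => F k `*` G k).
    rewrite -setXTT TF TG predeqE => -[x y]; split.
      move=> [/= [i _ Fix] [j _ Gjy]]; exists (maxn i j) => //; split.
      - by move: x Fix; exact/subsetPset/ndF/leq_maxl.
      - by move: y Gjy; exact/subsetPset/ndG/leq_maxr.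
    by move=> [k _ []/= ? ?]; split; exists k.
  move=> k; have [? ?] := Foo k; have [? ?] := Goo k.
  split; first exact: measurableX.
  by rewrite product_measure1E// lte_mul_pinfty// ge0_fin_numE.
pose unc (x : Rn R n.+1) : measurableTypeR R * Rn R n :=
  (thead x, [tuple of behead x]).
have munc : measurable_fun setT unc.
  apply/measurable_fun_pairP; split; last exact: measurable_behead.
  exact: measurable_tnth.
have uncK z : unc (Rn_cons z) = z.
  case: z => a b; rewrite /unc /Rn_cons /= theadE.
  by congr pair; exact: val_inj.
exists (fun k => unc @^-1` F k).
  by rewrite -preimage_bigcup -FT preimage_setT.
move=> k; have [mFk Fk] := Ffin k; split.
  by rewrite -[X in measurable X]setTI; exact: munc.
rewrite /lebesgue_Rn_step /pushforward -comp_preimage.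
by rewrite (_ : unc \o Rn_cons = id) ?preimage_id//; apply/funext.
Qed.

HB.instance Definition _ := Measure_isSigmaFinite.Build _ _ _
  lebesgue_Rn_step sigma_finite_lebesgue_Rn_step.

End lebesgue_measure_step.

Fixpoint lebesgue_Rn (R : realType) (n : nat) :
    {sigma_finite_measure set (Rn R n) -> \bar R} :=
  match n with
  | 0 => \d_([tuple] : Rn R 0)
  | m.+1 => lebesgue_Rn_step (lebesgue_Rn R m)
  end.

(* |[a_1, b_1] x ... x [a_n, b_n]| = (b_1 - a_1) ... (b_n - a_n) *)
Lemma lebesgue_Rn_box (R : realType) (n : nat) (a b : Rn R n) :
  (forall i, tnth a i <= tnth b i)%R ->
  lebesgue_Rn R n
    [set x | forall i, (tnth a i <= tnth x i <= tnth b i)%R] =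
  (\prod_(i < n) (tnth b i - tnth a i))%:E.
Proof.
elim: n a b => [|n IHn] a b ab.
  rewrite big_ord0 /= diracE mem_set//=; by case.
case/tupleP: a ab => a0 a; case/tupleP: b => b0 b ab.
have ab' i : (tnth a i <= tnth b i)%R.
  by have := ab (lift ord0 i); rewrite !tnthS.
have ab0 : (a0 <= b0)%R by have := ab ord0; rewrite !tnth0.
rewrite big_ord_recl !tnth0.
under eq_bigr do rewrite !tnthS.
rewrite EFinM -IHn//; set A := (X in _ = _ * lebesgue_Rn R n X).
rewrite /= /lebesgue_Rn_step /pushforward.
rewrite [X in product_measure1 _ _ X](_ : _ = `[a0, b0]%classic `*` A);
    last first.
  apply/seteqP; split => -[x y] /=.
    move=> H; split.
      by have := H ord0; rewrite !tnth0 in_itv.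
    by move=> i; have := H (lift ord0 i); rewrite /Rn_cons !tnthS.
  move=> [xab Ay] i; case: (unliftP ord0 i) => [j|] ->.
    by rewrite /Rn_cons !tnthS; exact: Ay.
  by move: xab; rewrite /Rn_cons /= !tnth0 in_itv.
rewrite product_measure1E//=; last first.
  rewrite (_ : A = \bigcap_(i in [set: 'I_n])
      ((fun x => tnth x i) @^-1` `[tnth a i, tnth b i]%classic)); last first.
    apply/seteqP; split => x /=.
      by move=> H i _; rewrite /= in_itv/=; exact: H.
    by move=> H i; have := H i I; rewrite /= in_itv.
  apply: fin_bigcap_measurable => // i _.
  by rewrite -[X in measurable X]setTI; exact: measurable_tnth.
congr (_ * _); rewrite lebesgue_measure_itv/= lte_fin.
case: ltP => [//|ba]; suff -> : a0 = b0 by rewrite subrr.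
by apply/eqP; rewrite eq_le ab0.
Qed.

Section cubes.
Context (R : realType) (n : nat).

Record cube := Cube {
  corner : Rn R n ;
  side : R ;
  side_gt0 : (0 < side)%R }.

Definition cube_set (Q : cube) : set (Rn R n) := [set x | forall i,
  (tnth (corner Q) i <= tnth x i <= tnth (corner Q) i + side Q)%R].

Definition cube_interior (Q : cube) : set (Rn R n) := [set x | forall i,
  (tnth (corner Q) i < tnth x i < tnth (corner Q) i + side Q)%R].

Definition subcube (Q Q0 : cube) : Prop := cube_set Q `<=` cube_set Q0.

Definition volume (Q : cube) : R := fine (lebesgue_Rn R n (cube_set Q)).

Lemma volumeE (Q : cube) : volume Q = (side Q ^+ n)%R.
Proof.
pose b : Rn R n := [tuple (tnth (corner Q) i + side Q)%R | i < n].
have := @lebesgue_Rn_box R n (corner Q) b.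
rewrite (_ : [set x | _ ] = cube_set Q); last first.
  by apply/seteqP; split => x H i; have := H i; rewrite tnth_mktuple.
rewrite /volume => -> => [|i]; last first.
  by rewrite tnth_mktuple lerDl ltW// side_gt0.
under eq_bigr do rewrite tnth_mktuple addrAC subrr add0r.
by rewrite /= prodr_const card_ord.
Qed.

End cubes.

Section function_spaces.
Context (R : realType) (n : nat) (Q0 : cube R n).

Let mu := lebesgue_Rn R n.

Definition in_L1 (f : Rn R n -> R) : Prop :=
  mu.-integrable (cube_set Q0) (EFin \o f).

Definition average (f : Rn R n -> R) (Q : cube R n) : R :=
  ((volume Q)^-1 * \int[mu]_(x in cube_set Q) f x)%R.

Definition BMO_norm (f : Rn R n -> R) : \bar R :=
  ereal_sup [set (volume Q)^-1%:E *
                 \int[mu]_(x in cube_set Q) `|f x - average f Q|%:E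
            | Q in [set Q | subcube Q Q0]].

Definition in_BMO (f : Rn R n -> R) : Prop := in_L1 f /\ BMO_norm f < +oo.

(* the norm of L^1(Q0) modulo constants *)
Definition L1_quotient_norm (f : Rn R n -> R) : \bar R :=
  ereal_inf [set \int[mu]_(x in cube_set Q0) `|f x - c|%:E | c in [set: R]].

(* Linear operators on L^1(Q0) modulo constants, which is also the sum of L^1
   and BMO modulo constants. T is given on representatives: linearity holds up
   to an additive constant (depending on the arguments) almost everywhere.
   Together with the first bound this makes T well defined on classes. *)
Definition bounded_on_L1_BMO (T : (Rn R n -> R) -> (Rn R n -> R)) : Prop :=
  [/\ forall f : Rn R n -> R, in_L1 f -> in_L1 (T f),
      forall (a : R) (f g : Rn R n -> R), in_L1 f -> in_L1 g ->
        exists c : R, {ae mu, forall x, cube_set Q0 x ->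
          T (fun y => a * f y + g y)%R x = (a * T f x + T g x + c)%R},
      exists2 C : R, (0 < C)%R & forall f : Rn R n -> R, in_L1 f ->
        L1_quotient_norm (T f) <= C%:E * L1_quotient_norm f
    & exists2 C : R, (0 < C)%R & forall f : Rn R n -> R, in_BMO f ->
        BMO_norm (T f) <= C%:E * BMO_norm f ].

Definition decreasing_rearrangement (f : Rn R n -> R) (t : R) : \bar R :=
  ereal_inf [set s%:E | s in [set s : R | (0 <= s)%R /\
    mu (cube_set Q0 `&` [set x | (s < `|f x|)%R]) <= t%:E]].

(* A function space X on Q0 is given by its norm N, extended by +oo outside
   X; functions are real-valued representatives of classes modulo equality
   almost everywhere on Q0, and their values outside Q0 are irrelevant. *)
Definition in_space (N : (Rn R n -> R) -> \bar R) (f : Rn R n -> R) : Prop :=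
  measurable_fun (cube_set Q0) f /\ N f < +oo.

Record is_banach_function_space (N : (Rn R n -> R) -> \bar R) : Prop := {
  bfs_ge0 : forall f : Rn R n -> R, in_space N f -> 0 <= N f ;
  bfs_eq0 : forall f : Rn R n -> R, in_space N f -> N f = 0 ->
    {ae mu, forall x, cube_set Q0 x -> f x = 0%R} ;
  bfs_scale : forall (a : R) (f : Rn R n -> R), in_space N f ->
    N (fun x => a * f x)%R = `|a|%:E * N f ;
  bfs_triangle : forall f g : Rn R n -> R, in_space N f -> in_space N g ->
    N (fun x => f x + g x)%R <= N f + N g ;
  bfs_ideal : forall f g : Rn R n -> R,
    measurable_fun (cube_set Q0) f -> in_space N g ->
    {ae mu, forall x, cube_set Q0 x -> (`|f x| <= `|g x|)%R} -> N f <= N g ;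
  bfs_complete : forall u : nat -> Rn R n -> R,
    (forall k, in_space N (u k)) ->
    (forall e : R, (0 < e)%R -> exists K : nat, forall i j : nat,
       (K <= i)%N -> (K <= j)%N -> N (fun x => u i x - u j x)%R < e%:E) ->
    exists2 f : Rn R n -> R, in_space N f
      & N (fun x => u k x - f x)%R @[k --> \oo] --> 0 ;
  bfs_Linfty_embed : exists C : R, forall (f : Rn R n -> R) (M : R),
    measurable_fun (cube_set Q0) f -> (0 <= M)%R ->
    {ae mu, forall x, cube_set Q0 x -> (`|f x| <= M)%R} -> N f <= (C * M)%:E ;
  bfs_L1_embed : exists C : R, forall f : Rn R n -> R, in_space N f ->
    \int[mu]_(x in cube_set Q0) `|f x|%:E <= C%:E * N f }.

Definition separable_space (N : (Rn R n -> R) -> \bar R) : Prop :=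
  exists2 u : nat -> Rn R n -> R, (forall k, in_space N (u k)) &
    forall f : Rn R n -> R, in_space N f -> forall e : R, (0 < e)%R ->
      exists k, N (fun x => f x - u k x)%R < e%:E.

Definition Fatou_property (N : (Rn R n -> R) -> \bar R) : Prop :=
  forall (u : nat -> Rn R n -> R) (f : Rn R n -> R),
    (forall k, measurable_fun (cube_set Q0) (u k)) -> in_space N f ->
    {ae mu, forall x, cube_set Q0 x ->
      [/\ forall k, (0 <= u k x)%R,
          forall k, (u k x <= u k.+1 x)%R
        & u k x @[k --> \oo] --> f x]} ->
    (forall k, N (u k) <= N (u k.+1)) /\ N (u k) @[k --> \oo] --> N f.

Definition rearrangement_invariant (N : (Rn R n -> R) -> \bar R) : Prop :=
  forall f g : Rn R n -> R, measurable_fun (cube_set Q0) f -> in_space N g ->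
    (forall t : R, (0 < t)%R ->
       decreasing_rearrangement f t = decreasing_rearrangement g t) ->
    in_space N f /\ N f = N g.

Definition is_ri_space (N : (Rn R n -> R) -> \bar R) : Prop :=
  [/\ is_banach_function_space N,
      separable_space N \/ Fatou_property N
    & rearrangement_invariant N ].

(* Countable families are (Q i) for i in D, with D an arbitrary set of
   natural numbers. *)
Definition packing (D : set nat) (Q : nat -> cube R n) : Prop :=
  (forall i, D i -> subcube (Q i) Q0) /\
  trivIset D (fun i => cube_interior (Q i)).

(* The sum of the integrals of g is the limit of its partial sums; it is
   absolutely convergent because g is integrable and the cubes do not
   overlap. *)
Definition Gamma_class (f : Rn R n -> R) : set (Rn R n -> R) :=
  [set g | in_L1 g /\ forall D Q, packing D Q ->
    \sum_(i <oo | i \in D) ((volume (Q i))^-1%:E *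
      \int[mu]_(x in cube_set (Q i))
        \int[mu]_(y in cube_set (Q i)) `|f x - f y|%:E)
    <= \sum_(i <oo | i \in D) \int[mu]_(x in cube_set (Q i)) (g x)%:E].

Definition GaRo_norm (N : (Rn R n -> R) -> \bar R) (f : Rn R n -> R) : \bar R :=
  ereal_inf [set N g | g in Gamma_class f].

Definition in_GaRo (N : (Rn R n -> R) -> \bar R) (f : Rn R n -> R) : Prop :=
  in_L1 f /\ GaRo_norm N f < +oo.

Definition bounded_on_GaRo (N : (Rn R n -> R) -> \bar R)
    (T : (Rn R n -> R) -> (Rn R n -> R)) : Prop :=
  exists2 C : R, (0 < C)%R & forall f : Rn R n -> R, in_GaRo N f ->
    GaRo_norm N (T f) <= C%:E * GaRo_norm N f.

End function_spaces.

(* Main.v *)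
Require Import Defs.
From mathcomp Require Import all_boot all_order all_algebra.
From mathcomp Require Import all_classical all_reals all_analysis.
From mathcomp Require Import measurable_realfun ring lra zify.

(** Write O(f, Q) for the integral over Q of |f - f_Q|.  Up to a factor 2 it is
the summand of the Garsia-Rodemich condition, and since the condition may be
summed over a packing, gamma belongs to Gamma_f as soon as (up to a constant)
O(f, Q) is at most the integral of gamma over each subcube Q.

Let gamma be in Gamma_f and lambda_i = lambda_0 2^i with lambda_0 slightly
above the L^1 norm of gamma.  A Whitney-type stopping-time decomposition of
the set where the maximal function of gamma is large gives f = b_i + g_i with
|b_i|_1 <= C J_i and |g_i|_BMO <= C lambda_i, where J_i is the integral of
gamma over {gamma > lambda_i}.  Let k_{j+1} be the first index after k_j at
which J has dropped to at most half of J_{k_j}; the pieces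
f_j = g_{k_{j+1}} - g_{k_j} satisfy |f_j|_1 <= C J_{k_j} and
|f_j|_BMO <= C lambda_{k_{j+1}}, and so do the T f_j.  Since k_{j+1} is minimal,
J_{k_j} is at most a constant times the integral of gamma over
{lambda_{k_{j+1}-1} < gamma <= lambda_{k_{j+2}}}.

The norm of X need not be monotone for the Hardy-Littlewood-Polya order, so it
does not suffice to majorize T f_j by a bounded function with the right
integral.  Instead, for h = T f_j with |h|_BMO <= B, O(h, Q) is controlled by
the integral over Q of min(|h|, 4 B) plus a function that handles very small
cubes; min(|h|, 4 B) is then replaced by a sum of lambda_i times indicators of sets A_i whose
measure is at most that of a layer of gamma and which are spread out finely
enough to have the same integral over all cubes that are not small.  Summing
over j and keeping at each point only the largest level gives a function whose
decreasing rearrangement is dominated by that of gamma. *)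

Set Implicit Arguments.
Unset Strict Implicit.
Unset Printing Implicit Defensive.

Import Order.TTheory GRing.Theory Num.Theory.
Import numFieldNormedType.Exports.

Local Open Scope classical_set_scope.
Local Open Scope ring_scope.

(** * Integrals of real-valued functions *)

(** The bounds on [T] give only the total size of T f_j in L^1 and BMO and do not locate its mass.
    So the majorant is built from T f_j itself, and only its distribution is compared with that of
    gamma. The halving finds the right layers: J keeps at least half of J_{k_j} at index k_{j+1}-1
    and at most a quarter at k_{j+2}, so the layers in between account for at least a quarter of
    J_{k_j}. Their levels are at least half of lambda_{k_{j+1}}, hence comparable to or above the
    BMO bound of T f_j; this leaves room in every cube for sets at these levels that reproduce the
    truncated mass. A layer is used by at most two j, each of which is allotted half of its measure.
    Telescoping leaves two terms: b_{k_m}, whose image tends to 0 in L^1 modulo constants, and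
    g_{k_0}, whose image has BMO norm at most about |gamma|_1. The latter costs a constant function,
    paid for by the embeddings of L^infty into X and of X into L^1. All constructions stop at a
    finite dyadic depth; approximation by step functions takes the place of Lebesgue
    differentiation. *)

Lemma cvge_ex_lt (R : realType) (f : nat -> \bar R) (l y : \bar R) :
  f @ \oo --> l -> (l < y)%E -> exists N, (f N < y)%E.
Proof.
move=> fl ly; have [N _ fN] := fl _ (open_ereal_lt' ly).
by exists N; apply: fN => /=.
Qed.

Section real_integral.
Context d (T : measurableType d) (R : realType).
Variable mu : {measure set T -> \bar R}.
Implicit Types (A B : set T) (u v : T -> R).

Definition L1 A u : Prop := mu.-integrable A (EFin \o u).

Lemma L1_measurable A u : L1 A u -> measurable_fun A u.
Proof. by move=> /(measurable_int mu)/measurable_EFinP. Qed.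

Lemma L1S A B u : measurable A -> measurable B -> A `<=` B -> L1 B u -> L1 A u.
Proof. by move=> mA mB AB; exact: integrableS. Qed.

Lemma L1D A u v : measurable A -> L1 A u -> L1 A v ->
  L1 A (fun x => u x + v x).
Proof. by move=> mA Lu Lv; exact: (integrableD mA Lu Lv). Qed.

Lemma L1B A u v : measurable A -> L1 A u -> L1 A v ->
  L1 A (fun x => u x - v x).
Proof. by move=> mA Lu Lv; exact: (integrableB mA Lu Lv). Qed.

Lemma L1Z A r u : measurable A -> L1 A u -> L1 A (fun x => r * u x).
Proof. by move=> mA Lu; exact: (integrableZl mA r Lu). Qed.

Lemma L1_norm A u : L1 A u -> L1 A (fun x => `|u x|).
Proof. exact: integrable_norm. Qed.

Lemma L1_bounded A u (M : R) : measurable A -> (mu A < +oo)%E ->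
  measurable_fun A u -> (forall x, A x -> `|u x| <= M) -> L1 A u.
Proof.
move=> mA A_fin mu_ uM; apply: measurable_bounded_integrable => //.
exists M; split; first exact: num_real.
by move=> y /ltW My x Ax; exact: le_trans (uM x Ax) My.
Qed.

Lemma L1_cst A (r : R) : measurable A -> (mu A < +oo)%E -> L1 A (fun=> r).
Proof. by move=> mA Afin; apply: (@L1_bounded _ _ `|r|). Qed.

Lemma L1_le A u v : measurable A -> measurable_fun A u ->
  (forall x, A x -> `|u x| <= v x) -> L1 A v -> L1 A u.
Proof.
move=> mA mu_ uv Lv; apply: le_integrable Lv => //; first exact/measurable_EFinP.
move=> x Ax /=; rewrite lee_fin; exact: le_trans (uv x Ax) (ler_norm _).
Qed.

Lemma L1_indicM A B u : measurable A -> measurable B -> L1 A u ->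
  L1 A (fun x => u x * \1_B x).
Proof.
move=> mA mB Lu; apply: L1_le (L1_norm Lu) => //.
  by apply: measurable_funM (L1_measurable Lu) _; exact: measurable_indic.
move=> x _; rewrite normrM ler_piMr// indicE ger0_norm//.
by case: (_ \in _).
Qed.

Lemma L1_indicM_setI A B u : measurable A -> measurable B -> L1 (A `&` B) u ->
  L1 A (fun x => u x * \1_B x).
Proof.
move=> mA mB Lu; have : mu.-integrable A ((EFin \o u) \_ B).
  exact/integrable_restrict.
apply: eq_integrable => // x _ /=; rewrite patchE indicE.
by case: ifPn; rewrite (mulr1, mulr0).
Qed.

Lemma L1_sum A (I : Type) (s : seq I) (F : I -> T -> R) : measurable A ->
  (forall i, L1 A (F i)) -> L1 A (fun x => \sum_(i <- s) F i x).
Proof.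
move=> mA LF; have := @integrable_sum _ _ _ mu _ mA _ s predT
  (fun i => EFin \o F i) (fun i _ => LF i).
by apply: eq_integrable => // x _ /=; rewrite sumEFin.
Qed.

Lemma Rintegral_sum A (I : Type) (s : seq I) (F : I -> T -> R) :
  measurable A -> (forall i, L1 A (F i)) ->
  \int[mu]_(x in A) (\sum_(i <- s) F i x) =
  \sum_(i <- s) \int[mu]_(x in A) F i x.
Proof.
move=> mA LF; elim: s => [|i s IH].
  rewrite big_nil; under eq_Rintegral do rewrite big_nil.
  by rewrite Rintegral_cst// mul0r.
under eq_Rintegral do rewrite big_cons.
by rewrite big_cons RintegralD ?IH//; [exact: LF | exact: L1_sum].
Qed.

Lemma Rintegral_indicM A B u :
  \int[mu]_(x in A) (u x * \1_B x) = \int[mu]_(x in A `&` B) u x.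
Proof.
rewrite Rintegral_mkcondr; apply: eq_Rintegral => x _.
by rewrite patchE indicE; case: ifPn => _; rewrite (mulr1, mulr0).
Qed.

Lemma Rintegral_indic A B : measurable A -> measurable B ->
  \int[mu]_(x in A) \1_B x = fine (mu (A `&` B)).
Proof. by move=> mA mB; rewrite /Rintegral integral_indic// setIC. Qed.

Lemma le_Rintegral_subset A B u : measurable A -> measurable B ->
  A `<=` B -> L1 B u -> (forall x, B x -> 0 <= u x) ->
  \int[mu]_(x in A) u x <= \int[mu]_(x in B) u x.
Proof.
move=> mA mB AB Lu u0; rewrite fine_le//.
- by apply: integrable_fin_num => //; exact: integrableS Lu.
- exact: integrable_fin_num.
- apply: ge0_subset_integral => //; first exact: measurable_int Lu.
Qed.

Lemma Rintegral_setD_null A B u : measurable A -> measurable B -> L1 A u ->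
  mu B = 0%E -> \int[mu]_(x in A) u x = \int[mu]_(x in A `\` B) u x.
Proof.
by move=> mA mB Lu B0; rewrite /Rintegral (negligible_integral mB mA Lu B0).
Qed.

Lemma L1_EFin A u : measurable A -> L1 A u ->
  (\int[mu]_(x in A) (u x)%:E)%E = (\int[mu]_(x in A) u x)%:E.
Proof. by move=> mA Lu; rewrite fineK//; exact: integrable_fin_num. Qed.

Lemma L1_of_norm A u (M : \bar R) : measurable A -> measurable_fun A u ->
  (\int[mu]_(x in A) `|u x|%:E <= M)%E -> (M < +oo)%E -> L1 A u.
Proof.
move=> mA mu_ uM Mfin; apply/integrableP; split; first exact/measurable_EFinP.
exact: le_lt_trans uM Mfin.
Qed.

Lemma ae_eq_Rintegral A u v : measurable A -> L1 A u -> L1 A v ->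
  {ae mu, forall x, A x -> u x = v x} ->
  \int[mu]_(x in A) u x = \int[mu]_(x in A) v x.
Proof.
move=> mA Lu Lv uv; congr fine; apply: ae_eq_integral => //.
- exact: measurable_int Lu.
- exact: measurable_int Lv.
- by apply: filterS uv => x uv Ax; rewrite uv.
Qed.

Lemma ae_le_Rintegral A u v : measurable A -> L1 A u -> L1 A v ->
  {ae mu, forall x, A x -> u x <= v x} ->
  \int[mu]_(x in A) u x <= \int[mu]_(x in A) v x.
Proof.
move=> mA Lu Lv uv.
(* [v] agrees almost everywhere with [max u v], which dominates [u] at every point. *)
have -> : \int[mu]_(x in A) v x = \int[mu]_(x in A) Num.max (u x) (v x).
  apply: ae_eq_Rintegral => //; last first.
    by apply: filterS uv => x uv Ax; rewrite (max_idPr (uv Ax)).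
  apply: (@L1_le _ _ (fun x => `|u x| + `|v x|)) => //.
  - by apply: measurable_maxr; exact: L1_measurable.
  - move=> x _; rewrite /Num.max; case: ifP => _; rewrite (lerDl, lerDr)//.
  - by apply: L1D => //; exact: L1_norm.
apply: le_Rintegral => //; last by move=> x _; rewrite le_max lexx.
apply: (@L1_le _ _ (fun x => `|u x| + `|v x|)) => //.
- by apply: measurable_maxr; exact: L1_measurable.
- by move=> x _; rewrite /Num.max; case: ifP => _; rewrite (lerDl, lerDr).
- by apply: L1D => //; exact: L1_norm.
Qed.

Lemma measure_bigsetU_le (I : Type) (s : seq I) (B : I -> set T) :
  (forall i, measurable (B i)) ->
  (mu (\big[setU/set0]_(i <- s) B i) <= \sum_(i <- s) mu (B i))%E.
Proof.
move=> mB; elim: s => [|i s IH]; first by rewrite !big_nil measure0.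
rewrite !big_cons; apply: le_trans (measureU2 mu (mB i) _) _.
  exact: bigsetU_measurable.
exact: leeD2l.
Qed.

End real_integral.

(** * Cubes and dyadic children *)

Section cube_geometry.
Context (R : realType) (n : nat).
Local Notation mu := (lebesgue_Rn R n).
Implicit Types (Q p : cube R n) (x y : Rn R n).

Lemma measurable_coordwise (P : 'I_n -> set R) :
  (forall i, measurable (P i : set (measurableTypeR R))) ->
  measurable [set x : Rn R n | forall i, P i (tnth x i)].
Proof.
move=> mP; rewrite (_ : [set x | _] = \bigcap_(i in [set: 'I_n])
    ((fun x : Rn R n => tnth x i) @^-1` P i)); last first.
  apply/seteqP; split => x /= Px; first by move=> i _; exact: Px.
  by move=> i; exact: Px.
apply: fin_bigcap_measurable => // i _.
by rewrite -[X in measurable X]setTI; exact: measurable_tnth.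
Qed.

Lemma measurable_coord (i : 'I_n) (P : set R) :
  measurable (P : set (measurableTypeR R)) ->
  measurable [set x : Rn R n | P (tnth x i)].
Proof.
by move=> mP; rewrite -[X in measurable X]setTI; exact: measurable_tnth.
Qed.

Lemma measurable_le_le (a b : R) :
  measurable ([set t | a <= t <= b] : set (measurableTypeR R)).
Proof.
rewrite (_ : [set t | _] = `[a, b]%classic)//.
Qed.

Lemma measurable_cube Q : measurable (cube_set Q).
Proof.
apply: (measurable_coordwise (P := fun i =>
  [set t | tnth (corner Q) i <= t <= tnth (corner Q) i + side Q])) => i.
exact: measurable_le_le.
Qed.
Hint Resolve measurable_cube : core.

Lemma mu_cube Q : mu (cube_set Q) = (side Q ^+ n)%:E.
Proof.
pose b : Rn R n := [tuple (tnth (corner Q) i + side Q) | i < n].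
have := @lebesgue_Rn_box R n (corner Q) b.
rewrite (_ : [set x | _ ] = cube_set Q); last first.
  by apply/seteqP; split => x H i; have := H i; rewrite tnth_mktuple.
move=> -> => [|i]; last by rewrite tnth_mktuple lerDl ltW// side_gt0.
under eq_bigr do rewrite tnth_mktuple addrAC subrr add0r.
by rewrite /= prodr_const card_ord.
Qed.

Lemma mu_cube_fin Q : (mu (cube_set Q) < +oo)%E.
Proof. by rewrite mu_cube ltry. Qed.
Hint Resolve mu_cube_fin : core.

Lemma volume_gt0 Q : 0 < volume Q.
Proof. by rewrite volumeE exprn_gt0// side_gt0. Qed.
Hint Resolve volume_gt0 : core.

Lemma mu_volume Q : mu (cube_set Q) = (volume Q)%:E.
Proof. by rewrite mu_cube volumeE. Qed.

Lemma volume_ge0 Q : 0 <= volume Q.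
Proof. exact: ltW. Qed.

Lemma Rintegral_cube_cst Q (c : R) :
  \int[mu]_(_ in cube_set Q) c = c * volume Q.
Proof. by rewrite Rintegral_cst// mu_volume. Qed.

Lemma corner_in_cube Q : cube_set Q (corner Q).
Proof. by move=> i; rewrite lexx lerDl ltW// side_gt0. Qed.

Lemma subcube_side Q p (n_gt0 : (0 < n)%N) : subcube Q p -> side Q <= side p.
Proof.
move=> Qp; have s0 := side_gt0 Q.
pose y : Rn R n := [tuple (tnth (corner Q) i + side Q) | i < n].
have Qy : cube_set Q y by move=> i; rewrite tnth_mktuple lexx lerDl ltW.
have := Qp _ Qy (Ordinal n_gt0); have := Qp _ (@corner_in_cube Q) (Ordinal n_gt0).
by rewrite tnth_mktuple; lra.
Qed.

(** The intersection is a box with one edge of length at most b - a. The case a = b gives null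
    faces; thin slabs absorb the jumps of half-space indicators and yield the Lipschitz bound behind
    the slicing of sets. *)
Lemma mu_slab Q (i : 'I_n) (a b : R) : a <= b ->
  (mu (cube_set Q `&` [set x | (a <= tnth x i <= b)%R]) <=
   ((b - a) * side Q ^+ n.-1)%:E)%E.
Proof.
move=> ab; set c := corner Q; set s := side Q; have s0 : 0 < s := side_gt0 Q.
pose lo : Rn R n := [tuple if j == i then Num.max (tnth c j) a else tnth c j | j < n].
pose up : Rn R n := [tuple if j == i then Num.min (tnth c j + s) b
                           else tnth c j + s | j < n].
have setE : cube_set Q `&` [set x | (a <= tnth x i <= b)%R] =
    [set x | forall j, (tnth lo j <= tnth x j <= tnth up j)%R].
  apply/seteqP; split => x /=.
    move=> [Qx xab] j; rewrite !tnth_mktuple; case: eqP => [->|_]; last exact: Qx.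
    have := Qx i; rewrite ge_max le_min -/c -/s.
    by move: xab => /andP[-> ->] /andP[-> ->].
  move=> H; split.
    move=> j; have := H j; rewrite !tnth_mktuple; case: eqP => [->|_] //.
    by rewrite ge_max le_min => /andP[/andP[-> _] /andP[-> _]].
  have := H i; rewrite !tnth_mktuple eqxx ge_max le_min.
  by move=> /andP[/andP[_ ->] /andP[_ ->]].
have [loup|uplo] := leP (tnth lo i) (tnth up i); last first.
  rewrite setE [X in mu X](_ : _ = set0) ?measure0 ?lee_fin; last first.
    apply/seteqP; split => // x /(_ i) /andP[lox xup].
    by have := lt_le_trans uplo lox; rewrite ltNge xup.
  by rewrite mulr_ge0 ?subr_ge0// exprn_ge0// ltW.
rewrite setE lebesgue_Rn_box => [|j]; last first.
  have [->//|ji] := eqVneq j i; rewrite !tnth_mktuple (negbTE ji).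
  by rewrite lerDl ltW.
rewrite lee_fin (bigD1 i)//=.
rewrite (eq_bigr (fun=> s)) => [|j ji]; last first.
  by rewrite !tnth_mktuple (negbTE ji) addrAC subrr add0r.
rewrite prodr_const (_ : #|_| = n.-1); last first.
  by rewrite -[in RHS](card_ord n) -(cardC1 i); apply: eq_card => j; rewrite !inE.
apply: ler_wpM2r; first by rewrite exprn_ge0// ltW.
rewrite !tnth_mktuple eqxx lerB//.
  by rewrite ge_min lexx orbT.
by rewrite le_max lexx orbT.
Qed.

Definition child Q (e : {ffun 'I_n -> bool}) : cube R n :=
  @Cube R n [tuple (tnth (corner Q) i + (if e i then side Q / 2 else 0)) | i < n]
    (side Q / 2) (divr_gt0 (side_gt0 Q) (ltr0n _ 2)).

(** Children are closed and share faces. This assigns every point of Q to exactly one child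
    containing it, the upper one on a shared face, so that functions can be defined child by
    child. *)
Definition half_of Q x : {ffun 'I_n -> bool} :=
  [ffun i => tnth (corner Q) i + side Q / 2 <= tnth x i].

Lemma side_child Q e : side (child Q e) = side Q / 2.
Proof. by []. Qed.

Lemma volume_child Q e : volume (child Q e) = volume Q / 2 ^+ n.
Proof. by rewrite !volumeE side_child expr_div_n. Qed.

Lemma child_subcube Q e : subcube (child Q e) Q.
Proof.
have s0 := side_gt0 Q.
by move=> x cx i; have := cx i; rewrite /= tnth_mktuple; case: (e i); lra.
Qed.

Lemma half_of_child Q x : cube_set Q x -> cube_set (child Q (half_of Q x)) x.
Proof.
have s0 := side_gt0 Q.
move=> Qx i; have := Qx i; rewrite /= tnth_mktuple ffunE.
by case: ifPn; rewrite -?ltNge; lra.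
Qed.

Lemma measurable_half_of Q e : measurable [set x : Rn R n | half_of Q x = e].
Proof.
pose m i := tnth (corner Q) i + side Q / 2.
rewrite (_ : [set x | _] = [set x | forall i,
    [set t : R | (m i <= t) = e i] (tnth x i)]); last first.
  apply/seteqP; split => x /=; first by move=> <- i; rewrite ffunE.
  by move=> H; apply/ffunP => i; rewrite ffunE; exact: H.
apply: (measurable_coordwise (P := fun i => [set t | (m i <= t) = e i])) => i.
case: (e i).
  rewrite (_ : [set t | _] = `[m i, +oo[%classic) //; last first.
  by apply/seteqP; split => t /=; rewrite in_itv/= andbT.
rewrite (_ : [set t | _] = `]-oo, m i[%classic)//.
by apply/seteqP; split => t /=; rewrite in_itv/= ltNge; [move=> ->|move/negbTE].
Qed.

(** A point of a child that is assigned to another child lies on a middle hyperplane of Q, a slab of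
    width zero. *)
Lemma child_half_of_null Q e :
  mu (cube_set (child Q e) `&` ~` [set x | half_of Q x = e]) = 0%E.
Proof.
pose m i := tnth (corner Q) i + side Q / 2.
pose B i := cube_set Q `&` [set x : Rn R n | (m i <= tnth x i <= m i)%R].
have mB i : measurable (B i).
  apply: measurableI => //.
  exact: (@measurable_coord i _ (measurable_le_le (m i) (m i))).
have B0 i : mu (B i) = 0%E.
  apply/eqP; rewrite eq_le measure_ge0 andbT.
  by apply: le_trans (mu_slab Q i (lexx (m i))) _; rewrite subrr mul0r.
apply: (@subset_measure0 _ _ _ _ _ (\bigcup_(i in [set: 'I_n]) B i)).
- by apply: measurableI => //; apply: measurableC; exact: measurable_half_of.
- exact: fin_bigcup_measurable.
- move=> x [cx] /= /eqP xe.
  have [i xi] : exists i, half_of Q x i != e i.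
    apply/existsP; rewrite -negb_forall; apply: contraNN xe => /forallP H.
    by apply/eqP/ffunP => i; exact/eqP.
  exists i => //; split; first exact: child_subcube cx.
  move: xi; rewrite /= ffunE; have := cx i; rewrite /= tnth_mktuple -/(m i).
  have s0 := side_gt0 Q.
  case: (e i).
    by move=> /andP[-> _].
  by rewrite eqbF_neg negbK addr0 -/(m i) => /andP[_ ->] ->.
- apply/eqP; rewrite eq_le measure_ge0 andbT.
  rewrite (_ : \bigcup_(i in _) _ = \big[setU/set0]_(i <- enum 'I_n) B i).
    apply: le_trans (measure_bigsetU_le _ _ mB) _.
    by rewrite big1// => i _; exact: B0.
  rewrite -bigcup_seq; apply/seteqP; split => x [i _ Bx]; exists i => //=.
  by rewrite mem_enum.
Qed.

End cube_geometry.
#[global] Hint Extern 0 (measurable (cube_set _)) =>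
  solve [exact: measurable_cube] : core.
#[global] Hint Extern 0 (is_true (_ < +oo)%E) =>
  solve [exact: mu_cube_fin] : core.
#[global] Hint Extern 0 (is_true (0 < volume _)) =>
  solve [exact: volume_gt0] : core.
#[global] Hint Extern 0 (is_true (0 <= volume _)) =>
  solve [exact: volume_ge0] : core.

Section dyadic_children.
Context (R : realType) (n : nat).
Local Notation mu := (lebesgue_Rn R n).
Local Notation L1 := (L1 mu).
Implicit Types (Q p : cube R n) (x y : Rn R n).

(** The integrand may have a different formula on each child, as happens for the recursively defined
    averages over stopping cubes. *)
Lemma L1_children_piecewise Q (F : Rn R n -> R)
    (G : {ffun 'I_n -> bool} -> Rn R n -> R) :
  (forall e, L1 (cube_set (child Q e)) (G e)) ->
  (forall x, cube_set Q x -> F x = G (half_of Q x) x) ->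
  L1 (cube_set Q) F /\ \int[mu]_(x in cube_set Q) F x =
                       \sum_e \int[mu]_(x in cube_set (child Q e)) G e x.
Proof.
move=> LG FG; pose H e := [set x | half_of Q x = e].
have mH e : measurable (H e) by exact: measurable_half_of.
have mQH e : measurable (cube_set Q `&` H e) by exact: measurableI.
have QHc e : cube_set Q `&` H e `<=` cube_set (child Q e).
  by move=> x [Qx <-]; exact: half_of_child.
have LGH e : L1 (cube_set Q) (fun x => G e x * \1_(H e) x).
  apply: L1_indicM_setI => //.
  exact: L1S (mQH e) (measurable_cube _) (@QHc e) (LG e).
have FE : {in cube_set Q, F =1 fun x => \sum_e G e x * \1_(H e) x}.
  move=> x /set_mem Qx; rewrite FG// (bigD1 (half_of Q x))//= big1 ?addr0.
    by rewrite indicE mem_set ?mulr1.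
  by move=> e /eqP ne; rewrite indicE memNset ?mulr0// => /esym.
have LS : L1 (cube_set Q) (fun x => \sum_e G e x * \1_(H e) x).
  exact: L1_sum.
split.
  by apply: eq_integrable LS => // x xQ /=; rewrite FE.
rewrite (eq_Rintegral _ FE) Rintegral_sum//; apply: eq_bigr => e _.
rewrite Rintegral_indicM.
rewrite (Rintegral_setD_null _ _ (LG e) (child_half_of_null Q e))//; last first.
  apply: measurableI => //; exact: measurableC (mH e).
congr (Rintegral _ _ _); apply/seteqP; split => x.
  by move=> Qx; split; [exact: QHc | case=> _; apply; exact: Qx.2].
move=> [cx xN]; split; first exact: child_subcube cx.
by apply: contrapT => Hx; exact: xN.
Qed.

Lemma L1_child Q e (F : Rn R n -> R) :
  L1 (cube_set Q) F -> L1 (cube_set (child Q e)) F.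
Proof. by apply: L1S => //; exact: child_subcube. Qed.

Lemma Rintegral_children Q (F : Rn R n -> R) : L1 (cube_set Q) F ->
  \int[mu]_(x in cube_set Q) F x =
  \sum_e \int[mu]_(x in cube_set (child Q e)) F x.
Proof.
move=> LF; apply: (proj2 (@L1_children_piecewise Q F (fun=> F) _ _)) => // e.
exact: L1_child.
Qed.

End dyadic_children.

(** * Mean oscillation and the Garsia-Rodemich summand *)

Section mean_oscillation.
Context (R : realType) (n : nat).
Local Notation mu := (lebesgue_Rn R n).
Local Notation L1 := (L1 mu).
Implicit Types (Q p : cube R n) (f g : Rn R n -> R).

Definition mosc f Q : R := \int[mu]_(x in cube_set Q) `|f x - average f Q|.

Lemma L1_norm_sub f Q (c : R) : L1 (cube_set Q) f ->
  L1 (cube_set Q) (fun x => `|f x - c|).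
Proof.
by move=> Lf; apply: L1_norm; apply: L1B => //; exact: L1_cst.
Qed.

Lemma averageE f Q : average f Q * volume Q = \int[mu]_(x in cube_set Q) f x.
Proof. by rewrite /average mulrAC mulVf ?mul1r// gt_eqF. Qed.

Lemma average_sub_le f Q (c : R) : L1 (cube_set Q) f ->
  `|average f Q - c| * volume Q <= \int[mu]_(x in cube_set Q) `|f x - c|.
Proof.
move=> Lf; rewrite -[X in _ * X](ger0_norm (volume_ge0 Q)) -normrM mulrBl averageE.
rewrite -Rintegral_cube_cst -RintegralB//; last exact: L1_cst.
by apply: le_normr_Rintegral => //; apply: L1B => //; exact: L1_cst.
Qed.

(** The average is, up to a factor 2, the best approximating constant, so oscillation may be
    estimated around any convenient [c]. *)
Lemma mosc_le f Q (c : R) : L1 (cube_set Q) f ->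
  mosc f Q <= 2 * \int[mu]_(x in cube_set Q) `|f x - c|.
Proof.
move=> Lf; rewrite mulr2n mulrDl mul1r.
apply: (@le_trans _ _ (\int[mu]_(x in cube_set Q)
    (`|f x - c| + `|average f Q - c|))).
  apply: le_Rintegral => //; first exact: L1_norm_sub.
    by apply: L1D => //; [exact: L1_norm_sub | exact: L1_cst].
  by move=> x _; rewrite (distrC (average f Q)) (le_trans _ (ler_normD _ _))//
    subrKA.
rewrite RintegralD//; [|exact: L1_norm_sub|exact: L1_cst].
by rewrite lerD2l Rintegral_cube_cst average_sub_le.
Qed.

Lemma averageD f g Q : L1 (cube_set Q) f -> L1 (cube_set Q) g ->
  average (fun x => f x + g x) Q = average f Q + average g Q.
Proof. by move=> Lf Lg; rewrite /average RintegralD// mulrDr. Qed.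

Lemma averageZ (r : R) f Q : L1 (cube_set Q) f ->
  average (fun x => r * f x) Q = r * average f Q.
Proof. by move=> Lf; rewrite /average RintegralZl// mulrCA. Qed.

Lemma average_cst (c : R) Q : average (fun=> c) Q = c.
Proof. by rewrite /average Rintegral_cube_cst mulrCA mulVf ?mulr1// gt_eqF. Qed.

Lemma mosc_cst (c : R) Q : mosc (fun=> c) Q = 0.
Proof.
rewrite /mosc average_cst (@eq_Rintegral _ _ _ _ _ (fun=> 0)) => [|x _].
  by rewrite Rintegral_cube_cst mul0r.
by rewrite subrr normr0.
Qed.

Lemma moscD f g Q : L1 (cube_set Q) f -> L1 (cube_set Q) g ->
  mosc (fun x => f x + g x) Q <= mosc f Q + mosc g Q.
Proof.
move=> Lf Lg; rewrite /mosc averageD// -RintegralD//; try exact: L1_norm_sub.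
apply: le_Rintegral => //; first by apply: L1_norm_sub; exact: L1D.
  by apply: L1D => //; exact: L1_norm_sub.
by move=> x _; rewrite opprD addrACA ler_normD.
Qed.

Lemma moscZ (r : R) f Q : L1 (cube_set Q) f ->
  mosc (fun x => r * f x) Q = `|r| * mosc f Q.
Proof.
move=> Lf; rewrite /mosc averageZ// -RintegralZl//; last exact: L1_norm_sub.
by apply: eq_Rintegral => x _; rewrite -mulrBr normrM.
Qed.

Lemma mosc_addc f (c : R) Q : L1 (cube_set Q) f ->
  mosc (fun x => f x + c) Q = mosc f Q.
Proof.
move=> Lf; rewrite /mosc averageD ?average_cst//; last exact: L1_cst.
by apply: eq_Rintegral => x _; rewrite opprD addrACA subrr addr0.
Qed.

Lemma mosc_ae f g Q : L1 (cube_set Q) f -> L1 (cube_set Q) g ->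
  {ae mu, forall x, cube_set Q x -> f x = g x} -> mosc f Q = mosc g Q.
Proof.
move=> Lf Lg fg; have avfg : average f Q = average g Q.
  by rewrite /average (ae_eq_Rintegral _ Lf Lg).
rewrite /mosc avfg; apply: ae_eq_Rintegral => //; try exact: L1_norm_sub.
by apply: filterS fg => x fg /fg ->.
Qed.

Lemma average_mosc f Q p : subcube Q p -> L1 (cube_set p) f ->
  `|average f Q - average f p| * volume Q <= mosc f p.
Proof.
move=> Qp Lf; apply: le_trans (average_sub_le _ _) _; first exact: L1S Lf.
by apply: le_Rintegral_subset => //; exact: L1_norm_sub.
Qed.

Local Open Scope ereal_scope.

Lemma measurable_dist_prod f Q : L1 (cube_set Q) f ->
  measurable_fun (cube_set Q `*` cube_set Q)
    (fun z : Rn R n * Rn R n => `|f z.1 - f z.2|%:E).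
Proof.
move=> Lf; have mf := L1_measurable Lf.
have mQ := measurable_cube Q.
have mQQ : measurable (cube_set Q `*` cube_set Q) by exact: measurableX.
apply/measurable_EFinP; apply: measurableT_comp => //.
apply: measurable_funB.
  apply: (measurable_comp (F := cube_set Q) mQ _ mf).
    by move=> _ [z [? ?] <-].
  exact: measurable_funTS measurable_fst.
apply: (measurable_comp (F := cube_set Q) mQ _ mf).
  by move=> _ [z [? ?] <-].
exact: measurable_funTS measurable_snd.
Qed.

Lemma measurable_dist_integral f Q : L1 (cube_set Q) f ->
  measurable_fun (cube_set Q)
    (fun x => \int[mu]_(y in cube_set Q) `|f x - f y|%:E).
Proof.
move=> Lf; have mQ := measurable_cube Q.
(* Tonelli measurability is applied on the whole product space, hence the extension by zero. *)
pose k := (fun z : Rn R n * Rn R n => `|f z.1 - f z.2|%:E) \_ (cube_set Q `*` cube_set Q).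
have mk : measurable_fun setT k.
  by apply/(measurable_restrictT _ _).1; [exact: measurableX|exact: measurable_dist_prod].
have k0 z : 0 <= k z by rewrite /k patchE; case: ifP.
have mF := @measurable_fun_fubini_tonelli_F _ _ _ _ _ mu k mk k0.
apply: eq_measurable_fun (measurable_funTS mF) => x xQ.
rewrite /fubini_F [RHS]integral_mkcond; apply: eq_integral => y _.
rewrite /k !patchE; congr (if _ then _ else _).
apply/idP/idP; rewrite !inE; first by case.
by move=> Qy; split => //; exact/set_mem.
Qed.

(** Pointwise in x, |f x - f_Q| is at most the mean over y of |f x - f y|. *)
Lemma mosc_le_double f Q : L1 (cube_set Q) f ->
  (mosc f Q)%:E <= (volume Q)^-1%:E * \int[mu]_(x in cube_set Q)
    \int[mu]_(y in cube_set Q) `|f x - f y|%:E.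
Proof.
move=> Lf; rewrite /mosc -L1_EFin//; last exact: L1_norm_sub.
rewrite -ge0_integralZl//; first last.
- by rewrite lee_fin invr_ge0.
- by move=> x _; exact: integral_ge0.
- exact: measurable_dist_integral.
apply: ge0_le_integral => //.
- exact: measurable_int (L1_norm_sub _ Lf).
- by apply: measurable_funeM; exact: measurable_dist_integral.
move=> x Qx; rewrite L1_EFin//; last first.
  by apply: L1_norm; apply: L1B => //; exact: L1_cst.
rewrite -EFinM lee_fin ler_pdivlMl//.
have := @average_sub_le f Q (f x) Lf; rewrite distrC mulrC => /le_trans; apply.
by under eq_Rintegral do rewrite distrC.
Qed.

(** The triangle inequality through [c]. With [mosc_le_double] it makes [mosc] and the
    Garsia-Rodemich summand equivalent. *)
Lemma double_le f Q (c : R) : L1 (cube_set Q) f ->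
  (volume Q)^-1%:E * \int[mu]_(x in cube_set Q)
    \int[mu]_(y in cube_set Q) `|f x - f y|%:E <=
  (2 * \int[mu]_(x in cube_set Q) `|f x - c|)%:E.
Proof.
move=> Lf; set I := (\int[mu]_(x in cube_set Q) `|f x - c|)%R.
have H x : cube_set Q x -> \int[mu]_(y in cube_set Q) `|f x - f y|%:E <=
    (`|f x - c| * volume Q + I)%:E.
  move=> Qx; rewrite L1_EFin//; last first.
    by apply: L1_norm; apply: L1B => //; exact: L1_cst.
  rewrite lee_fin -Rintegral_cube_cst -RintegralD//; last first.
  - exact: L1_norm_sub.
  - exact: L1_cst.
  apply: le_Rintegral => //.
  - by apply: L1_norm; apply: L1B => //; exact: L1_cst.
  - by apply: L1D => //; [exact: L1_cst|exact: L1_norm_sub].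
  - by move=> y _; rewrite (distrC (f y)) (le_trans _ (ler_normD _ _))// subrKA.
have Lr : L1 (cube_set Q) (fun x => `|f x - c| * volume Q + I)%R.
  apply: L1D => //; last exact: L1_cst.
  rewrite (_ : (fun x => _) = (fun x => volume Q * `|f x - c|)%R); last first.
    by apply/funext => x; rewrite mulrC.
  by apply: L1Z => //; exact: L1_norm_sub.
have -> : (2 * I)%:E = (volume Q)^-1%:E *
    \int[mu]_(x in cube_set Q) (`|f x - c| * volume Q + I)%:E.
  rewrite L1_EFin// -EFinM RintegralD//; last exact: L1_cst.
    rewrite RintegralZr//; last exact: L1_norm_sub.
    rewrite Rintegral_cube_cst -/I; congr EFin.
    by rewrite mulr2n; field; rewrite gt_eqF.
  rewrite /= (_ : (fun x => _) = (fun x => volume Q * `|f x - c|)%R); last first.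
    by apply/funext => x; rewrite mulrC.
  by apply: L1Z => //; exact: L1_norm_sub.
apply: lee_wpmul2l; first by rewrite lee_fin invr_ge0.
apply: ge0_le_integral => //.
- by move=> x _; exact: integral_ge0.
- exact: measurable_dist_integral.
- exact: measurable_int Lr.
Qed.

End mean_oscillation.

(** * Weak type bound and approximation by step functions *)

Section weak_type_maximal.
Context (R : realType) (n : nat).
Local Notation mu := (lebesgue_Rn R n).
Local Notation L1 := (L1 mu).
Implicit Types (Q p : cube R n) (x y : Rn R n) (u : Rn R n -> R).

(* negative values of t shrink the cube *)
Definition thicken Q (t : R) : set (Rn R n) := [set x | forall i,
  tnth (corner Q) i - t <= tnth x i <= tnth (corner Q) i + side Q + t].

Lemma measurable_thicken Q t : measurable (thicken Q t).
Proof.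
apply: (measurable_coordwise (P := fun i => [set r |
  tnth (corner Q) i - t <= r <= tnth (corner Q) i + side Q + t])) => i.
exact: measurable_le_le.
Qed.

Lemma mu_thicken Q t : 0 <= side Q + 2 * t ->
  mu (thicken Q t) = ((side Q + 2 * t) ^+ n)%:E.
Proof.
move=> st; pose a : Rn R n := [tuple (tnth (corner Q) i - t) | i < n].
pose b : Rn R n := [tuple (tnth (corner Q) i + side Q + t) | i < n].
have := @lebesgue_Rn_box R n a b.
rewrite (_ : [set x | _ ] = thicken Q t); last first.
  by apply/seteqP; split => x H i; have := H i; rewrite !tnth_mktuple.
move=> -> => [|i]; last by rewrite !tnth_mktuple; lra.
rewrite (eq_bigr (fun=> side Q + 2 * t)) => [|i _]; last first.
  by rewrite !tnth_mktuple; ring.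
by rewrite /= prodr_const card_ord.
Qed.

Lemma dyadic_scale (s S : R) : 0 < s -> s <= S ->
  exists d, s <= S / 2 ^+ d /\ S / 2 ^+ d < 2 * s.
Proof.
move=> s0 sS; have ex : exists d : nat, S / 2 ^+ d < 2 * s.
  exists (Num.truncn (S / s)).+1.
  have S0 : 0 < S by exact: lt_le_trans sS.
  rewrite ltr_pdivrMr ?exprn_gt0//.
  have : S / s < (Num.truncn (S / s)).+1%:R by exact: truncnS_gt.
  rewrite ltr_pdivrMr// => /lt_le_trans; apply.
  rewrite mulrAC ler_pM2r//.
  have : ((Num.truncn (S / s)).+1%:R <= 2 ^+ (Num.truncn (S / s)).+1 :> R).
    by rewrite -natrX ler_nat ltnW// ltn_expl.
  by move=> h; have : (0 : R) <= 2 ^+ (Num.truncn (S / s)).+1; [rewrite exprn_ge0|lra].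
case: (ex_minnP ex) => [[|d]] Sd dmin.
  by exists 0%N; split => //; rewrite expr0 divr1.
exists d.+1; split => //.
have : ~~ (S / 2 ^+ d < 2 * s) by apply/negP => /dmin; rewrite ltnn.
rewrite -leNgt exprS invfM mulrCA.
by move=> h; rewrite mulrC ler_pdivlMr//; lra.
Qed.

Fixpoint heavy_cover u (lam : R) (d : nat) p : set (Rn R n) :=
  if lam * volume p < \int[mu]_(x in cube_set p) u x then thicken p (side p)
  else if d is d'.+1 then
    \big[setU/set0]_(e : {ffun 'I_n -> bool}) heavy_cover u lam d' (child p e)
  else set0.

Lemma measurable_heavy_cover u lam d p : measurable (heavy_cover u lam d p).
Proof.
elim: d p => [|d IH] p /=; case: ifP => _ //; try exact: measurable_thicken.
by apply: bigsetU_measurable => e _; exact: IH.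
Qed.

Lemma heavy_coverS u lam d p :
  heavy_cover u lam d p `<=` heavy_cover u lam d.+1 p.
Proof.
elim: d p => [|d IH] p x /=; case: ifP => // _.
by rewrite -!bigcup_seq => -[e es /IH hx]; exists e.
Qed.

Lemma mu_heavy_cover u lam d p : 0 < lam -> L1 (cube_set p) u ->
  (forall x, cube_set p x -> 0 <= u x) ->
  (mu (heavy_cover u lam d p) <=
   (3 ^+ n / lam * \int[mu]_(x in cube_set p) u x)%:E)%E.
Proof.
move=> lam0; elim: d p => [|d IH] p Lu u0 /=; case: ifPn => hp.
- rewrite mu_thicken; last by have := side_gt0 p; lra.
  rewrite (_ : side p + 2 * side p = 3 * side p); last by ring.
  rewrite exprMn -volumeE lee_fin -mulrA ler_wpM2l ?exprn_ge0//.
  by rewrite ler_pdivlMl// ltW.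
- rewrite measure0 lee_fin mulr_ge0 ?divr_ge0 ?exprn_ge0 ?(ltW lam0)//.
  exact: Rintegral_ge0.
- rewrite mu_thicken; last by have := side_gt0 p; lra.
  rewrite (_ : side p + 2 * side p = 3 * side p); last by ring.
  rewrite exprMn -volumeE lee_fin -mulrA ler_wpM2l ?exprn_ge0//.
  by rewrite ler_pdivlMl// ltW.
- apply: le_trans (measure_bigsetU_le _ _ _) _.
    by move=> e; exact: measurable_heavy_cover.
  rewrite Rintegral_children// mulr_sumr -sumEFin; apply: lee_sum => e _.
  apply: IH; first exact: L1_child.
  by move=> x cx; apply: u0; exact: child_subcube cx.
Qed.

(** A heavy cube where the recursion stops is at least as large as Q; if it met Q, its dilate would
    contain Q. So Q meets only light cubes of generation d, and these lie in the thickening of Q by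
    their side. *)
Lemma heavy_cover_light u lam d p Q : 0 < lam -> L1 (cube_set p) u ->
  (forall x, cube_set p x -> 0 <= u x) -> side Q <= side p / 2 ^+ d ->
  ~ cube_set Q `<=` heavy_cover u lam d p ->
  \int[mu]_(x in cube_set p) (u x * \1_(cube_set Q) x) <=
  lam * \int[mu]_(x in cube_set p) \1_(thicken Q (side p / 2 ^+ d)) x.
Proof.
move=> lam0.
have disj q : (forall x, cube_set q x -> cube_set Q x -> False) ->
    \int[mu]_(x in cube_set q) (u x * \1_(cube_set Q) x) = 0.
  move=> qQ; rewrite (@eq_Rintegral _ _ _ _ _ (fun=> 0)); last first.
    move=> x /set_mem qx; rewrite indicE memNset ?mulr0//; exact: qQ.
  by rewrite Rintegral_cube_cst mul0r.
have rhs0 q t : 0 <= lam * \int[mu]_(x in cube_set q) \1_(thicken Q t) x.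
  by rewrite mulr_ge0 ?(ltW lam0)//; apply: Rintegral_ge0.
have heavy q : side Q <= side q -> ~ cube_set Q `<=` thicken q (side q) ->
    forall x, cube_set q x -> cube_set Q x -> False.
  move=> Qq nQq x qx Qx; apply: nQq => y Qy i.
  by have := qx i; have := Qx i; have := Qy i; lra.
have lesd (q : cube R n) d' : side q / 2 ^+ d' <= side q.
  rewrite ler_pdivrMr ?exprn_gt0// ler_peMr ?(ltW (side_gt0 _))//.
  by rewrite exprn_ege1// ler1n.
elim: d p => [|d IH] p Lu u0 sQp /=; case: ifPn => hp nQ.
- rewrite disj ?rhs0//; exact: (heavy _ (le_trans sQp (lesd _ _)) nQ).
- have [/asboolP pQ|/asboolPn pQ] := boolP `[< exists x, cube_set p x /\ cube_set Q x >]; last first.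
    by rewrite disj// => x px Qx; apply: pQ; exists x.
  have pQ' : cube_set p `<=` thicken Q (side p / 2 ^+ 0).
    case: pQ => x [px Qx] y py i.
    by have := px i; have := Qx i; have := py i; rewrite expr0 divr1; lra.
  rewrite (Rintegral_indic _ (measurable_cube p) (measurable_thicken _ _)).
  rewrite (setIidl pQ') -[fine _]/(volume p) Rintegral_indicM.
  move: hp; rewrite -leNgt; apply: le_trans.
  apply: le_Rintegral_subset => //; exact: measurableI.
- rewrite disj ?rhs0//; exact: (heavy _ (le_trans sQp (lesd _ _)) nQ).
- have LuQ : L1 (cube_set p) (fun x => u x * \1_(cube_set Q) x) by exact: L1_indicM.
  have Lth : L1 (cube_set p) (fun x => \1_(thicken Q (side p / 2 ^+ d.+1)) x).
    apply: (@L1_bounded _ _ _ _ _ _ 1) => //.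
      by apply: measurable_indic; exact: measurable_thicken.
    by move=> x _; rewrite indicE ger0_norm//; case: (_ \in _).
  have sE e : side (child p e) / 2 ^+ d = side p / 2 ^+ d.+1.
    by rewrite side_child exprS invfM mulrA.
  rewrite !Rintegral_children// mulr_sumr; apply: ler_sum => e _.
  rewrite -(sE e); apply: IH.
  + exact: L1_child.
  + by move=> x cx; apply: u0; exact: child_subcube cx.
  + by rewrite sE.
  + move=> Qe; apply: nQ => x /Qe hx; rewrite -bigcup_seq.
    by exists e => //=; rewrite mem_index_enum.
Qed.

Lemma weak_type_maximal (n_gt0 : (0 < n)%N) Q0 u (lam : R) : 0 < lam ->
  L1 (cube_set Q0) u -> (forall x, cube_set Q0 x -> 0 <= u x) ->
  exists Om : set (Rn R n), [/\ measurable Om,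
    (mu Om <= (15 ^+ n / lam * \int[mu]_(x in cube_set Q0) u x)%:E)%E &
    forall Q, subcube Q Q0 ->
      lam * volume Q < \int[mu]_(x in cube_set Q) u x -> cube_set Q `<=` Om].
Proof.
(* Q is compared with dyadic cubes of side t, where side Q <= t < 2 side Q; its thickening by t has
   side below 5 side Q. Hence the 5^n, and 15 = 3 * 5 in the measure bound. *)
move=> lam0 Lu u0; pose lam' := lam / 5 ^+ n.
have lam'0 : 0 < lam' by rewrite divr_gt0// exprn_gt0.
pose G d := heavy_cover u lam' d Q0.
have mG d : measurable (G d) by exact: measurable_heavy_cover.
have mUG : measurable (\bigcup_d G d) by exact: bigcup_measurable.
exists (\bigcup_d G d); split => //.
  have GU : mu \o G @ \oo --> mu (\bigcup_d G d).
    apply: nondecreasing_cvg_mu => //; apply/nondecreasing_seqP => d.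
    by apply/subsetPset; exact: heavy_coverS.
  rewrite -(cvg_lim _ GU)//; apply: lime_le; first by apply/cvg_ex; eexists; exact: GU.
  apply: nearW => d; apply: le_trans (mu_heavy_cover d lam'0 Lu u0) _.
  rewrite lee_fin ler_wpM2r//; first exact: Rintegral_ge0.
  rewrite /lam' invf_div mulrA -exprMn (_ : 3 * 5 = 15 :> R)//.
  by rewrite -!natrM.
move=> Q QQ0 heavyQ; apply: contrapT => nQ.
have [d [sd ds]] := dyadic_scale (side_gt0 Q) (subcube_side n_gt0 QQ0).
have nG : ~ cube_set Q `<=` heavy_cover u lam' d Q0.
  by move=> QG; apply: nQ => x Qx; exists d => //; exact: QG.
have := heavy_cover_light lam'0 Lu u0 sd nG.
rewrite Rintegral_indicM (setIidr QQ0).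
apply/negP; rewrite -ltNge; apply: le_lt_trans heavyQ.
rewrite (Rintegral_indic _ (measurable_cube Q0) (measurable_thicken _ _)).
set t := side Q0 / 2 ^+ d in sd ds *.
have s0 := side_gt0 Q.
have st : 0 <= side Q + 2 * t by lra.
apply: (@le_trans _ _ (lam' * (side Q + 2 * t) ^+ n)).
  rewrite ler_wpM2l ?(ltW lam'0)// -[leRHS]/(fine ((side Q + 2 * t) ^+ n)%:E).
  rewrite -(mu_thicken st) fine_le//.
  - rewrite ge0_fin_numE//; apply: le_lt_trans (mu_cube_fin Q0).
    apply: le_measure; rewrite ?inE//.
    by apply: measurableI => //; exact: measurable_thicken.
  - by rewrite mu_thicken.
  - apply: le_measure; rewrite ?inE//; last exact: measurable_thicken.
    by apply: measurableI => //; exact: measurable_thicken.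
apply: (@le_trans _ _ (lam' * (5 * side Q) ^+ n)).
  rewrite ler_wpM2l ?(ltW lam'0)// lerXn2r ?nnegrE//; last by lra.
  by rewrite mulr_ge0// ltW.
by rewrite exprMn volumeE mulrA mulrVK// unitfE expf_neq0.
Qed.

End weak_type_maximal.

(** * Integrable functions at small scales *)

Section step_approximation.
Context (R : realType) (n : nat).
Local Notation mu := (lebesgue_Rn R n).
Local Notation L1 := (L1 mu).
Variable Q0 : cube R n.
Implicit Types (Q p : cube R n) (x y : Rn R n) (h s : Rn R n -> R).

(** [E] is a neighbourhood of the jumps of a step function: a small cube that touches a jump lies
    entirely inside it. The alternative concerns whole cubes because oscillation on a cube is what
    has to be controlled. *)
Definition locally_constant_off (E : set (Rn R n)) (delta : R) s : Prop :=
  forall Q, subcube Q Q0 -> side Q <= delta ->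
    cube_set Q `<=` E \/ forall x y, cube_set Q x -> cube_set Q y -> s x = s y.

Definition step_approximable h : Prop := forall eps : R, 0 < eps ->
  exists s E delta, [/\ 0 < delta, measurable E /\ (mu E <= eps%:E)%E,
    L1 (cube_set Q0) s, \int[mu]_(x in cube_set Q0) `|h x - s x| <= eps &
    locally_constant_off E delta s].

Lemma step_approximable_op (op : R -> R -> R) h1 h2 :
  (forall a b c d, `|op a b - op c d| <= `|a - c| + `|b - d|) ->
  (forall u v, L1 (cube_set Q0) u -> L1 (cube_set Q0) v ->
     L1 (cube_set Q0) (fun x => op (u x) (v x))) ->
  L1 (cube_set Q0) h1 -> L1 (cube_set Q0) h2 ->
  step_approximable h1 -> step_approximable h2 ->
  step_approximable (fun x => op (h1 x) (h2 x)).
Proof.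
move=> op_lip op_L1 Lh1 Lh2 h1P h2P eps eps0.
have e20 : 0 < eps / 2 by rewrite divr_gt0.
have [s1 [E1 [d1 [d10 [mE1 E1e] Ls1 hs1 lc1]]]] := h1P _ e20.
have [s2 [E2 [d2 [d20 [mE2 E2e] Ls2 hs2 lc2]]]] := h2P _ e20.
exists (fun x => op (s1 x) (s2 x)), (E1 `|` E2), (Num.min d1 d2); split.
- by rewrite lt_min d10.
- split; first exact: measurableU.
  apply: le_trans (measureU2 _ mE1 mE2) _.
  by rewrite (splitr eps) EFinD leeD.
- exact: op_L1.
- apply: (@le_trans _ _ (\int[mu]_(x in cube_set Q0)
      (`|h1 x - s1 x| + `|h2 x - s2 x|))).
    apply: le_Rintegral => //.
    + by apply: L1_norm; apply: L1B => //; exact: op_L1.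
    + by apply: L1D => //; apply: L1_norm; exact: L1B.
  rewrite RintegralD//; [|by apply: L1_norm; exact: L1B..].
  by rewrite (splitr eps) lerD.
- move=> Q QQ0; rewrite le_min => /andP[/(lc1 _ QQ0) l1 /(lc2 _ QQ0) l2].
  case: l1 => [l1|l1]; first by left => x /l1; left.
  case: l2 => [l2|l2]; first by left => x /l2; right.
  by right => x y Qx Qy; rewrite (l1 x y)// (l2 x y).
Qed.

Lemma step_approximableD h1 h2 :
  L1 (cube_set Q0) h1 -> L1 (cube_set Q0) h2 ->
  step_approximable h1 -> step_approximable h2 ->
  step_approximable (fun x => h1 x + h2 x).
Proof.
apply: step_approximable_op => [a b c d|u v Lu Lv]; last exact: L1D.
by rewrite opprD addrACA ler_normD.
Qed.

Lemma step_approximable_max h1 h2 :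
  L1 (cube_set Q0) h1 -> L1 (cube_set Q0) h2 ->
  step_approximable h1 -> step_approximable h2 ->
  step_approximable (fun x => Num.max (h1 x) (h2 x)).
Proof.
apply: step_approximable_op => [a b c d|u v Lu Lv].
  rewrite ler_norml; have := ler_norm (a - c); have := ler_norm (b - d).
  have := ler_norm (- (a - c)); have := ler_norm (- (b - d)); rewrite !normrN.
  by rewrite /Num.max; case: ifP; case: ifP; rewrite ?ltNge;
    do 2?(move=> /negbT; rewrite ?negbK); lra.
apply: (@L1_le _ _ _ _ _ _ (fun x => `|u x| + `|v x|)) => //.
- by apply: measurable_maxr; [exact: L1_measurable Lu|exact: L1_measurable Lv].
- by move=> x _; rewrite /Num.max; case: ifP => _; rewrite (lerDl, lerDr).
- by apply: L1D => //; exact: L1_norm.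
Qed.

Lemma step_approximable_cst (c : R) : step_approximable (fun=> c).
Proof.
move=> eps eps0; exists (fun=> c), set0, 1; split => //.
- by split => //; rewrite measure0 lee_fin ltW.
- exact: L1_cst.
- under eq_Rintegral do rewrite subrr normr0.
  by rewrite Rintegral_cube_cst mul0r ltW.
- by move=> Q _ _; right.
Qed.

Lemma step_approximableZ (r : R) h : L1 (cube_set Q0) h ->
  step_approximable h -> step_approximable (fun x => r * h x).
Proof.
move=> Lh hP eps eps0; have r1 : 0 < `|r| + 1 by rewrite ltr_wpDl.
pose eps' := Num.min eps (eps / (`|r| + 1)).
have e'0 : 0 < eps' by rewrite lt_min eps0 divr_gt0.
have [s [E [d [d0 [mE Ee] Ls hs lc]]]] := hP _ e'0.
exists (fun x => r * s x), E, d; split => //.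
- by split => //; apply: le_trans Ee _; rewrite lee_fin ge_min lexx.
- exact: L1Z.
- under eq_Rintegral do rewrite -mulrBr normrM.
  rewrite RintegralZl//; last by apply: L1_norm; exact: L1B.
  apply: (@le_trans _ _ (`|r| * (eps / (`|r| + 1)))).
    by rewrite ler_wpM2l//; apply: le_trans hs _; rewrite ge_min lexx orbT.
  rewrite mulrCA ler_piMr ?(ltW eps0)// ler_pdivrMr// mul1r.
  by rewrite lerDl.
- move=> Q QQ0 /(lc _ QQ0)[|l]; [by left|right => x y Qx Qy].
  by rewrite (l x y).
Qed.

Lemma step_approximable_sum (I : Type) (r : seq I) (h : I -> Rn R n -> R) :
  (forall i, L1 (cube_set Q0) (h i)) -> (forall i, step_approximable (h i)) ->
  step_approximable (fun x => \sum_(i <- r) h i x).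
Proof.
move=> Lh hP; elim: r => [|i r IH].
  under eq_fun do rewrite big_nil; exact: step_approximable_cst.
under eq_fun do rewrite big_cons.
by apply: step_approximableD => //; exact: L1_sum.
Qed.

Lemma step_approximable_lim h : L1 (cube_set Q0) h ->
  (forall eps : R, 0 < eps -> exists h', [/\ L1 (cube_set Q0) h',
     step_approximable h' & \int[mu]_(x in cube_set Q0) `|h x - h' x| <= eps]) ->
  step_approximable h.
Proof.
move=> Lh hP eps eps0; have e20 : 0 < eps / 2 by rewrite divr_gt0.
have [h' [Lh' h'P hh']] := hP _ e20.
have [s [E [d [d0 [mE Ee] Ls hs lc]]]] := h'P _ e20.
exists s, E, d; split => //.
- by split => //; apply: le_trans Ee _; rewrite lee_fin ler_pdivrMr//; lra.
- apply: (@le_trans _ _ (\int[mu]_(x in cube_set Q0)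
      (`|h x - h' x| + `|h' x - s x|))).
    apply: le_Rintegral => //.
    + by apply: L1_norm; exact: L1B.
    + by apply: L1D => //; apply: L1_norm; exact: L1B.
    + by move=> x _; rewrite (le_trans _ (ler_normD _ _))// subrKA.
  rewrite RintegralD//; [|by apply: L1_norm; exact: L1B..].
  by rewrite (splitr eps) lerD.
Qed.

Lemma L1_indic (A : set (Rn R n)) : measurable A ->
  L1 (cube_set Q0) (fun x => \1_A x).
Proof.
move=> mA; apply: (@L1_bounded _ _ _ _ _ _ 1) => //.
  exact: measurable_indic.
by move=> x _; rewrite indicE ger0_norm//; case: (_ \in _).
Qed.

(** The indicator approximates itself. A cube of side at most d with points on both sides of the
    hyperplane lies in the slab of half-width d, and d is chosen so that this slab has measure at
    most eps. *)
Lemma step_approximable_ray (i : 'I_n) (t : R) :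
  step_approximable (fun x => \1_[set x : Rn R n | t < tnth x i] x).
Proof.
move=> eps eps0; set S := side Q0 ^+ n.-1.
have S0 : 0 < S by rewrite exprn_gt0// side_gt0.
pose d := eps / (2 * S); have d0 : 0 < d by rewrite divr_gt0// mulr_gt0.
pose E := cube_set Q0 `&` [set x : Rn R n | (t - d <= tnth x i <= t + d)%R].
have mray : measurable [set x : Rn R n | t < tnth x i].
  apply: (@measurable_coord _ _ i [set r | t < r]).
  rewrite (_ : [set r | _] = `]t, +oo[%classic)//.
  by apply/seteqP; split => r /=; rewrite in_itv/= andbT.
exists (fun x => \1_[set x : Rn R n | t < tnth x i] x), E, d; split => //.
- split.
    apply: measurableI => //.
    exact: (@measurable_coord _ _ i _ (measurable_le_le _ _)).
  apply: le_trans (mu_slab _ _ _) _; first by lra.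
  rewrite lee_fin -/S (_ : t + d - (t - d) = 2 * d); last by ring.
  rewrite /d (_ : 2 * _ * S = eps)//; field.
  by rewrite gt_eqF.
- exact: L1_indic.
- under eq_Rintegral do rewrite subrr normr0.
  by rewrite Rintegral_cube_cst mul0r ltW.
- move=> Q QQ0 Qd.
  have [[x [y [Qx Qy xt ty]]]|] := pselect (exists x y,
      [/\ cube_set Q x, cube_set Q y, tnth x i <= t & t < tnth y i]).
    left => z Qz; split; first exact: QQ0.
    by have := Qx i; have := Qy i; have := Qz i; rewrite /=; lra.
  move=> nxy; right => x y Qx Qy; rewrite !indicE; congr (nat_of_bool _)%:R.
  apply/idP/idP; rewrite !inE/= => tx; rewrite ltNge; apply/negP => yt.
    by apply: nxy; exists y, x; split.
  by apply: nxy; exists x, y; split.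
Qed.

(** Complements come from 1 - 1_A. For a countable union, finite unions are handled by maxima and
    converge in L^1 because the part of [Q0] still uncovered has measure decreasing to 0. *)
Lemma step_approximable_sigma_algebra :
  sigma_algebra setT [set A : set (Rn R n) | measurable A /\
                        step_approximable (fun x => \1_A x)].
Proof.
split => /=.
- split => //; under eq_fun do rewrite indic0; exact: step_approximable_cst.
- move=> A [mA AP]; split; first by rewrite setTD; exact: measurableC.
  rewrite (_ : (fun x => _) = (fun x => 1 + (-1) * \1_A x)); last first.
    apply/funext => x; rewrite !indicE in_setD in_setT/=.
    by case: (x \in A); rewrite /= ?mulr0 ?mulr1 ?subrr ?addr0.
  apply: step_approximableD.
  + exact: L1_cst.
  + by apply: L1Z => //; exact: L1_indic.
  + exact: step_approximable_cst.
  + by apply: step_approximableZ => //; exact: L1_indic.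
- move=> A AP; have mA k : measurable (A k) by case: (AP k).
  have mU : measurable (\bigcup_k A k) by exact: bigcup_measurable.
  split => //; apply: step_approximable_lim; first exact: L1_indic.
  move=> eps eps0; pose B N := \big[setU/set0]_(k < N) A k.
  have mB N : measurable (B N) by exact: bigsetU_measurable.
  have BP N : step_approximable (fun x => \1_(B N) x).
    elim: N => [|N IH].
      rewrite /B big_ord0; under eq_fun do rewrite indic0.
      exact: step_approximable_cst.
    rewrite /B big_ord_recr/= -/(B N).
    rewrite (_ : (fun x => _) = (fun x => Num.max (\1_(B N) x) (\1_(A N) x))).
      apply: step_approximable_max => //; try exact: L1_indic.
      by case: (AP N).
    apply/funext => x; rewrite !indicE in_setU.
    case: (x \in B N); case: (x \in A N) => /=.
    + by rewrite maxxx.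
    + by rewrite max_l// ler01.
    + by rewrite max_r// ler01.
    + by rewrite maxxx.
  have UB : \bigcup_k A k = \bigcup_N B N.
    apply/seteqP; split => x [k _]; last exact: bigsetU_bigcup.
    by move=> Ax; exists k.+1 => //; rewrite /B big_ord_recr; right.
  have ndB : {homo B : i j / (i <= j)%N >-> (i <= j)%O}.
    by apply/nondecreasing_seqP => N; apply/subsetPset; rewrite /B big_ord_recr; left.
  pose D N := cube_set Q0 `&` (\bigcup_k A k `\` B N).
  have mD N : measurable (D N) by apply: measurableI => //; exact: measurableD.
  have D0 : mu \o D @ \oo --> mu (\bigcap_N D N).
    apply: nonincreasing_cvg_mu => //.
    + apply: le_lt_trans (mu_cube_fin Q0); apply: le_measure; rewrite ?inE//.
      exact: subIsetl.
    + exact: bigcap_measurable.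
    + move=> i j ij; apply/subsetPset => x [Qx [Ux nBx]]; split => //; split => //.
      by move=> Bx; apply: nBx; move: x Bx {Qx Ux}; exact/subsetPset/ndB.
  have capD : \bigcap_N D N = set0.
    apply/seteqP; split => // x Dx; have [_ []] := Dx 0%N I.
    rewrite UB => -[N _ BNx] _.
    by have [_ []] := Dx N I.
  rewrite capD measure0 in D0.
  have [N DN] : exists N, (mu (D N) <= eps%:E)%E.
    have [|N /ltW DN] := cvge_ex_lt D0 (y := eps%:E); first by rewrite lte_fin.
    by exists N.
  exists (fun x => \1_(B N) x); split => //; first exact: L1_indic.
  have -> : \int[mu]_(x in cube_set Q0) `|\1_(\bigcup_k A k) x - \1_(B N) x| =
      \int[mu]_(x in cube_set Q0) \1_(\bigcup_k A k `\` B N) x.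
    apply: eq_Rintegral => x _; rewrite !indicE in_setD.
    have [xB|xB] := boolP (x \in B N).
      rewrite andbF mem_set ?subrr ?normr0//.
      by rewrite UB; exists N => //; exact/set_mem.
    by rewrite andbT subr0 ger0_norm.
  rewrite Rintegral_indic//; last exact: measurableD.
  rewrite -lee_fin fineK// ge0_fin_numE//.
  by apply: le_lt_trans DN _; rewrite ltry.
Qed.

Lemma step_approximable_indic (A : set (Rn R n)) : measurable A ->
  step_approximable (fun x => \1_A x).
Proof.
move=> mA; suff : [set A : set (Rn R n) | measurable A /\
    step_approximable (fun x => \1_A x)] A by case.
apply: (smallest_sub step_approximable_sigma_algebra) mA.
move=> B; rewrite -bigcup_seq => -[i _ [Y mY]]; rewrite setTI => <- {B}.
have [S0 SD SU] := step_approximable_sigma_algebra.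
(* A second induction, on the one-dimensional set: the sets whose preimage under the coordinate
   qualifies form a sigma-algebra, so rays suffice. *)
move: Y mY; rewrite RGenOInfty.measurableE; apply: smallest_sub.
  split => /=.
  - by rewrite preimage_set0.
  - by move=> Y YP; rewrite setTD preimage_setC -setTD; exact: SD.
  - by move=> Y YP; rewrite preimage_bigcup; exact: SU.
move=> _ [t ->] /=.
have -> : (fun x : Rn R n => tnth x i) @^-1` `]t, +oo[%classic =
    [set x | t < tnth x i].
  by apply/seteqP; split => x /=; rewrite in_itv/= andbT.
split; last exact: step_approximable_ray.
apply: (@measurable_coord _ _ i [set r | t < r]).
rewrite (_ : [set r | _] = `]t, +oo[%classic)//.
by apply/seteqP; split => r /=; rewrite in_itv/= andbT.
Qed.

Import HBSimple.

Lemma L1_step_approximable h : L1 (cube_set Q0) h -> step_approximable h.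
Proof.
move=> Lh; apply: step_approximable_lim => // eps eps0.
have [g [Lg _ g0]] := approximation_sfun_integrable (measurable_cube Q0) Lh.
have [|N gN] := cvge_ex_lt g0 (y := eps%:E); first by rewrite lte_fin.
exists (g N); split; first exact: Lg.
- have [rs gE] : exists rs : seq R, (g N : Rn R n -> R) =
      fun x => \sum_(r <- rs) (r * \1_(g N @^-1` [set r]) x).
    exists (finmap.enum_fset (fset_set (range (g N)))).
    by apply/funext => x; rewrite [LHS]fimfunE fsbig_finite.
  rewrite gE.
  have mgN r : measurable (g N @^-1` [set r]).
    by rewrite -[X in measurable X]setTI; exact: measurable_funP.
  apply: step_approximable_sum => r.
    by apply: L1Z => //; exact: L1_indic.
  apply: step_approximableZ; first exact: L1_indic.
  exact: step_approximable_indic.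
- rewrite -lee_fin -L1_EFin//; first exact: ltW.
  by apply: L1_norm; apply: L1B => //; exact: Lg.
Qed.

End step_approximation.

(** * Decomposition into an integrable and a BMO part *)

Section tails.
Context (R : realType) (n : nat).
Local Notation mu := (lebesgue_Rn R n).
Local Notation L1 := (L1 mu).
Variable Q0 : cube R n.
Implicit Types (g : Rn R n -> R) (lam : R).

Definition superlevel g lam : set (Rn R n) := cube_set Q0 `&` [set x | lam < g x].

Definition tail g lam : R := \int[mu]_(x in superlevel g lam) g x.

Lemma measurable_superlevel g lam : measurable_fun (cube_set Q0) g ->
  measurable (superlevel g lam).
Proof.
move=> mg; rewrite /superlevel.
rewrite (_ : [set x | lam < g x] = g @^-1` `]lam, +oo[%classic); first exact: mg.
by apply/seteqP; split => x /=; rewrite in_itv/= andbT.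
Qed.

Lemma tailE g lam : tail g lam =
  \int[mu]_(x in cube_set Q0) (g x * \1_(superlevel g lam) x).
Proof. by rewrite Rintegral_indicM /superlevel setIA setIid. Qed.

Lemma tail_ge0 g lam : (forall x, cube_set Q0 x -> 0 <= g x) -> 0 <= tail g lam.
Proof. by move=> g0; apply: Rintegral_ge0 => x [/g0]. Qed.

Lemma le_tail g lam lam' : L1 (cube_set Q0) g ->
  (forall x, cube_set Q0 x -> 0 <= g x) -> lam <= lam' -> tail g lam' <= tail g lam.
Proof.
move=> Lg g0 ll; have mg := L1_measurable Lg.
apply: le_Rintegral_subset; try exact: measurable_superlevel.
- by move=> x [Qx /(le_lt_trans ll)].
- by apply: L1S Lg => //; [exact: measurable_superlevel|exact: subIsetl].
- by move=> x [/g0].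
Qed.

Lemma tail_small g (eps : R) : L1 (cube_set Q0) g ->
  (forall x, cube_set Q0 x -> 0 <= g x) -> 0 < eps ->
  exists k : nat, tail g k%:R <= eps.
Proof.
move=> Lg g0 eps0; have mg := L1_measurable Lg.
pose F k x := (g x * \1_(superlevel g k%:R) x)%:E.
have mS k : measurable (superlevel g k%:R) by exact: measurable_superlevel.
have LF k : L1 (cube_set Q0) (fun x => g x * \1_(superlevel g k%:R) x).
  exact: L1_indicM.
have [||||_ _ F0] := @dominated_convergence _ _ _ mu _ (measurable_cube Q0) F
    (cst 0%E) (EFin \o g) (fun k => measurable_int _ (LF k)).
- exact: measurable_cst.
- apply: aeW => x Qx; apply: cvg_near_cst.
  exists (Num.truncn (g x)).+1 => // k /= gk.
  rewrite /F indicE memNset ?mulr0// => -[_ /=]; apply/negP; rewrite -leNgt.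
  by rewrite ltW// (lt_le_trans (truncnS_gt _))// ler_nat.
- exact: Lg.
- apply: aeW => x k Qx; rewrite /F/= lee_fin ger0_norm ?indicE.
    by rewrite ler_piMr ?g0//; case: (_ \in _).
  by rewrite mulr_ge0 ?g0.
rewrite integral0 in F0.
have [|N FN] := cvge_ex_lt F0 (y := eps%:E); first by rewrite lte_fin.
exists N; rewrite tailE -lee_fin -L1_EFin//; exact: ltW.
Qed.

Lemma le_superlevel_split g lam x : cube_set Q0 x -> 0 <= lam -> 0 <= g x ->
  g x <= lam + g x * \1_(superlevel g lam) x.
Proof.
move=> Qx lam0 gx0; have [gl|lg] := leP (g x) lam.
  by rewrite (le_trans gl)// lerDl mulr_ge0.
by rewrite indicE mem_set ?mulr1 ?lerDr.
Qed.

(** Quantitative absolute continuity of the integral: [g] is split at height lam. *)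
Lemma Rintegral_indic_le_tail g lam (A : set (Rn R n)) : measurable A ->
  L1 (cube_set Q0) g -> (forall x, cube_set Q0 x -> 0 <= g x) -> 0 <= lam ->
  \int[mu]_(x in cube_set Q0) (g x * \1_A x) <=
  lam * fine (mu (cube_set Q0 `&` A)) + tail g lam.
Proof.
move=> mA Lg g0 lam0; have mg := L1_measurable Lg.
have mS := measurable_superlevel lam mg.
have LS : L1 (cube_set Q0) (fun x => g x * \1_(superlevel g lam) x).
  exact: L1_indicM.
have LA : L1 (cube_set Q0) (fun x => \1_A x) by exact: L1_indic.
rewrite tailE -Rintegral_indic// -RintegralZl// -RintegralD//; last exact: L1Z.
apply: le_Rintegral => //; [exact: L1_indicM|by apply: L1D => //; exact: L1Z|].
move=> x Qx; have gx0 := g0 x Qx; have := le_superlevel_split Qx lam0 gx0.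
rewrite [\1_A x]indicE; case: (x \in A) => /=; first by rewrite !mulr1.
by rewrite !mulr0 add0r mulr_ge0.
Qed.

Lemma Rintegral_cube_le_tail g lam Q : subcube Q Q0 ->
  L1 (cube_set Q0) g -> (forall x, cube_set Q0 x -> 0 <= g x) -> 0 <= lam ->
  \int[mu]_(x in cube_set Q) g x <= lam * volume Q +
    \int[mu]_(x in cube_set Q) (g x * \1_(superlevel g lam) x).
Proof.
move=> QQ0 Lg g0 lam0; have mg := L1_measurable Lg.
have mS := measurable_superlevel lam mg.
have LQ : L1 (cube_set Q) g by exact: L1S Lg.
rewrite -Rintegral_cube_cst -RintegralD//; [|exact: L1_cst|exact: L1_indicM].
apply: le_Rintegral => //.
  by apply: L1D => //; [exact: L1_cst|exact: L1_indicM].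
by move=> x /QQ0 Qx; apply: le_superlevel_split => //; exact: g0.
Qed.

End tails.

(** * Averages over stopping cubes *)

Section stopping_cubes.
Context (R : realType) (n : nat).
Local Notation mu := (lebesgue_Rn R n).
Local Notation L1 := (L1 mu).
Variable stop : cube R n -> Prop.
Implicit Types (Q p : cube R n) (x y : Rn R n) (f : Rn R n -> R).

(** The descent towards x ends at the first cube satisfying [stop], or else at generation d. The
    cut-off makes all integrals below finite sums; a leaf of generation d that does not satisfy
    [stop] is treated by step approximation. *)
Fixpoint stopping_cube (d : nat) Q x : cube R n :=
  if d is d'.+1 then
    if `[< stop Q >] then Q else stopping_cube d' (child Q (half_of Q x)) x
  else Q.

Local Notation loc := stopping_cube.

Lemma stopping_cube_in d Q x : cube_set Q x -> cube_set (loc d Q x) x.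
Proof.
elim: d Q => [//|d IH] Q Qx /=; case: ifP => // _.
by apply: IH; exact: half_of_child.
Qed.

Lemma stopping_cube_sub d Q x : subcube (loc d Q x) Q.
Proof.
elim: d Q => [|d IH] Q /=; first exact: subset_refl.
case: ifP => _; first exact: subset_refl.
by apply: subset_trans (IH _) _; exact: child_subcube.
Qed.

Lemma stopping_cubeP d Q x :
  stop (loc d Q x) \/ side (loc d Q x) = side Q / 2 ^+ d.
Proof.
elim: d Q => [|d IH] Q /=; first by right; rewrite expr0 divr1.
case: ifPn => [/asboolP|_]; first by left.
case: (IH (child Q (half_of Q x))) => [|->]; [by left|right].
by rewrite side_child exprS invfM mulrA.
Qed.

Lemma stopping_cube_side d Q x : side Q / 2 ^+ d <= side (loc d Q x).
Proof.
elim: d Q => [|d IH] Q /=; first by rewrite expr0 divr1.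
case: ifPn => _.
  rewrite ler_pdivrMr ?exprn_gt0// ler_peMr ?(ltW (side_gt0 _))//.
  by rewrite exprn_ege1// ler1n.
apply: le_trans (IH _).
by rewrite side_child exprS invfM mulrA.
Qed.

Lemma stopping_cube_parent d Q x : cube_set Q x -> loc d Q x = Q \/
  exists p, [/\ ~ stop p, cube_set p x & side p = 2 * side (loc d Q x)].
Proof.
elim: d Q => [|d IH] Q Qx /=; first by left.
case: ifPn => [_|/asboolPn nstop]; first by left.
right; have [->|//] := IH _ (half_of_child Qx).
by exists Q; split => //; rewrite side_child mulrC divfK.
Qed.

Lemma L1_average_stopping f d Q :
  L1 (cube_set Q) (fun x => average f (loc d Q x)).
Proof.
elim: d Q => [|d IH] Q /=; first exact: L1_cst.
case: `[< stop Q >]; first exact: L1_cst.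
exact: (proj1 (@L1_children_piecewise _ _ Q _
  (fun e x => average f (loc d (child Q e) x)) (fun e => IH _) _)).
Qed.

(** The distance is the sum of the oscillations over the leaves, so a majorant is needed only on
    cubes that can be leaves. *)
Lemma average_stopping_L1_dist f (psi : Rn R n -> R) d Q :
  L1 (cube_set Q) f -> L1 (cube_set Q) psi ->
  (forall q, subcube q Q -> stop q \/ side q = side Q / 2 ^+ d ->
     mosc f q <= \int[mu]_(x in cube_set q) psi x) ->
  \int[mu]_(x in cube_set Q) `|f x - average f (loc d Q x)| <=
  \int[mu]_(x in cube_set Q) psi x.
Proof.
elim: d Q => [|d IH] Q Lf Lpsi leaf /=.
  by apply: leaf => //; right; rewrite expr0 divr1.
case: asboolP => [stopQ|_]; first by apply: leaf => //; left.
have [|//|_ ->] := @L1_children_piecewise _ _ Q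
    (fun x => `|f x - average f (loc d (child Q (half_of Q x)) x)|)
    (fun e x => `|f x - average f (loc d (child Q e) x)|).
  move=> e; apply: L1_norm; apply: L1B => //; first exact: L1_child.
  exact: L1_average_stopping.
rewrite Rintegral_children//; apply: ler_sum => e _.
apply: IH; [exact: L1_child|exact: L1_child|].
move=> q qe leafq; apply: leaf.
  by apply: subset_trans qe _; exact: child_subcube.
by case: leafq => [|->]; [left|right; rewrite side_child exprS invfM mulrA].
Qed.

(** Averaging over leaves does not increase the L^1 distance to a constant. Localised to [S], the
    estimate needs [f] on all leaves that meet [S], whence [W]. *)
Lemma average_stopping_contract f (c : R) (S W : set (Rn R n)) d Q :
  L1 (cube_set Q) f -> measurable S -> measurable W ->
  (forall x, cube_set Q x -> S x -> cube_set (loc d Q x) `<=` W) ->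
  \int[mu]_(x in cube_set Q) (`|average f (loc d Q x) - c| * \1_S x) <=
  \int[mu]_(x in cube_set Q) (`|f x - c| * \1_W x).
Proof.
move=> + + mW; have leaf q S' : L1 (cube_set q) f -> measurable S' ->
    (forall x, cube_set q x -> S' x -> cube_set q `<=` W) ->
    \int[mu]_(x in cube_set q) (`|average f q - c| * \1_S' x) <=
    \int[mu]_(x in cube_set q) (`|f x - c| * \1_W x).
  move=> Lf mS' SW.
  have [[x [qx Sx]]|nS] := pselect (exists x, cube_set q x /\ S' x); last first.
    rewrite (@eq_Rintegral _ _ _ _ _ (fun=> 0)) => [|x /set_mem qx].
      by rewrite Rintegral_cube_cst mul0r; apply: Rintegral_ge0.
    by rewrite indicE memNset ?mulr0// => Sx; apply: nS; exists x.
  rewrite [leRHS]Rintegral_indicM (setIidl (SW x qx Sx)).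
  apply: le_trans (average_sub_le c Lf).
  rewrite -Rintegral_cube_cst; apply: le_Rintegral => //.
  - by apply: L1_indicM => //; exact: L1_cst.
  - exact: L1_cst.
  - by move=> y _; rewrite ler_piMr// indicE; case: (_ \in _).
elim: d Q S => [|d IH] Q S Lf mS SW /=; first exact: leaf.
case nstop : `[< stop Q >].
  by apply: leaf => // x Qx Sx; have := SW x Qx Sx; rewrite /= nstop.
pose H e := [set x | half_of Q x = e].
have mSH e : measurable (S `&` H e).
  by apply: measurableI => //; exact: measurable_half_of.
have [||_ ->] := @L1_children_piecewise _ _ Q
    (fun x => `|average f (loc d (child Q (half_of Q x)) x) - c| * \1_S x)
    (fun e x => `|average f (loc d (child Q e) x) - c| * \1_(S `&` H e) x).
- move=> e; apply: L1_indicM => //; apply: L1_norm_sub.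
  exact: L1_average_stopping.
- by move=> x Qx; rewrite !indicE in_setI [x \in H _]mem_set ?andbT.
have LfW : L1 (cube_set Q) (fun x => `|f x - c| * \1_W x).
  by apply: L1_indicM => //; exact: L1_norm_sub.
rewrite Rintegral_children//; apply: ler_sum => e _.
apply: IH => //; first exact: L1_child.
move=> x ex [Sx Hx]; have := SW x (child_subcube ex) Sx.
by rewrite /= nstop Hx.
Qed.

End stopping_cubes.

Section calderon_zygmund.
Context (R : realType) (n : nat) (n_gt0 : (0 < n)%N).
Local Notation mu := (lebesgue_Rn R n).
Local Notation L1 := (L1 mu).
Variable Q0 : cube R n.
Implicit Types (Q p : cube R n) (x y : Rn R n) (f g : Rn R n -> R).

Definition within (t : R) x y : Prop := forall i,
  tnth x i - t <= tnth y i <= tnth x i + t.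

(** The cube of radius t around x, pushed back into [Q0] where it sticks out. It is needed because
    the oscillation of [f] is controlled only on subcubes of [Q0]. *)
Lemma window x (t : R) : cube_set Q0 x -> 0 < t ->
  exists W, [/\ subcube W Q0, side W <= 2 * t &
                forall y, cube_set Q0 y -> within t x y -> cube_set W y].
Proof.
move=> Qx t0; have [St|tS] := leP (side Q0) (2 * t).
  by exists Q0; split => //; exact: subset_refl.
have t20 : 0 < 2 * t by rewrite mulr_gt0.
pose W := @Cube R n [tuple Num.max (tnth (corner Q0) i)
  (Num.min (tnth x i - t) (tnth (corner Q0) i + side Q0 - 2 * t)) | i < n] _ t20.
exists W; split => //=.
  move=> y Wy i; have := Wy i; rewrite /= tnth_mktuple /Num.max /Num.min.
  have := Qx i.
  by case: (ltP (tnth x i - t) (tnth (corner Q0) i + side Q0 - 2 * t)) => h1;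
    case: ltP => h2; lra.
move=> y Qy xy i; rewrite /= tnth_mktuple /Num.max /Num.min.
have := Qx i; have := Qy i; have := xy i.
by case: (ltP (tnth x i - t) (tnth (corner Q0) i + side Q0 - 2 * t)) => h1;
    case: ltP => h2; lra.
Qed.

Section good_part.
Variables (f gam : Rn R n -> R) (lam : R) (Om : set (Rn R n)) (y0 : Rn R n).
Variable d : nat.
Hypothesis lam0 : 0 < lam.
Hypothesis Lf : L1 (cube_set Q0) f.
Hypothesis fgam : forall Q, subcube Q Q0 ->
  mosc f Q <= \int[mu]_(x in cube_set Q) gam x.
Hypothesis lightP : forall Q y, subcube Q Q0 -> cube_set Q y -> ~ Om y ->
  \int[mu]_(x in cube_set Q) gam x <= 2 * lam * volume Q.
Hypothesis Qy0 : cube_set Q0 y0.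
Hypothesis Omy0 : ~ Om y0.

(** A Whitney condition relative to [Q0]: stopping requires the threefold dilate to lie in [Om], so
    that neighbouring stopping cubes have comparable sides. *)
Definition buried p : Prop := thicken p (side p) `&` cube_set Q0 `<=` Om.

Local Notation loc := (stopping_cube buried d Q0).
Local Notation sigma x := (side (loc x)).

Definition good_part x : R := average f (loc x).

(** The parent is not buried, so its dilate contains a point outside [Om], at distance at most twice
    the side of the parent. Without a parent the cube is [Q0], and [y0] serves. *)
Lemma stopping_near x : cube_set Q0 x ->
  exists y, [/\ cube_set Q0 y, ~ Om y & within (4 * sigma x) x y].
Proof.
move=> Qx; have [E|[p [np px sp]]] := stopping_cube_parent buried d Qx.
  exists y0; split => // i; rewrite E; have := Qx i; have := Qy0 i.
  by have := side_gt0 Q0; lra.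
have [y [[py Qy] ny]] : exists y, (thicken p (side p) `&` cube_set Q0) y /\ ~ Om y.
  by move/existsNP : np => [y /not_implyP[? ?]]; exists y.
exists y; split => // i; have := px i; have := py i; rewrite sp.
by have := side_gt0 (loc x); lra.
Qed.

(** If the cube of x' were smaller, [stopping_near] would place a point outside [Om] within half a
    side of x', inside the dilate of the buried cube of x. *)
Lemma stopping_comparable x x' : cube_set Q0 x -> cube_set Q0 x' ->
  within (sigma x / 2) x x' -> sigma x / 8 <= sigma x'.
Proof.
move=> Qx Qx' xx'; have s0 := side_gt0 (loc x).
have [bur|E] := stopping_cubeP buried d Q0 x; last first.
  apply: (@le_trans _ _ (sigma x)); first by lra.
  by rewrite E; exact: stopping_cube_side.
rewrite leNgt; apply/negP => lt; have [y [Qy ny yx']] := stopping_near Qx'.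
apply: ny; apply: bur; split => // i.
by have := stopping_cube_in buried d Qx i; have := xx' i; have := yx' i; lra.
Qed.

(** The leaves met by Q are larger than Q or comparable to it and to each other. They lie in a
    common window that reaches outside [Om], so the averages over them are all close to the average
    over the window. *)
Lemma mosc_good_part_coarse Q x : subcube Q Q0 -> cube_set Q x ->
  side Q <= sigma x / 2 -> mosc good_part Q <= 4 * 144 ^+ n * lam * volume Q.
Proof.
move=> QQ0 Qx sQ; have Q0x := QQ0 _ Qx; have s0 := side_gt0 (loc x).
have Lg : L1 (cube_set Q) good_part.
  by apply: (L1S _ _ QQ0) => //; exact: L1_average_stopping.
have sx x' : cube_set Q x' -> sigma x / 8 <= sigma x' <= 8 * sigma x.
  move=> Qx'; have Q0x' := QQ0 _ Qx'.
  have xx' i : tnth x i - side Q <= tnth x' i <= tnth x i + side Q.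
    by have := Qx i; have := Qx' i; lra.
  apply/andP; split.
    by apply: stopping_comparable => // i; have := xx' i; lra.
  have [/ltW le|le] := ltP (sigma x') (sigma x); first by lra.
  suff : sigma x' / 8 <= sigma x by lra.
  by apply: stopping_comparable => // i; have := xx' i; lra.
(* Leaves met by Q stay within 8.5 sigma of x: sigma / 2 inside Q, plus a side of at most 8 sigma.
   The window has side at most 18 sigma, which is at most 144 times the side of any of these
   leaves. *)
have [|W [WQ0 sW Wnear]] := @window x (9 * sigma x) Q0x; first by lra.
have [y [Qy ny xy]] := stopping_near Q0x.
have Wy : cube_set W y by apply: Wnear => // i; have := xy i; lra.
have fW : mosc f W <= 2 * lam * volume W.
  by apply: le_trans (fgam WQ0) _; exact: lightP ny.
have gW x' : cube_set Q x' -> `|good_part x' - average f W| <= 2 * 144 ^+ n * lam.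
  move=> Qx'; have Q0x' := QQ0 _ Qx'; have /andP[sx1 sx2] := sx _ Qx'.
  have lW : subcube (loc x') W.
    move=> z lz; apply: Wnear; first exact: stopping_cube_sub lz.
    move=> i; have := lz i; have := stopping_cube_in buried d Q0x' i.
    by have := Qx i; have := Qx' i; lra.
  rewrite -(ler_pM2r (volume_gt0 (loc x'))).
  apply: le_trans (average_mosc lW _) _; first exact: L1S Lf.
  apply: le_trans fW _; rewrite !volumeE.
  rewrite (_ : 2 * 144 ^+ n * lam * _ = 2 * lam * (144 * sigma x') ^+ n); last first.
    by rewrite exprMn; ring.
  rewrite ler_wpM2l ?mulr_ge0 ?(ltW lam0)// lerXn2r ?nnegrE//.
  - by rewrite ltW// side_gt0.
  - by have := side_gt0 (loc x'); lra.
  - by lra.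
apply: le_trans (mosc_le (average f W) Lg) _.
apply: (@le_trans _ _ (2 * (2 * 144 ^+ n * lam * volume Q))); last first.
  by rewrite le_eqVlt; apply/orP; left; apply/eqP; ring.
rewrite ler_wpM2l// -Rintegral_cube_cst; apply: le_Rintegral => //.
  exact: L1_norm_sub.
exact: L1_cst.
Qed.

(** All leaves met by Q are small compared with Q, so the oscillation of the averages is bounded by
    that of [f] over a window, by [average_stopping_contract]. The radius 8 side Q exceeds the
    distance 4 sigma to a point outside [Om]. *)
Lemma mosc_good_part_fine Q : subcube Q Q0 ->
  (forall x, cube_set Q x -> sigma x < 2 * side Q) ->
  mosc good_part Q <= 4 * 16 ^+ n * lam * volume Q.
Proof.
move=> QQ0 sQ; have s0 := side_gt0 Q.
have Qx := @corner_in_cube _ _ Q; set x := corner Q in Qx.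
have Q0x := QQ0 _ Qx.
have Lg : L1 (cube_set Q) good_part.
  by apply: (L1S _ _ QQ0) => //; exact: L1_average_stopping.
have [|W [WQ0 sW Wnear]] := @window x (8 * side Q) Q0x; first by lra.
have [y [Qy ny xy]] := stopping_near Q0x.
have Wy : cube_set W y.
  by apply: Wnear => // i; have := xy i; have := sQ x Qx; lra.
have fW : mosc f W <= 2 * lam * volume W.
  by apply: le_trans (fgam WQ0) _; exact: lightP ny.
apply: le_trans (mosc_le (average f W) Lg) _.
apply: (@le_trans _ _ (2 * (2 * lam * volume W))); last first.
  rewrite !volumeE (_ : 4 * _ * _ * _ = 2 * (2 * lam * (16 * side Q) ^+ n)).
    rewrite ler_wpM2l// ler_wpM2l ?mulr_ge0 ?(ltW lam0)// lerXn2r ?nnegrE//.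
    - by rewrite ltW// side_gt0.
    - by lra.
    - by lra.
  by rewrite exprMn; ring.
rewrite ler_wpM2l//; apply: le_trans fW.
have := @average_stopping_contract _ _ buried f (average f W) (cube_set Q)
  (cube_set W) d Q0 Lf (measurable_cube Q) (measurable_cube W).
rewrite !Rintegral_indicM (setIidr QQ0) (setIidr WQ0); apply.
move=> x' Q0x' Qx' z lz; apply: Wnear; first exact: stopping_cube_sub lz.
move=> i; have := lz i; have := stopping_cube_in buried d Q0x' i.
by have := Qx i; have := Qx' i; have := sQ _ Qx'; lra.
Qed.

Lemma mosc_good_part Q : subcube Q Q0 ->
  mosc good_part Q <= 4 * 144 ^+ n * lam * volume Q.
Proof.
move=> QQ0.
have [[x [Qx sx]]|nx] := pselect (exists x, cube_set Q x /\ side Q <= sigma x / 2).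
  exact: mosc_good_part_coarse Qx sx.
apply: le_trans (mosc_good_part_fine QQ0 _) _.
  by move=> x Qx; rewrite ltNge; apply/negP => sx; apply: nx; exists x; split => //; lra.
rewrite ler_wpM2r// ler_wpM2r ?(ltW lam0)// ler_wpM2l// lerXn2r ?nnegrE//.
by rewrite ler_nat.
Qed.

End good_part.

End calderon_zygmund.

Section good_bad_decomposition.
Context (R : realType) (n : nat) (n_gt0 : (0 < n)%N).
Local Notation mu := (lebesgue_Rn R n).
Local Notation L1 := (L1 mu).
Variable Q0 : cube R n.
Implicit Types (Q p : cube R n) (x y : Rn R n) (f g : Rn R n -> R).

(** 4 * 144^n bounds the oscillation of [good_part]. The L^1 error uses 15^n + 4: 15^n + 1 from
    [Om], 2 from the step approximation and 1 from its exceptional set. *)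
Definition cz_const : R := 4 * 144 ^+ n + 15 ^+ n + 4.

Lemma cz_const_ge1 : 1 <= cz_const.
Proof.
have h1 : (0 : R) <= 144 ^+ n by rewrite exprn_ge0.
have h2 : (0 : R) <= 15 ^+ n by rewrite exprn_ge0.
by rewrite /cz_const; lra.
Qed.

Lemma fine_mu_cubeI_le (A : set (Rn R n)) (a : R) : measurable A ->
  (mu A <= a%:E)%E -> fine (mu (cube_set Q0 `&` A)) <= a.
Proof.
move=> mA Aa; have le : (mu (cube_set Q0 `&` A) <= a%:E)%E.
  apply: le_trans Aa; apply: le_measure; rewrite ?inE//.
  exact: measurableI.
rewrite -lee_fin fineK// ge0_fin_numE//; apply: le_lt_trans le _.
by rewrite ltry.
Qed.

Lemma good_bad_decomposition f (gam : Rn R n -> R) (lam : R) : 0 < lam ->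
  L1 (cube_set Q0) f -> L1 (cube_set Q0) gam ->
  (forall x, cube_set Q0 x -> 0 <= gam x) ->
  (forall Q, subcube Q Q0 -> mosc f Q <= \int[mu]_(x in cube_set Q) gam x) ->
  exists g, [/\ L1 (cube_set Q0) g,
    \int[mu]_(x in cube_set Q0) `|f x - g x| <= cz_const * tail Q0 gam lam &
    forall Q, subcube Q Q0 -> mosc g Q <= cz_const * lam * volume Q].
Proof.
move=> lam0 Lf Lgam gam0 fgam; set J := tail Q0 gam lam.
have J0 : 0 <= J by exact: tail_ge0 gam0.
have C1 := cz_const_ge1; have C0 : 0 <= cz_const by lra.
have C144 : 4 * 144 ^+ n <= cz_const.
  by have h2 : (0 : R) <= 15 ^+ n; [rewrite exprn_ge0|rewrite /cz_const; lra].
have mgam := L1_measurable Lgam.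
have mS := measurable_superlevel lam mgam.
(* The maximal estimate is run on the part of [gam] above lam, which bounds the measure of [Om] by J
   / lam rather than |gam|_1 / lam. Outside [Om] the discarded part adds at most lam to the
   averages, whence 2 * lam. *)
pose u x := gam x * \1_(superlevel Q0 gam lam) x.
have Lu : L1 (cube_set Q0) u by exact: L1_indicM.
have u0 x : cube_set Q0 x -> 0 <= u x.
  by move=> Qx; apply: mulr_ge0 => //; exact: gam0.
have uJ : \int[mu]_(x in cube_set Q0) u x = J by rewrite /J tailE.
(* With J = 0 no error is allowed and [f] itself works; otherwise J sets the scale of the
   approximation error. *)
have [J_eq0|J_gt0] := leP J 0.
  exists f; split => //.
    under eq_Rintegral do rewrite subrr normr0.
    by rewrite Rintegral_cube_cst mul0r mulr_ge0.
  move=> Q QQ0; apply: le_trans (fgam _ QQ0) _.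
  apply: le_trans (Rintegral_cube_le_tail QQ0 Lgam gam0 (ltW lam0)) _.
  have : \int[mu]_(x in cube_set Q) u x <= J.
    by rewrite -uJ; exact: le_Rintegral_subset.
  have : lam * volume Q <= cz_const * lam * volume Q.
    by rewrite ler_wpM2r// ler_peMl// ltW.
  by rewrite /u; lra.
have [Om [mOm Om_le Om_heavy]] := weak_type_maximal n_gt0 lam0 Lu u0.
rewrite uJ in Om_le.
have gamOm : \int[mu]_(x in cube_set Q0) (gam x * \1_Om x) <= (15 ^+ n + 1) * J.
  apply: le_trans (Rintegral_indic_le_tail mOm Lgam gam0 (ltW lam0)) _.
  rewrite -/J mulrDl mul1r lerD2r.
  apply: (@le_trans _ _ (lam * (15 ^+ n / lam * J))).
    by rewrite ler_wpM2l ?(ltW lam0)//; exact: fine_mu_cubeI_le.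
  by rewrite mulrA mulrCA mulfV ?mulr1// gt_eqF.
(* If [Om] covers [Q0] no point outside is available as an anchor, but then the oscillation of [f]
   on [Q0] is already at most a multiple of J. *)
have [Q0Om|nQ0Om] := pselect (cube_set Q0 `<=` Om).
  exists (fun=> average f Q0); split; first exact: L1_cst.
    apply: le_trans (fgam Q0 (@subset_refl _ _)) _.
    rewrite -[X in Rintegral _ X _](setIidl Q0Om) -Rintegral_indicM.
    apply: le_trans gamOm _; rewrite ler_wpM2r// /cz_const.
    by have h1 : (0 : R) <= 144 ^+ n; [rewrite exprn_ge0|lra].
  by move=> Q _; rewrite mosc_cst !mulr_ge0// ltW.
have [y0 [Qy0 Omy0]] : exists y, cube_set Q0 y /\ ~ Om y.
  by move/existsNP : nQ0Om => [y /not_implyP[? ?]]; exists y.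
have lightP Q y : subcube Q Q0 -> cube_set Q y -> ~ Om y ->
    \int[mu]_(x in cube_set Q) gam x <= 2 * lam * volume Q.
  move=> QQ0 Qy ny.
  apply: le_trans (Rintegral_cube_le_tail QQ0 Lgam gam0 (ltW lam0)) _.
  have : \int[mu]_(x in cube_set Q) u x <= lam * volume Q.
    by rewrite leNgt; apply/negP => /(Om_heavy _ QQ0)/(_ _ Qy).
  by rewrite /u; lra.
have J20 : 0 < J / 2 by rewrite divr_gt0.
have [K KJ] := tail_small Lgam gam0 J20.
(* The second bound makes the integral of [gam] over a set of measure eps at most K * eps + J / 2 <=
   J. *)
pose eps := Num.min J (J / 2 / (K%:R + 1)).
have K1 : 0 < K%:R + 1 :> R by rewrite ltr_wpDl.
have eps0 : 0 < eps by rewrite lt_min J_gt0 !divr_gt0.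
have [s [E [delta [delta0 [mE Ee] Ls fs lc]]]] := L1_step_approximable Lf eps0.
have gamE : \int[mu]_(x in cube_set Q0) (gam x * \1_E x) <= J.
  apply: le_trans (Rintegral_indic_le_tail mE Lgam gam0 (ler0n _ K)) _.
  rewrite [leRHS](splitr J) lerD//.
  apply: (@le_trans _ _ (K%:R * eps)).
    by rewrite ler_wpM2l//; exact: fine_mu_cubeI_le.
  apply: (@le_trans _ _ (K%:R * (J / 2 / (K%:R + 1)))).
    by rewrite ler_wpM2l// ge_min lexx orbT.
  rewrite mulrCA ler_piMr ?(ltW J20)// ler_pdivrMr// mul1r.
  by rewrite lerDl.
have [d dd] : exists d, side Q0 / 2 ^+ d <= delta.
  have [d0|d0] := leP (side Q0) delta; first by exists 0%N; rewrite expr0 divr1.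
  have d20 : 0 < delta / 2 by rewrite divr_gt0.
  have [|d [_ dd]] := dyadic_scale d20 (S := side Q0); first by lra.
  by exists d; lra.
pose g := good_part Q0 f Om d.
exists g; split; first exact: L1_average_stopping.
(* One summand for each kind of leaf: buried, of generation d with [s] constant, of generation d
   inside [E]. *)
- pose psi x := gam x * \1_Om x + 2 * `|f x - s x| + gam x * \1_E x.
  have Lfs : L1 (cube_set Q0) (fun x => `|f x - s x|).
    by apply: L1_norm; exact: L1B.
  have LgO : L1 (cube_set Q0) (fun x => gam x * \1_Om x) by exact: L1_indicM.
  have LgE : L1 (cube_set Q0) (fun x => gam x * \1_E x) by exact: L1_indicM.
  have Lpsi : L1 (cube_set Q0) psi.
    by apply: L1D => //; apply: L1D => //; exact: L1Z.
  have psiE : \int[mu]_(x in cube_set Q0) psi x <= cz_const * J.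
    rewrite RintegralD//; last by apply: L1D => //; exact: L1Z.
    rewrite RintegralD//; last exact: L1Z.
    rewrite RintegralZl//.
    have : eps <= J by rewrite ge_min lexx.
    have h : 0 <= 144 ^+ n * J by rewrite mulr_ge0// exprn_ge0.
    move: fs gamE gamOm h; rewrite /cz_const !mulrDl; lra.
  apply: le_trans psiE; apply: average_stopping_L1_dist => // q qQ0 leafq.
  have Lq w : L1 (cube_set Q0) w -> L1 (cube_set q) w by exact: L1S.
  have mono w : L1 (cube_set Q0) w -> (forall x, cube_set q x -> w x <= psi x) ->
      \int[mu]_(x in cube_set q) w x <= \int[mu]_(x in cube_set q) psi x.
    by move=> Lw wpsi; apply: le_Rintegral => //; exact: Lq.
  have in_set A : measurable A -> cube_set q `<=` A ->
      mosc f q <= \int[mu]_(x in cube_set q) (gam x * \1_A x).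
    move=> mA qA; rewrite Rintegral_indicM (setIidl qA); exact: fgam.
  have g0 A x : cube_set q x -> 0 <= gam x * \1_A x.
    by move=> qx; rewrite mulr_ge0// gam0//; exact: qQ0.
  case: leafq => [bur|sq].
    have qOm : cube_set q `<=` Om.
      move=> x qx; apply: bur; split; last exact: qQ0.
      by move=> i; have := qx i; have := side_gt0 q; lra.
    apply: le_trans (in_set _ mOm qOm) _; apply: mono => // x qx.
    rewrite /psi; have := g0 E x qx; have := normr_ge0 (f x - s x); lra.
  have [qE|sc] := lc q qQ0 (eq_ind_r (fun r => r <= delta) dd sq).
    apply: le_trans (in_set _ mE qE) _; apply: mono => // x qx.
    rewrite /psi; have := g0 Om x qx; have := normr_ge0 (f x - s x); lra.
  have Lfq := Lq _ Lf; apply: le_trans (mosc_le (s (corner q)) Lfq) _.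
  rewrite -RintegralZl//; last exact: L1_norm_sub.
  rewrite (@eq_Rintegral _ _ _ _ _ (fun x => 2 * `|f x - s x|)); last first.
    by move=> x /set_mem qx; rewrite (sc x (corner q))//; exact: corner_in_cube.
  apply: mono => [|x qx]; first exact: L1Z.
  by rewrite /psi; have := g0 Om x qx; have := g0 E x qx; lra.
- move=> Q QQ0; apply: le_trans (mosc_good_part d lam0 Lf fgam lightP Qy0 Omy0 QQ0) _.
  by rewrite ler_wpM2r// ler_wpM2r// ltW.
Qed.

End good_bad_decomposition.

(** * Majorants of the mean oscillation *)

Section truncated_majorant.
Context (R : realType) (n : nat).
Local Notation mu := (lebesgue_Rn R n).
Local Notation L1 := (L1 mu).
Variables (Q0 : cube R n) (h e : Rn R n -> R) (B r : R).
Implicit Types (Q p : cube R n) (x y : Rn R n).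
Hypothesis Lh : L1 (cube_set Q0) h.
Hypothesis B0 : 0 < B.
Hypothesis hB : forall Q, subcube Q Q0 -> mosc h Q <= B * volume Q.
Hypothesis Le : L1 (cube_set Q0) e.
Hypothesis e0 : forall x, cube_set Q0 x -> 0 <= e x.
Hypothesis r0 : 0 < r.
Hypothesis he : forall Q, subcube Q Q0 -> side Q <= r ->
  mosc h Q <= \int[mu]_(x in cube_set Q) e x.

Definition truncated x : R := Num.min `|h x| (4 * B).
Local Notation v := truncated.

Lemma truncated_ge0 x : 0 <= v x.
Proof. by rewrite le_min normr_ge0 mulr_ge0// ltW. Qed.

Lemma L1_truncated : L1 (cube_set Q0) v.
Proof.
apply: L1_le (L1_norm Lh) => //.
  apply: measurable_minr; last exact: measurable_cst.
  exact: L1_measurable (L1_norm Lh).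
by move=> x _; rewrite ger0_norm ?truncated_ge0// ge_min lexx.
Qed.

Let L1_sub Q u : subcube Q Q0 -> L1 (cube_set Q0) u -> L1 (cube_set Q) u.
Proof. by move=> QQ0; exact: L1S. Qed.

(** The mean m satisfies min(|m|, 4 B) |p| <= int v + mosc < (3 B + B) |p|, so the truncation does
    not act on m. This is why the truncation level is 4 B. *)
Lemma norm_integral_le_truncated p : subcube p Q0 ->
  \int[mu]_(x in cube_set p) v x < 3 * B * volume p ->
  \int[mu]_(x in cube_set p) `|h x| <=
  \int[mu]_(x in cube_set p) v x + 2 * mosc h p.
Proof.
move=> pQ0 vp; set m := average h p.
have Lhp := L1_sub pQ0 Lh; have Lvp := L1_sub pQ0 L1_truncated.
have Ld : L1 (cube_set p) (fun x => `|h x - m|) by exact: L1_norm_sub.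
have minm : Num.min `|m| (4 * B) * volume p <=
    \int[mu]_(x in cube_set p) v x + mosc h p.
  rewrite -Rintegral_cube_cst -RintegralD//; apply: le_Rintegral => //.
  - exact: L1_cst.
  - exact: L1D.
  - move=> x _; have := ler_normD (m - h x) (h x); rewrite subrK distrC.
    have := normr_ge0 (h x - m); rewrite /truncated.
    rewrite /Num.min; case: ltP => h1; case: ltP => h2; rewrite -/m; lra.
have hBp := hB pQ0.
have m4 : `|m| < 4 * B.
  rewrite ltNge; apply/negP => m4; move: minm; rewrite (min_idPr m4).
  by lra.
rewrite (min_idPl (ltW m4)) in minm.
have : \int[mu]_(x in cube_set p) `|h x| <= mosc h p + `|m| * volume p.
  rewrite -Rintegral_cube_cst -RintegralD//; last exact: L1_cst.
  apply: le_Rintegral => //; first exact: L1_norm.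
    by apply: L1D => //; exact: L1_cst.
  by move=> x _; have := ler_normD (h x - m) m; rewrite subrK.
by lra.
Qed.

(* A cube with little truncated mass is split until its mass becomes
   comparable with B times its volume, or its side drops below r. *)
Lemma norm_integral_le_light d p : subcube p Q0 -> side p <= r * 2 ^+ d ->
  \int[mu]_(x in cube_set p) v x < 3 * B / 2 ^+ n * volume p ->
  \int[mu]_(x in cube_set p) `|h x| <=
  (2 + 2 ^+ n) * \int[mu]_(x in cube_set p) (v x + e x).
Proof.
have p2 : (1 : R) <= 2 ^+ n by rewrite exprn_ege1// ler1n.
have p20 : (0 : R) < 2 ^+ n by rewrite exprn_gt0.
have ve q : subcube q Q0 -> \int[mu]_(x in cube_set q) (v x + e x) =
    \int[mu]_(x in cube_set q) v x + \int[mu]_(x in cube_set q) e x.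
  by move=> qQ0; rewrite RintegralD//; apply: L1_sub => //; exact: L1_truncated.
have v_ge0 q : 0 <= \int[mu]_(x in cube_set q) v x.
  by apply: Rintegral_ge0 => x _; exact: truncated_ge0.
have e_ge0 q : subcube q Q0 -> 0 <= \int[mu]_(x in cube_set q) e x.
  by move=> qQ0; apply: Rintegral_ge0 => x /qQ0/e0.
elim: d p => [|d IH] p pQ0 sp vp.
  have vp' : \int[mu]_(x in cube_set p) v x < 3 * B * volume p.
    apply: lt_le_trans vp _; rewrite ler_wpM2r// ler_pdivrMr//.
    by rewrite ler_peMr// mulr_ge0// ltW.
  apply: le_trans (norm_integral_le_truncated pQ0 vp') _.
  rewrite expr0 mulr1 in sp; have := he pQ0 sp; rewrite ve//.
  have := v_ge0 p; have := e_ge0 p pQ0; nra.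
have Lhp := L1_norm (L1_sub pQ0 Lh).
have Lvp : L1 (cube_set p) (fun x => v x + e x).
  by apply: L1D => //; apply: L1_sub => //; exact: L1_truncated.
rewrite !Rintegral_children// mulr_sumr; apply: ler_sum => c _.
have cp := @child_subcube _ _ p c; have cQ0 := subset_trans cp pQ0.
have [light|heavy] :=
  ltP (\int[mu]_(x in cube_set (child p c)) v x) (3 * B / 2 ^+ n * volume (child p c)).
  apply: IH => //; rewrite side_child ler_pdivrMr//.
  by rewrite -mulrA -exprSr.
(* The 2^n in the threshold serves here: a light parent gives every child less than 3 B times its
   volume. A heavy child can then be estimated directly, its oscillation being charged to its own
   truncated mass. *)
have vc : \int[mu]_(x in cube_set (child p c)) v x < 3 * B * volume (child p c).
  rewrite volume_child mulrA mulrAC; apply: le_lt_trans vp.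
  apply: le_Rintegral_subset => //; last by move=> x _; exact: truncated_ge0.
  by apply: L1_sub => //; exact: L1_truncated.
apply: le_trans (norm_integral_le_truncated cQ0 vc) _.
have hBc := hB cQ0; rewrite ve//.
have heavy' : 3 * (B * volume (child p c)) <=
    2 ^+ n * \int[mu]_(x in cube_set (child p c)) v x.
  rewrite -ler_pdivrMl//; apply: le_trans heavy.
  by rewrite le_eqVlt; apply/orP; left; apply/eqP; ring.
have := v_ge0 (child p c); have := e_ge0 _ cQ0; nra.
Qed.

(** On a heavy cube the BMO bound is already below the truncated mass times a constant. On a light
    one the oscillation around 0 is used, which doubles the constant 2 + 2^n. *)
Lemma mosc_le_truncated Q : subcube Q Q0 ->
  mosc h Q <= (4 + 2 * 2 ^+ n) * \int[mu]_(x in cube_set Q) (v x + e x).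
Proof.
move=> QQ0.
have p20 : (0 : R) < 2 ^+ n by rewrite exprn_gt0.
have v_ge0 : 0 <= \int[mu]_(x in cube_set Q) v x.
  by apply: Rintegral_ge0 => x _; exact: truncated_ge0.
have e_ge0 : 0 <= \int[mu]_(x in cube_set Q) e x.
  by apply: Rintegral_ge0 => x /QQ0/e0.
have ve : \int[mu]_(x in cube_set Q) (v x + e x) =
    \int[mu]_(x in cube_set Q) v x + \int[mu]_(x in cube_set Q) e x.
  by rewrite RintegralD//; apply: L1_sub => //; exact: L1_truncated.
have [light|heavy] :=
  ltP (\int[mu]_(x in cube_set Q) v x) (3 * B / 2 ^+ n * volume Q).
  have [d sd] : exists d, side Q <= r * 2 ^+ d.
    have [Qr|rQ] := leP (side Q) r; first by exists 0%N; rewrite expr0 mulr1.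
    have r20 : 0 < r / 2 by rewrite divr_gt0.
    have [|d [_ dd]] := dyadic_scale r20 (S := side Q); first by lra.
    exists d; move: dd; rewrite ltr_pdivrMr ?exprn_gt0// => /ltW.
    by rewrite (_ : 2 * (r / 2) = r)//; lra.
  have := norm_integral_le_light QQ0 sd light.
  have := mosc_le 0 (L1_sub QQ0 Lh).
  under eq_Rintegral do rewrite subr0.
  by move=> h1 h2; apply: le_trans h1 _; move: h2; set I := Rintegral _ _ _; nra.
apply: le_trans (hB QQ0) _; rewrite ve.
have heavy' : 3 * (B * volume Q) <= 2 ^+ n * \int[mu]_(x in cube_set Q) v x.
  rewrite -ler_pdivrMl//; apply: le_trans heavy.
  by rewrite le_eqVlt; apply/orP; left; apply/eqP; ring.
nra.
Qed.

End truncated_majorant.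

(** * Sets of prescribed measure, cut out and spread over dyadic cubes *)

Section slicing.
Context (R : realType) (n : nat) (n_gt0 : (0 < n)%N).
Local Notation mu := (lebesgue_Rn R n).
Variable Q0 : cube R n.

Let i0 := Ordinal n_gt0.
Let below (t : R) : set (Rn R n) := [set x | tnth x i0 <= t].

Let measurable_below t : measurable (below t).
Proof.
apply: (@measurable_coord _ _ i0 [set r | r <= t]).
rewrite (_ : [set r | _] = `]-oo, t]%classic)//.
Qed.

Lemma fin_num_mu_subcube (Z : set (Rn R n)) : measurable Z ->
  Z `<=` cube_set Q0 -> mu Z \is a fin_num.
Proof.
move=> mZ ZQ; rewrite ge0_fin_numE//; apply: le_lt_trans (mu_cube_fin Q0).
by apply: le_measure; rewrite ?inE.
Qed.

(** Intermediate value theorem for the measure of the part of [Z] below a moving hyperplane; by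
    [mu_slab] it is Lipschitz in the position. *)
Lemma subset_of_measure (Z : set (Rn R n)) (t : R) : measurable Z ->
  Z `<=` cube_set Q0 -> 0 <= t -> (t%:E <= mu Z)%E ->
  exists Z', [/\ measurable Z', Z' `<=` Z & mu Z' = t%:E].
Proof.
move=> mZ ZQ t0 tZ; pose m (a : R) := fine (mu (Z `&` below a)).
have mZb a : measurable (Z `&` below a) by exact: measurableI.
have finZ a : mu (Z `&` below a) \is a fin_num.
  by apply: fin_num_mu_subcube => // x [/ZQ].
pose L := side Q0 ^+ n.-1.
have L0 : 0 < L by rewrite exprn_gt0// side_gt0.
have mB a b : a <= b -> 0 <= m b - m a <= (b - a) * L.
  move=> ab; pose D := Z `&` below b `\` (Z `&` below a).
  have mD : measurable D by exact: measurableD.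
  have finD : mu D \is a fin_num.
    by apply: fin_num_mu_subcube => // x [[/ZQ]].
  have ZE : Z `&` below b = (Z `&` below a) `|` D.
    apply/seteqP; split => x.
      by move=> Zx; have [Ax|nAx] := pselect ((Z `&` below a) x); [left|right].
    by move=> [[Zx xa]|[]//]; split => //; exact: le_trans xa ab.
  have E : mu (Z `&` below b) = (mu (Z `&` below a) + mu D)%E.
    rewrite ZE measureU//; apply/seteqP; split => // x [Ax [_ nAx]].
    exact: nAx.
  have -> : m b - m a = fine (mu D) by rewrite /m E fineD// addrAC subrr add0r.
  rewrite fine_ge0//= -lee_fin fineK//.
  apply: le_trans (mu_slab Q0 i0 ab); apply: le_measure; rewrite ?inE//.
    apply: measurableI => //.
    exact: (@measurable_coord _ _ i0 _ (measurable_le_le _ _)).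
  move=> x [[Zx xb] nxa]; split; first exact: ZQ.
  apply/andP; split => //; rewrite leNgt; apply/negP => /ltW xa.
  by apply: nxa.
pose a0 := tnth (corner Q0) i0 - 1; pose b0 := tnth (corner Q0) i0 + side Q0.
have ab0 : a0 <= b0 by rewrite /a0 /b0; have := side_gt0 Q0; lra.
have ma0 : m a0 = 0.
  rewrite /m (_ : Z `&` below a0 = set0) ?measure0//.
  apply/seteqP; split => // x [/ZQ/(_ i0)/andP[+ _]].
  by rewrite /below/= /a0; lra.
have mb0 : m b0 = fine (mu Z).
  congr (fine (mu _)); apply/setIidl => x /ZQ/(_ i0)/andP[_].
  by [].
have m_cont : {within `[a0, b0], continuous m}.
  apply: continuous_subspaceT => a; apply/cvgrPdist_le => /= eps eps0.
  have eL : 0 < eps / L by rewrite divr_gt0.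
  apply: filterS (nbhsx_ballx a _ eL) => b.
  rewrite /ball/= ltr_pdivlMr// => /ltW dist.
  apply: le_trans dist; have [ab|/ltW ba] := leP a b.
    have /andP[m0 mL] := mB _ _ ab.
    by rewrite distrC (distrC a b) (ger0_norm m0) ger0_norm ?subr_ge0.
  have /andP[m0 mL] := mB _ _ ba.
  by rewrite (ger0_norm m0) ger0_norm ?subr_ge0.
have finZ' : mu Z \is a fin_num by exact: fin_num_mu_subcube.
have tZ' : t <= fine (mu Z) by rewrite -lee_fin fineK.
have [|c _ mc] := @IVT R m a0 b0 t ab0 m_cont.
  by rewrite ma0 mb0 ge_min le_max t0 tZ' orbT.
exists (Z `&` below c); split => //.
by rewrite -mc fineK.
Qed.

End slicing.

Section spreading.
Context (R : realType) (n : nat) (n_gt0 : (0 < n)%N).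
Local Notation mu := (lebesgue_Rn R n).
Local Notation L1 := (L1 mu).
Implicit Types (Q p : cube R n) (x y : Rn R n) (A : nat -> set (Rn R n)).

Definition layers (lam : nat -> R) (s : seq nat) A x : R :=
  \sum_(i <- s) lam i * \1_(A i) x.

Lemma layers_ge0 lam s A x : (forall i, 0 <= lam i) -> 0 <= layers lam s A x.
Proof. by move=> lam0; apply: sumr_ge0 => i _; rewrite mulr_ge0. Qed.

Lemma le_layers lam s A A' x : (forall i, 0 <= lam i) ->
  (forall i, A i x -> A' i x) -> layers lam s A x <= layers lam s A' x.
Proof.
move=> lam0 AA'; apply: ler_sum => i _; rewrite ler_wpM2l// !indicE ler_nat.
have [xA|//] := boolP (x \in A i); rewrite mem_set//.
by apply: AA'; exact/set_mem.
Qed.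

Lemma L1_layers lam s A Q : (forall i, measurable (A i)) ->
  L1 (cube_set Q) (layers lam s A).
Proof.
by move=> mA; apply: L1_sum => // i; apply: L1Z => //; exact: L1_indic.
Qed.

Variables (Q0 : cube R n) (v : Rn R n -> R) (lam bet : nat -> R) (s : seq nat).
Variable kap : R.
Hypothesis Lv : L1 (cube_set Q0) v.
Hypothesis v0 : forall x, cube_set Q0 x -> 0 <= v x.
Hypothesis lam0 : forall i, 0 <= lam i.
Hypothesis bet0 : forall i, 0 <= bet i.
Hypothesis kap0 : 0 <= kap.
Hypothesis kapE : \sum_(i <- s) lam i * (kap * bet i) = 4^-1.
Hypothesis fits : forall i p, subcube p Q0 ->
  kap * bet i * \int[mu]_(x in cube_set p) v x <= volume p.

(** In each cube of generation d the sets are cut to measure proportional to the mass of [v] there,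
    which by [kapE] gives the layers a quarter of that mass. [S] and [W] express the comparison on
    arbitrary cubes: a generation-d cube meeting [S] lies in [W], so only a boundary strip is
    lost. *)
Lemma spread_layers d p : subcube p Q0 -> exists A,
  [/\ forall i, measurable (A i), forall i, A i `<=` cube_set p,
      forall i, (mu (A i) <= (kap * bet i * \int[mu]_(x in cube_set p) v x)%:E)%E &
      forall S W : set (Rn R n), measurable S -> measurable W ->
        (forall x y, cube_set p x -> S x -> cube_set p y ->
           within (side p / 2 ^+ d) x y -> W y) ->
        4^-1 * \int[mu]_(x in cube_set p) (v x * \1_S x) <=
        \int[mu]_(x in cube_set p) (layers lam s A x * \1_W x)].
Proof.
elim: d p => [|d IH] p pQ0.
  have Lvp : L1 (cube_set p) v by exact: L1S Lv.
  have I0 : 0 <= \int[mu]_(x in cube_set p) v x.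
    by apply: Rintegral_ge0 => x /pQ0/v0.
  have /choice[A AP] : forall i, exists E : set (Rn R n),
      [/\ measurable E, E `<=` cube_set p &
      mu E = (kap * bet i * \int[mu]_(x in cube_set p) v x)%:E].
    move=> i; apply: (@subset_of_measure _ _ n_gt0 p) => //.
      by rewrite !mulr_ge0.
    by rewrite mu_volume lee_fin fits.
  have mA i : measurable (A i) by case: (AP i).
  have Ap i : A i `<=` cube_set p by case: (AP i).
  have muA i : mu (A i) = (kap * bet i * \int[mu]_(x in cube_set p) v x)%:E.
    by case: (AP i).
  exists A; split => //; first by move=> i; rewrite muA.
  move=> S W mS mW SW.
  have [[x [px Sx]]|nS] := pselect (exists x, cube_set p x /\ S x); last first.
    rewrite (@eq_Rintegral _ _ _ _ _ (fun=> 0)) => [|x /set_mem px]; last first.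
      by rewrite indicE memNset ?mulr0// => Sx; apply: nS; exists x.
    rewrite Rintegral_cube_cst mul0r mulr0; apply: Rintegral_ge0 => x _.
    by rewrite mulr_ge0// layers_ge0.
  have pW : cube_set p `<=` W.
    move=> y py; apply: (SW x) => // i; rewrite expr0 divr1.
    by have := px i; have := py i; lra.
  rewrite [leRHS]Rintegral_indicM (setIidl pW).
  rewrite [leRHS]Rintegral_sum//; last first.
    by move=> i; apply: L1Z => //; exact: L1_indic.
  rewrite [leRHS](eq_bigr (fun i => lam i * (kap * bet i) *
      \int[mu]_(x in cube_set p) v x)); last first.
    move=> i _; rewrite RintegralZl//; last exact: L1_indic.
    rewrite Rintegral_indic// (setIidr (@Ap i)) -mulrA; congr (_ * _).
    exact: (congr1 fine (muA i)).
  rewrite -mulr_suml kapE ler_wpM2l// Rintegral_indicM.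
  apply: le_Rintegral_subset => //; first exact: measurableI.
  by move=> z /pQ0/v0.
have /choice[AA AP] : forall e : {ffun 'I_n -> bool}, exists A, [/\ forall i, measurable (A i),
    forall i, A i `<=` cube_set (child p e),
    forall i, (mu (A i) <=
      (kap * bet i * \int[mu]_(x in cube_set (child p e)) v x)%:E)%E &
    forall S W : set (Rn R n), measurable S -> measurable W ->
      (forall x y, cube_set (child p e) x -> S x -> cube_set (child p e) y ->
         within (side (child p e) / 2 ^+ d) x y -> W y) ->
      4^-1 * \int[mu]_(x in cube_set (child p e)) (v x * \1_S x) <=
      \int[mu]_(x in cube_set (child p e)) (layers lam s A x * \1_W x)].
  by move=> e; apply: IH; apply: subset_trans pQ0; exact: child_subcube.
have mAA e i : measurable (AA e i) by case: (AP e).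
have Lvp : L1 (cube_set p) v by exact: L1S Lv.
pose A i := \big[setU/set0]_(e : {ffun 'I_n -> bool}) AA e i.
have mA i : measurable (A i) by exact: bigsetU_measurable.
exists A; split => //.
- move=> i x; rewrite /A -bigcup_seq => -[e _].
  by have [_ h _ _] := AP e => /h; exact: child_subcube.
- move=> i; apply: le_trans (measure_bigsetU_le _ _ _) _ => //.
  rewrite Rintegral_children// mulr_sumr -sumEFin; apply: lee_sum => e _.
  by have [_ _ h _] := AP e; exact: h.
- move=> S W mS mW SW.
  have LvS : L1 (cube_set p) (fun x => v x * \1_S x) by exact: L1_indicM.
  have LW : L1 (cube_set p) (fun x => layers lam s A x * \1_W x).
    by apply: L1_indicM => //; exact: L1_layers.
  rewrite !Rintegral_children// mulr_sumr; apply: ler_sum => e _.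
  have cp := @child_subcube _ _ p e.
  have [_ _ _ /(_ S W mS mW) h] := AP e; apply: le_trans (h _) _.
    move=> x y ex Sx ey xy; apply: (SW x y) => //; try exact: cp.
    by rewrite exprS invfM mulrA.
  apply: le_Rintegral => //.
  + by apply: L1_indicM => //; exact: L1_layers.
  + exact: L1_child.
  + move=> x _; rewrite ler_wpM2r//; apply: le_layers => // i Ax.
    by rewrite /A -bigcup_seq; exists e => //=; rewrite mem_index_enum.
Qed.

End spreading.

(** * Majorants made of layers *)

Section layered_majorant.
Context (R : realType) (n : nat) (n_gt0 : (0 < n)%N).
Local Notation mu := (lebesgue_Rn R n).
Local Notation L1 := (L1 mu).
Variable Q0 : cube R n.
Implicit Types (Q p : cube R n) (x y : Rn R n) (h : Rn R n -> R).

Definition majorant_const : R := 4 + 2 * 2 ^+ n.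
Local Notation K := majorant_const.

Lemma majorant_const_ge4 : 4 <= K.
Proof. by rewrite lerDl mulr_ge0// exprn_ge0. Qed.

(** A small cube either has [s] constant and |h - s| of mean at most eps, or lies in an exceptional
    set of small measure; there the BMO bound is the integral of B times the indicator. *)
Lemma small_scale_majorant h (B eps eta : R) : 0 < B -> 0 < eps -> 0 < eta ->
  L1 (cube_set Q0) h -> (forall Q, subcube Q Q0 -> mosc h Q <= B * volume Q) ->
  exists E r, [/\ measurable E, (mu E <= eta%:E)%E, 0 < r &
    forall Q, subcube Q Q0 -> side Q <= r ->
      mosc h Q <= \int[mu]_(x in cube_set Q) (2 * eps + B * \1_E x)].
Proof.
move=> B0 eps0 eta0 Lh hB.
pose C := 15 ^+ n / eps + 1.
have C0 : 0 < C by rewrite ltr_wpDl// divr_ge0 ?exprn_ge0// ltW.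
have e0 : 0 < eta / C by rewrite divr_gt0.
have [s [E [r [r0 [mE Ee] Ls hs lc]]]] := L1_step_approximable Lh e0.
have Lhs : L1 (cube_set Q0) (fun x => `|h x - s x|).
  by apply: L1_norm; exact: L1B.
have [Om [mOm Ome Om_heavy]] :=
  weak_type_maximal n_gt0 eps0 Lhs (fun x _ => normr_ge0 (h x - s x)).
have mEO : measurable (E `|` Om) by exact: measurableU.
exists (E `|` Om), r; split => //.
  apply: le_trans (measureU2 _ mE mOm) _.
  apply: le_trans (leeD Ee Ome) _; rewrite -EFinD lee_fin.
  apply: (@le_trans _ _ (eta / C * C)); last by rewrite divfK// gt_eqF.
  rewrite mulrDr mulr1 addrC lerD2r mulrC ler_wpM2r//.
  by rewrite divr_ge0 ?exprn_ge0// ltW.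
move=> Q QQ0 sQ; have LhQ : L1 (cube_set Q) h by exact: L1S Lh.
have rhsE : \int[mu]_(x in cube_set Q) (2 * eps + B * \1_(E `|` Om) x) =
    2 * eps * volume Q + B * fine (mu (cube_set Q `&` (E `|` Om))).
  have LE := L1_indic Q mEO.
  rewrite RintegralD//; [|exact: L1_cst|exact: L1Z].
  by rewrite Rintegral_cube_cst RintegralZl// Rintegral_indic.
rewrite rhsE; have eps2 : 0 <= 2 * eps * volume Q by rewrite !mulr_ge0// ltW.
have inside : cube_set Q `<=` E `|` Om ->
    mosc h Q <= 2 * eps * volume Q + B * fine (mu (cube_set Q `&` (E `|` Om))).
  by move=> QE; rewrite (setIidl QE); apply: le_trans (hB _ QQ0) _; rewrite lerDr.
have [QE|sc] := lc Q QQ0 sQ; first by apply: inside => x /QE; left.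
have [heavy|light] :=
    ltP (eps * volume Q) (\int[mu]_(x in cube_set Q) `|h x - s x|).
  by apply: inside => x Qx; right; exact: (Om_heavy Q).
apply: le_trans (mosc_le (s (corner Q)) LhQ) _.
rewrite (@eq_Rintegral _ _ _ _ _ (fun x => `|h x - s x|)); last first.
  by move=> x /set_mem Qx; rewrite (sc x (corner Q))//; exact: corner_in_cube.
apply: (@le_trans _ _ (2 * eps * volume Q)); first by lra.
by rewrite lerDl mulr_ge0 ?(ltW B0)// fine_ge0.
Qed.

(** Bernoulli's inequality; it bounds the share of a cube lost to a boundary strip. *)
Lemma bernoulli_sub (t s : R) : 0 < s -> 0 <= t <= s ->
  s ^+ n - (s - t) ^+ n <= n%:R * t / s * s ^+ n.
Proof.
move=> s0 /andP[t0 ts]; have s_neq0 : s != 0 by rewrite gt_eqF.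
have -> : s - t = s * (1 - t / s) by field.
rewrite exprMn -{1}[s ^+ n]mulr1 -mulrBr mulrC ler_wpM2r ?exprn_ge0 ?(ltW s0)//.
have q0 : 0 <= t / s by rewrite divr_ge0// ltW.
have q1 : t / s <= 1 by rewrite ler_pdivrMr// mul1r.
rewrite -mulrA; move: (t / s) q0 q1 => q q0 q1; elim: (n) => [|m IH].
  by rewrite expr0 subrr mul0r.
have p1 : (1 - q) ^+ m <= 1 by rewrite exprn_ile1//; lra.
rewrite exprS -natr1; nra.
Qed.

(** On cubes of side above r the spread layers reproduce the truncated mass up to a thin boundary
    strip; on smaller ones the exceptional set [E], hidden in one of the layers, suffices. The
    factor 5 is 4 for inverting the quarter in [spread_layers] plus 1 for [E]. *)
Lemma layered_majorant h (B eps : R) (s : seq nat) (lam bet : nat -> R) :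
  0 < B -> 0 < eps -> L1 (cube_set Q0) h ->
  (forall Q, subcube Q Q0 -> mosc h Q <= B * volume Q) ->
  (forall i, 0 <= lam i) -> (forall i, 0 <= bet i) ->
  (forall i, i \in s -> B <= lam i) -> (forall i, i \notin s -> bet i = 0) ->
  0 < \sum_(i <- s) lam i * bet i ->
  \int[mu]_(x in cube_set Q0) `|h x| <= \sum_(i <- s) lam i * bet i ->
  exists A : nat -> set (Rn R n),
    [/\ forall i, measurable (A i), forall i, A i `<=` cube_set Q0,
        forall i, (mu (A i) <= (bet i)%:E)%E &
        forall Q, subcube Q Q0 -> mosc h Q <=
          5 * K * \int[mu]_(x in cube_set Q) layers lam s A x + eps * volume Q].
Proof.
move=> B0 eps0 Lh hB lam0 bet0 Blam bets M0 hM; set M := \sum_(i <- s) _ in M0 hM.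
have K4 := majorant_const_ge4; have K0 : 0 < K by lra.
have [i0 [i0s bi0]] : exists i, i \in s /\ 0 < bet i.
  apply: contrapT => nb; suff : M = 0 by move=> M_eq0; rewrite M_eq0 ltxx in M0.
  rewrite /M big_seq big1// => i si; suff -> : bet i = 0 by rewrite mulr0.
  apply/eqP; rewrite eq_le bet0 andbT leNgt; apply/negP => bi.
  by apply: nb; exists i.
have le_term i : i \in s -> lam i * bet i <= M.
  move=> si; rewrite /M (big_rem i)//= lerDl; apply: sumr_ge0 => j _.
  by rewrite mulr_ge0.
have eps'0 : 0 < eps / (4 * K) by rewrite divr_gt0// mulr_gt0.
have bi02 : 0 < bet i0 / 2 by rewrite divr_gt0.
have [E [r [mE Ee r0 he]]] := small_scale_majorant B0 eps'0 bi02 Lh hB.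
pose e x := 2 * (eps / (4 * K)) + B * \1_E x.
have Le Q : L1 (cube_set Q) e.
  by apply: L1D => //; [exact: L1_cst|apply: L1Z => //; exact: L1_indic].
have e_ge0 x : cube_set Q0 x -> 0 <= e x.
  by move=> _; rewrite addr_ge0// mulr_ge0// ltW.
pose v := truncated h B.
have Lv : L1 (cube_set Q0) v by exact: L1_truncated.
have v_ge0 x : 0 <= v x by exact: truncated_ge0.
have v_le x : v x <= 4 * B by rewrite ge_min lexx orbT.
have hve Q : subcube Q Q0 ->
    mosc h Q <= K * \int[mu]_(x in cube_set Q) (v x + e x).
  exact: (mosc_le_truncated Lh B0 hB (Le Q0) e_ge0 r0 he).
(* From v <= 4 B and B * bet i <= lam i * bet i <= M, the sets to be cut from a cube fit into it. *)
pose kap := (4 * M)^-1.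
have kap0 : 0 <= kap by rewrite invr_ge0 mulr_ge0// ltW.
have kapE : \sum_(i <- s) lam i * (kap * bet i) = 4^-1.
  under eq_bigr do rewrite mulrCA.
  by rewrite -mulr_sumr -/M /kap; field; rewrite gt_eqF.
have fits i p : subcube p Q0 ->
    kap * bet i * \int[mu]_(x in cube_set p) v x <= volume p.
  move=> pQ0; have [si|/bets ->] := boolP (i \in s); last by rewrite mulr0 mul0r.
  have vp : \int[mu]_(x in cube_set p) v x <= 4 * B * volume p.
    rewrite -Rintegral_cube_cst; apply: le_Rintegral => //; last exact: L1_cst.
    exact: L1S Lv.
  have Bb : B * bet i <= M.
    by apply: le_trans (le_term _ si); rewrite ler_wpM2r// Blam.
  rewrite -mulrA /kap ler_pdivrMl ?mulr_gt0//.
  apply: (@le_trans _ _ (bet i * (4 * B * volume p))); first by rewrite ler_wpM2l.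
  rewrite (_ : bet i * _ = 4 * (B * bet i) * volume p); last by ring.
  by rewrite ler_wpM2r// ler_wpM2l.
(* Since del <= eta * side Q, the bound 1/2 keeps the shrunken cube nondegenerate, and the other
   bound makes the cost 8 K B n eta of the strip at most eps / 2. *)
pose eta := Num.min 2^-1 (eps / (16 * K * B * n%:R)).
have n0 : 0 < n%:R :> R by rewrite ltr0n.
have eta0 : 0 < eta by rewrite lt_min invr_gt0 ltr0n/= divr_gt0// !mulr_gt0.
have [d dd] : exists d, side Q0 / 2 ^+ d <= r * eta.
  have re0 : 0 < r * eta by rewrite mulr_gt0.
  have [d0|d0] := leP (side Q0) (r * eta); first by exists 0%N; rewrite expr0 divr1.
  have d20 : 0 < r * eta / 2 by rewrite divr_gt0.
  have [|d [_ dd]] := dyadic_scale d20 (S := side Q0); first by lra.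
  by exists d; lra.
have [A0 [mA0 A0Q muA0 A0P]] := spread_layers n_gt0 Lv (fun x _ => v_ge0 x)
  lam0 bet0 kap0 kapE fits d (@subset_refl _ (cube_set Q0)).
have vM : \int[mu]_(x in cube_set Q0) v x <= M.
  apply: le_trans hM; apply: le_Rintegral => //; first exact: L1_norm.
  by move=> x _; rewrite ge_min lexx.
have muA0' i : (mu (A0 i) <= (bet i / 4)%:E)%E.
  apply: le_trans (muA0 i) _; rewrite lee_fin.
  apply: (@le_trans _ _ (kap * bet i * M)); first by rewrite ler_wpM2l// mulr_ge0.
  by rewrite le_eqVlt /kap; apply/orP; left; apply/eqP; field; rewrite gt_eqF.
(* [A0 i0] uses at most a quarter of the measure [bet i0] and [E] at most half of it, so [E] can
   join a level of height at least B. *)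
pose A i := if i == i0 then A0 i `|` (cube_set Q0 `&` E) else A0 i.
have mQE : measurable (cube_set Q0 `&` E) by exact: measurableI.
have mA i : measurable (A i) by rewrite /A; case: ifP => // _; exact: measurableU.
exists A; split => //.
- move=> i; rewrite /A; case: ifP => // _ x [|[]//]; exact: A0Q.
- move=> i; rewrite /A; case: eqP => [->|_]; last first.
    by apply: le_trans (muA0' i) _; rewrite lee_fin; have := bet0 i; lra.
  apply: le_trans (measureU2 _ (mA0 _) mQE) _.
  apply: (@le_trans _ _ ((bet i0 / 4)%:E + (bet i0 / 2)%:E)%E).
    apply: leeD; first exact: muA0'.
    by apply: le_trans Ee; apply: le_measure; rewrite ?inE.
  by rewrite -EFinD lee_fin; lra.
move=> Q QQ0.
have LA : L1 (cube_set Q) (layers lam s A) by exact: L1_layers.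
have LA0 : L1 (cube_set Q) (layers lam s A0) by exact: L1_layers.
have LE := L1_indic Q mE.
set w := \int[mu]_(x in cube_set Q) layers lam s A x.
have w0 : \int[mu]_(x in cube_set Q) layers lam s A0 x <= w.
  apply: le_Rintegral => // x _; apply: le_layers => // i A0x.
  by rewrite /A; case: ifP => // _; left.
have wE : B * \int[mu]_(x in cube_set Q) \1_E x <= w.
  rewrite -RintegralZl//; apply: le_Rintegral => //; first exact: L1Z.
  move=> x Qx; apply: (@le_trans _ _ (lam i0 * \1_(A i0) x)).
    rewrite [\1_E x]indicE; have [xE|_] := boolP (x \in E); last first.
      by rewrite mulr0 mulr_ge0.
    rewrite indicE mem_set /= ?mulr1 ?Blam// /A eqxx; right.
    by split; [exact: QQ0|exact/set_mem].
  rewrite /layers (big_rem i0)//= lerDl; apply: sumr_ge0 => j _.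
  by rewrite mulr_ge0.
have w_ge0 : 0 <= w by apply: Rintegral_ge0 => x _; exact: layers_ge0.
have eE : \int[mu]_(x in cube_set Q) e x =
    2 * (eps / (4 * K)) * volume Q + B * \int[mu]_(x in cube_set Q) \1_E x.
  rewrite RintegralD//; [|exact: L1_cst|exact: L1Z].
  by rewrite Rintegral_cube_cst RintegralZl.
have Ke : K * (2 * (eps / (4 * K)) * volume Q) = eps / 2 * volume Q.
  by field; rewrite gt_eqF.
have [sQ|sQ] := leP (side Q) r.
  apply: le_trans (he Q QQ0 sQ) _; rewrite -[X in X <= _]/(\int[mu]_(x in cube_set Q) e x) eE.
  have : 2 * (eps / (4 * K)) * volume Q <= eps / 2 * volume Q.
    rewrite -Ke ler_peMl//; last by lra.
    by apply: mulr_ge0 => //; apply: mulr_ge0 => //; exact: ltW.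
  have : 0 <= eps * volume Q by rewrite mulr_ge0// ltW.
  by have : w <= 5 * K * w; [rewrite ler_peMl//; lra|lra].
have LvQ : L1 (cube_set Q) v by exact: L1S Lv.
have veE : \int[mu]_(x in cube_set Q) (v x + e x) =
    \int[mu]_(x in cube_set Q) v x + \int[mu]_(x in cube_set Q) e x.
  by apply: RintegralD => //; exact: Le.
apply: le_trans (hve Q QQ0) _; rewrite veE eE.
(* Q shrunk by the side of a generation-d cube: whatever is within that distance of [S] is still in
   Q. *)
pose del := side Q0 / 2 ^+ d; pose S := thicken Q (- del).
have del0 : 0 < del by rewrite divr_gt0 ?side_gt0// exprn_gt0.
have mS : measurable S by exact: measurable_thicken.
have SQ : S `<=` cube_set Q by move=> x Sx i; have := Sx i; lra.
have eta12 : eta <= 2^-1 by rewrite ge_min lexx.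
have dels : del <= side Q * eta.
  by apply: le_trans dd _; rewrite ler_wpM2r ?(ltW eta0)// ltW.
have vS : 4^-1 * \int[mu]_(x in S) v x <= w.
  apply: le_trans w0.
  have := A0P S (cube_set Q) mS (measurable_cube Q).
  rewrite !Rintegral_indicM (setIidr QQ0) (setIidr (subset_trans SQ QQ0)); apply.
  move=> x y _ Sx _ xy i; have := Sx i; have := xy i; rewrite -/del; lra.
have s0 := side_gt0 Q.
have muS : fine (mu S) = (side Q - 2 * del) ^+ n.
  by rewrite mu_thicken; [rewrite mulrN|nra].
have vQ : \int[mu]_(x in cube_set Q) v x <=
    \int[mu]_(x in S) v x + 4 * B * (volume Q - fine (mu S)).
  have -> : \int[mu]_(x in S) v x = \int[mu]_(x in cube_set Q) (v x * \1_S x).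
    by rewrite Rintegral_indicM (setIidr SQ).
  have -> : 4 * B * (volume Q - fine (mu S)) =
      \int[mu]_(x in cube_set Q) (4 * B * (1 - \1_S x)).
    have LS := L1_indic Q mS.
    rewrite RintegralZl//; last by apply: L1B => //; exact: L1_cst.
    rewrite RintegralB//; last exact: L1_cst.
    by rewrite Rintegral_cube_cst mul1r Rintegral_indic// (setIidr SQ).
  have LvS : L1 (cube_set Q) (fun x => v x * \1_S x) by exact: L1_indicM.
  have L4 : L1 (cube_set Q) (fun x => 4 * B * (1 - \1_S x)).
    apply: L1Z => //; apply: L1B => //; first exact: L1_cst.
    exact: L1_indic.
  rewrite -RintegralD//; apply: le_Rintegral => //; first exact: L1D.
  move=> x _; rewrite indicE; case: (x \in S) => /=.
    by rewrite mulr1 subrr mulr0 addr0.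
  by rewrite mulr0 subr0 mulr1 add0r.
have volS : K * (4 * B * (volume Q - fine (mu S))) <= eps / 2 * volume Q.
  rewrite muS volumeE.
  have := @bernoulli_sub (2 * del) (side Q) s0; have -> : 0 <= 2 * del <= side Q by nra.
  move=> /(_ isT) ber.
  have : n%:R * (2 * del) / side Q <= 2 * n%:R * eta.
    rewrite ler_pdivrMr//; nra.
  have : 16 * K * B * n%:R * eta <= eps.
    rewrite mulrC -ler_pdivlMr ?mulr_gt0//; by rewrite ge_min lexx orbT.
  have sn : 0 <= side Q ^+ n by rewrite exprn_ge0// ltW.
  move=> h1 h2.
  have ber' : side Q ^+ n - (side Q - 2 * del) ^+ n <= 2 * n%:R * eta * side Q ^+ n.
    by apply: le_trans ber _; rewrite ler_wpM2r.
  apply: (@le_trans _ _ (K * (4 * B * (2 * n%:R * eta * side Q ^+ n)))).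
    by rewrite ler_wpM2l ?(ltW K0)// ler_wpM2l// mulr_ge0// ltW.
  rewrite (_ : K * _ = 16 * K * B * n%:R * eta / 2 * side Q ^+ n); last by field.
  by rewrite ler_wpM2r// ler_wpM2r.
have : K * \int[mu]_(x in cube_set Q) v x <= K * (4 * w) + eps / 2 * volume Q.
  apply: le_trans (_ : K * (\int[mu]_(x in S) v x +
    4 * B * (volume Q - fine (mu S))) <= _); first by rewrite ler_wpM2l// ltW.
  by rewrite mulrDr lerD// ler_wpM2l ?(ltW K0)//; lra.
have : K * (B * \int[mu]_(x in cube_set Q) \1_E x) <= K * w.
  by rewrite ler_wpM2l// ltW.
move=> h1 h2; move: Ke h1 h2.
set a := 2 * (eps / (4 * K)) * volume Q; set b := B * _; set c := \int[mu]_(x in _) v x.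
by move=> h1 h2 h3; rewrite (_ : K * (c + (a + b)) = K * c + K * a + K * b); [lra|ring].
Qed.

End layered_majorant.

(** * Rearrangements *)

Section step_functions.
Context (R : realType) (n : nat).
Local Notation mu := (lebesgue_Rn R n).
Variables (Q0 : cube R n) (lam : nat -> R).
Hypothesis lam_gt0 : forall i, 0 < lam i.
Implicit Types (P : nat -> set (Rn R n)) (x : Rn R n).

(** The value is [lam i] on [P i]. The chosen index is determined only when the sets are disjoint,
    as they are in every use. *)
Definition step_fun P x : R :=
  if pselect (exists i, P i x) is left ex then lam (projT1 (cid ex)) else 0.

Lemma step_funE P i x : trivIset setT P -> P i x -> step_fun P x = lam i.
Proof.
move=> tP Px; rewrite /step_fun; case: pselect => [ex|]; last by case; exists i.
case: cid => j Pj /=; congr lam; apply: (tP j i) => //.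
by exists x.
Qed.

Lemma step_fun_out P x : (forall i, ~ P i x) -> step_fun P x = 0.
Proof.
move=> nP; rewrite /step_fun; case: pselect => // ex; exfalso.
by case: ex => i /nP.
Qed.

Lemma step_fun_ge0 P x : 0 <= step_fun P x.
Proof. by rewrite /step_fun; case: pselect => // ex; rewrite ltW. Qed.

Lemma superlevel_step_fun P (t : R) : trivIset setT P -> 0 <= t ->
  [set x | t < step_fun P x] = \bigcup_(i in [set i | t < lam i]) P i.
Proof.
move=> tP t0; apply/seteqP; split => x /=.
  have [[i Pi]|nP] := pselect (exists i, P i x).
    by rewrite (step_funE tP Pi) => ti; exists i.
  by rewrite step_fun_out; [rewrite ltNge t0|move=> i Pi; apply: nP; exists i].
by move=> [i ti Pi]; rewrite (step_funE tP Pi).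
Qed.

Lemma measurable_step_fun P D : trivIset setT P -> (forall i, measurable (P i)) ->
  measurable_fun D (step_fun P).
Proof.
move=> tP mP; apply: measurable_funTS.
apply: (measurability _ (RGenOInfty.measurableE R)).
move=> _ [_ [t ->] <-]; rewrite setTI.
rewrite (_ : _ @^-1` _ = [set x | t < step_fun P x]); last first.
  by apply/seteqP; split => x /=; rewrite in_itv/= andbT.
have [t0|t0] := ltP t 0.
  rewrite (_ : [set x | _] = setT)//; apply/seteqP; split => // x _ /=.
  exact: lt_le_trans t0 (step_fun_ge0 _ _).
by rewrite superlevel_step_fun//; exact: bigcup_measurable.
Qed.

(** Superlevel sets are disjoint unions of pieces, so their measures depend only on those of the
    pieces. *)
Lemma step_fun_equimeasurable P P' : trivIset setT P -> trivIset setT P' ->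
  (forall i, measurable (P i)) -> (forall i, measurable (P' i)) ->
  (forall i, P i `<=` cube_set Q0) -> (forall i, P' i `<=` cube_set Q0) ->
  (forall i, mu (P i) = mu (P' i)) -> forall t,
  decreasing_rearrangement Q0 (step_fun P) t =
  decreasing_rearrangement Q0 (step_fun P') t.
Proof.
move=> tP tP' mP mP' PQ PQ' PP' t.
have mu_level S (s : R) : trivIset setT S -> (forall i, measurable (S i)) ->
    (forall i, S i `<=` cube_set Q0) -> 0 <= s ->
    mu (cube_set Q0 `&` [set x | s < `|step_fun S x|]) =
    (\sum_(i <oo | i \in [set i | (s < lam i)%R]) mu (S i))%E.
  move=> tS mS SQ s0.
  under eq_set do rewrite ger0_norm ?step_fun_ge0//.
  rewrite superlevel_step_fun// setIidr; last by move=> x [i _]; exact: SQ.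
  rewrite measure_bigcup//; exact: sub_trivIset tS.
have E (s : R) : 0 <= s -> mu (cube_set Q0 `&` [set x | s < `|step_fun P x|]) =
    mu (cube_set Q0 `&` [set x | s < `|step_fun P' x|]).
  by move=> s0; rewrite !mu_level//; apply: eq_eseriesr => i _.
congr (ereal_inf (image _ _)); apply/seteqP; split => s /= [s0 le].
  by split => //; rewrite -E.
by split => //; rewrite E.
Qed.

End step_functions.

Section rearranged_layers.
Context (R : realType) (n : nat) (n_gt0 : (0 < n)%N).
Local Notation mu := (lebesgue_Rn R n).
Variables (Q0 : cube R n) (N : (Rn R n -> R) -> \bar R).
Hypothesis N_ri : is_ri_space Q0 N.
Implicit Types (x : Rn R n) (A : nat -> set (Rn R n)).

Definition dyadic_level (l0 : R) (i : nat) : R := l0 * 2 ^+ i.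

Definition dyadic_layer (g : Rn R n -> R) (l0 : R) (i : nat) : set (Rn R n) :=
  cube_set Q0 `&` [set x | dyadic_level l0 i < g x <= dyadic_level l0 i.+1].

Lemma dyadic_levelS l0 i : dyadic_level l0 i.+1 = 2 * dyadic_level l0 i.
Proof. by rewrite /dyadic_level exprS mulrCA. Qed.

Lemma dyadic_level_gt0 l0 i : 0 < l0 -> 0 < dyadic_level l0 i.
Proof. by move=> l00; rewrite mulr_gt0// exprn_gt0. Qed.

Lemma le_dyadic_level l0 i j : 0 < l0 -> (i <= j)%N ->
  dyadic_level l0 i <= dyadic_level l0 j.
Proof. by move=> l00 ij; rewrite ler_wpM2l ?(ltW l00)// ler_weXn2l// ler1n. Qed.

Lemma measurable_dyadic_layer g l0 i : measurable_fun (cube_set Q0) g ->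
  measurable (dyadic_layer g l0 i).
Proof.
move=> mg; rewrite /dyadic_layer.
rewrite (_ : [set x | _] =
  g @^-1` `]dyadic_level l0 i, dyadic_level l0 i.+1]%classic); first exact: mg.
by apply/seteqP; split => x /=; rewrite in_itv.
Qed.

Lemma trivIset_dyadic_layer g l0 : 0 < l0 -> trivIset setT (dyadic_layer g l0).
Proof.
move=> l00; apply/trivIsetP => i j _ _ ij.
wlog lt_ij : i j ij / (i < j)%N.
  move=> W; have [lt|lt|eq] := ltngtP i j; first exact: W.
    by rewrite setIC; apply: W => //; rewrite eq_sym.
  by rewrite eq eqxx in ij.
apply/seteqP; split => // x [[_ /andP[_ gi]] [_ /andP[gj _]]].
have := le_lt_trans (le_dyadic_level l00 lt_ij) gj.
by rewrite ltNge gi.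
Qed.

Definition top_layer A i : set (Rn R n) := A i `\` \bigcup_(l in [set l | (i < l)%N]) A l.

Lemma trivIset_top_layer A : trivIset setT (top_layer A).
Proof.
apply/trivIsetP => i j _ _ ij.
wlog lt_ij : i j ij / (i < j)%N.
  move=> W; have [lt|lt|eq] := ltngtP i j; first exact: W.
    by rewrite setIC; apply: W => //; rewrite eq_sym.
  by rewrite eq eqxx in ij.
apply/seteqP; split => // x [[_ nx] [Aj _]]; apply: nx; by exists j.
Qed.

(** [u] takes the highest level present at each point. Inside each layer of [g] a subset with the
    measure of the corresponding top layer is cut out; the step function on these subsets lies below
    [g] and is equimeasurable with [u]. Only the ideal property and rearrangement invariance of the
    norm enter. *)
Lemma rearranged_layers (g : Rn R n -> R) (l0 : R) A : 0 < l0 ->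
  in_space Q0 N g -> (forall x, cube_set Q0 x -> 0 <= g x) ->
  (forall i, measurable (A i)) -> (forall i, A i `<=` cube_set Q0) ->
  (forall i, (mu (A i) <= mu (dyadic_layer g l0 i))%E) ->
  exists u, [/\ in_space Q0 N u, (N u <= N g)%E, forall x, 0 <= u x &
    {ae mu, forall x, forall m,
       layers (dyadic_level l0) (iota 0 m) A x <= 2 * u x}].
Proof.
move=> l00 Ng g0 mA AQ muA; have [bfs _ ri] := N_ri; have mg := Ng.1.
have lam_gt0 i : 0 < dyadic_level l0 i by exact: dyadic_level_gt0.
have mB i : measurable (dyadic_layer g l0 i) by exact: measurable_dyadic_layer.
have BQ i : dyadic_layer g l0 i `<=` cube_set Q0 by move=> x [].
have tB := @trivIset_dyadic_layer g _ l00.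
have mtA i : measurable (top_layer A i).
  by apply: measurableD => //; exact: bigcup_measurable.
have tAA i : top_layer A i `<=` A i by move=> x [].
have tAQ i : top_layer A i `<=` cube_set Q0 by move=> x /tAA/AQ.
have /choice[B' B'P] : forall i, exists E : set (Rn R n),
    [/\ measurable E, E `<=` dyadic_layer g l0 i & mu E = mu (top_layer A i)].
  move=> i; have fin : mu (top_layer A i) \is a fin_num.
    exact: (@fin_num_mu_subcube _ _ Q0).
  have [||E [mE EB muE]] := @subset_of_measure _ _ n_gt0 Q0 _
      (fine (mu (top_layer A i))) (mB i) (@BQ i).
  - exact: fine_ge0.
  - rewrite fineK//; apply: le_trans (muA i); apply: le_measure; rewrite ?inE//.
  - by exists E; split => //; rewrite muE fineK.
have mB' i : measurable (B' i) by case: (B'P i).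
have B'B i : B' i `<=` dyadic_layer g l0 i by case: (B'P i).
have tB' : trivIset setT B'.
  move=> i j _ _ [x [/B'B Bi /B'B Bj]]; apply: tB => //; by exists x.
have ttA := @trivIset_top_layer A.
pose g' := step_fun (dyadic_level l0) B'.
pose u := step_fun (dyadic_level l0) (top_layer A).
have mg' : measurable_fun (cube_set Q0) g' by exact: measurable_step_fun.
have g'g : (N g' <= N g)%E.
  apply: (bfs_ideal bfs) => //; apply: aeW => x Qx.
  rewrite ger0_norm ?step_fun_ge0// (ger0_norm (g0 x Qx)).
  have [[i Bi]|nB] := pselect (exists i, B' i x).
    by rewrite /g' (step_funE _ tB' Bi); have [_ /andP[/ltW]] := B'B _ _ Bi.
  rewrite /g' step_fun_out ?g0// => i Bi; by apply: nB; exists i.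
have Ng' : in_space Q0 N g' by split => //; exact: le_lt_trans g'g Ng.2.
have mu_ : measurable_fun (cube_set Q0) u by exact: measurable_step_fun.
have [|Nu uE] := ri u g' mu_ Ng'.
  move=> t _; apply: step_fun_equimeasurable => //.
    by move=> i x /B'B; exact: BQ.
  by move=> i; case: (B'P i).
exists u; split => //; first by rewrite uE.
  by move=> x; exact: step_fun_ge0.
(* Borel-Cantelli: the measures are summable because the layers of [g] are disjoint subsets of [Q0].
   At a point lying in infinitely many sets there is no highest level. *)
have limA : mu (lim_sup_set A) = 0%E.
  apply: lim_sup_set_cvg0 => //.
  apply: (@le_lt_trans _ _ (\sum_(i <oo) mu (dyadic_layer g l0 i))%E).
    by apply: lee_nneseries => [i _ _|i _]; [exact: measure_ge0|exact: muA].
  apply: le_lt_trans (mu_cube_fin Q0).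
  have := @measure_bigcup _ _ _ mu setT (dyadic_layer g l0) (fun i _ => mB i) tB.
  under eq_eseriesl do rewrite in_setT.
  move=> <-; apply: le_measure; rewrite ?inE//; first exact: bigcup_measurable.
  by move=> x [i _]; exact: BQ.
exists (lim_sup_set A); split => //.
  by apply: bigcap_measurable => // k _; exact: bigcup_measurable.
move=> x /= nx; apply: contrapT => nlim; apply: nx => m.
rewrite /layers -[m]subn0 -/(index_iota 0 m) big_mkord.
have [[i [Ai imax]]|nmax] :=
    pselect (exists i, A i x /\ forall j, A j x -> (j <= i)%N).
  have -> : u x = dyadic_level l0 i.
    apply: step_funE => //; split => // -[j /= ij /imax].
    by rewrite leqNgt ij.
  rewrite -dyadic_levelS.
  (* Geometric sum: all levels up to i add up to at most level i + 1, twice the value of [u]. The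
     minimum makes the induction on m go through on both sides of i. *)
  apply: (@le_trans _ _ (dyadic_level l0 (minn m i.+1))); last first.
    by apply: le_dyadic_level => //; exact: geq_minr.
  elim: m => [|m IH]; first by rewrite big_ord0 ltW.
  rewrite big_ord_recr/=; have [mi|im] := leqP m i.
    rewrite (minn_idPl (leqW mi)) in IH.
    have ind1 : \1_(A m) x <= 1 :> R by rewrite indicE; case: (_ \in _).
    have lm : dyadic_level l0 m * \1_(A m) x <= dyadic_level l0 m.
      by rewrite ler_piMr// ltW.
    by rewrite (minn_idPl _)// dyadic_levelS mulr2n mulrDl mul1r lerD.
  rewrite indicE memNset ?mulr0 ?addr0; last first.
    by move=> /imax; rewrite leqNgt im.
  by rewrite (minn_idPr (leqW im)); rewrite (minn_idPr im) in IH.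
have nA j : ~ A j x.
  move=> Aj; apply: nlim => k _; apply: contrapT => nk; apply: nmax.
  have bnd i : A i x -> (i <= k)%N.
    by move=> Ai; rewrite leqNgt; apply/negP => ki; apply: nk; exists i => //=; exact: ltnW.
  have ex : exists i, `[< A i x >] by exists j; exact/asboolP.
  case: (ex_maxnP ex (m := k)); first by move=> i /asboolP/bnd.
  by move=> i /asboolP Ai imax; exists i; split => // l Al; apply: imax; exact/asboolP.
rewrite big1 => [|j _]; first by rewrite mulr_ge0//; exact: step_fun_ge0.
by rewrite indicE memNset ?mulr0.
Qed.

End rearranged_layers.

(** * Boundedness on the Garsia-Rodemich space *)

Section oscillation_interface.
Context (R : realType) (n : nat).
Local Notation mu := (lebesgue_Rn R n).
Local Notation L1 := (L1 mu).
Variable Q0 : cube R n.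
Implicit Types (Q : cube R n) (f g h : Rn R n -> R).

Lemma eseries_set1 (F : nat -> \bar R) (i : nat) :
  (\sum_(j <oo | j \in [set i]) F j)%E = F i.
Proof.
apply: cvg_lim => //; apply: cvg_near_cst; exists i.+1 => // m /= im.
rewrite big_mkcond/= (bigD1_seq i)//= ?mem_index_iota ?iota_uniq//.
rewrite mem_set//= big1 ?adde0// => j ji; rewrite memNset// => jE.
by rewrite jE eqxx in ji.
Qed.

(** The packing is the single cube Q. A member of the class may take negative values; its modulus is
    a nonnegative majorant. *)
Lemma Gamma_class_mosc f g Q : L1 (cube_set Q0) f -> Gamma_class Q0 f g ->
  subcube Q Q0 -> mosc f Q <= \int[mu]_(x in cube_set Q) `|g x|.
Proof.
move=> Lf [Lg fg] QQ0.
have LfQ : L1 (cube_set Q) f by exact: L1S Lf.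
have LgQ : L1 (cube_set Q) g by exact: L1S Lg.
have /fg : packing Q0 [set 0%N] (fun=> Q).
  split; first by move=> _ _.
  by move=> i j /= -> ->.
rewrite !eseries_set1 => h; rewrite -lee_fin.
apply: le_trans (mosc_le_double LfQ) _; apply: le_trans h _.
rewrite L1_EFin// lee_fin; apply: le_Rintegral => //; first exact: L1_norm.
by move=> x _; exact: ler_norm.
Qed.

Lemma mosc_Gamma_class f g : L1 (cube_set Q0) f -> L1 (cube_set Q0) g ->
  (forall Q, subcube Q Q0 -> 2 * mosc f Q <= \int[mu]_(x in cube_set Q) g x) ->
  Gamma_class Q0 f g.
Proof.
move=> Lf Lg fg; split => // D Q [DQ _]; apply: lee_nneseries => [i _ _|i].
  rewrite mule_ge0 ?lee_fin ?invr_ge0//; apply: integral_ge0 => x _.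
  exact: integral_ge0.
move=> /set_mem/DQ QQ0; have LfQ : L1 (cube_set (Q i)) f by exact: L1S Lf.
apply: le_trans (double_le (average f (Q i)) LfQ) _.
rewrite L1_EFin ?lee_fin//; first exact: fg.
exact: L1S Lg.
Qed.

Lemma BMO_norm_le f (C : R) : L1 (cube_set Q0) f ->
  (BMO_norm Q0 f <= C%:E)%E <->
  (forall Q, subcube Q Q0 -> mosc f Q <= C * volume Q).
Proof.
move=> Lf.
have E Q : subcube Q Q0 -> ((volume Q)^-1%:E *
    \int[mu]_(x in cube_set Q) `|f x - average f Q|%:E)%E =
    ((volume Q)^-1 * mosc f Q)%:E.
  move=> QQ0; rewrite L1_EFin//; apply: L1_norm_sub; exact: L1S Lf.
split=> [fC Q QQ0|fC].
  rewrite mulrC -ler_pdivrMl// -lee_fin -E//; apply: le_trans fC.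
  by apply: ereal_sup_ubound; exists Q.
apply: ge_ereal_sup => _ [Q QQ0 <-]; rewrite E// lee_fin ler_pdivrMl// mulrC.
exact: fC.
Qed.

Lemma L1_quotient_norm_le f : L1 (cube_set Q0) f ->
  (L1_quotient_norm Q0 f <= (\int[mu]_(x in cube_set Q0) `|f x|)%:E)%E.
Proof.
move=> Lf; rewrite -L1_EFin//; last exact: L1_norm.
apply: ereal_inf_lbound; exists 0 => //.
by apply: eq_integral => x _; rewrite subr0.
Qed.

Lemma L1_quotient_norm_lt f (a : R) : L1 (cube_set Q0) f ->
  (L1_quotient_norm Q0 f < a%:E)%E ->
  exists c : R, \int[mu]_(x in cube_set Q0) `|f x - c| <= a.
Proof.
move=> Lf /ereal_inf_lt[_ [c _ <-]]; rewrite L1_EFin//; last exact: L1_norm_sub.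
by rewrite lte_fin => /ltW; exists c.
Qed.

Lemma mosc_le_L1_quotient f (a : R) Q : L1 (cube_set Q0) f -> subcube Q Q0 ->
  (L1_quotient_norm Q0 f <= a%:E)%E -> mosc f Q <= 2 * a.
Proof.
move=> Lf QQ0 fa; apply/ler_addgt0Pr => e e0.
have [|c fc] := @L1_quotient_norm_lt f (a + e / 2) Lf.
  by apply: le_lt_trans fa _; rewrite lte_fin ltrDl divr_gt0.
apply: le_trans (mosc_le c _) _; first exact: L1S Lf.
have : \int[mu]_(x in cube_set Q) `|f x - c| <=
    \int[mu]_(x in cube_set Q0) `|f x - c|.
  by apply: le_Rintegral_subset => //; exact: L1_norm_sub.
by lra.
Qed.

End oscillation_interface.

(** * Selection of levels and bookkeeping of the layers *)

Section level_selection.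
Context (R : realType) (J : nat -> R).
Hypothesis J_ge0 : forall k, 0 <= J k.
Hypothesis J_ni : forall k, J k.+1 <= J k.
Hypothesis J_small : forall eps, 0 < eps -> exists k0, forall k,
  (k0 <= k)%N -> J k <= eps.

Lemma halving_levels : exists k : nat -> nat, k 0 = 0%N /\
  forall j, [/\ (k j < k j.+1)%N, 2 * J (k j.+1) <= J (k j) &
                J (k j) <= 2 * J (k j.+1).-1].
Proof.
have /choice[nxt nxtP] : forall k, exists k', [/\ (k < k')%N, 2 * J k' <= J k &
    J k <= 2 * J k'.-1].
  move=> k; have ex : exists k', (k < k')%N && (2 * J k' <= J k).
    (* Once the tail vanishes every later index qualifies, so the sequence never ends. *)
    have [Jk|Jk] := leP (J k) 0.
      have Jk0 : J k = 0 by apply/eqP; rewrite eq_le Jk J_ge0.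
      by exists k.+1; rewrite ltnSn Jk0; have := J_ni k; rewrite Jk0; lra.
    have /J_small[k0 k0P] : 0 < J k / 2 by rewrite divr_gt0.
    exists (maxn k.+1 k0); rewrite leq_maxl/=.
    by have := k0P _ (leq_maxr k.+1 k0); lra.
  case: (ex_minnP ex) => k' /andP[kk' Jk'] kmin; exists k'; split => //.
  have [Jk|Jk] := leP (J k) (2 * J k'.-1) => //.
  have [kE|lt] : k'.-1 = k \/ (k < k'.-1)%N by lia.
    by move: Jk; rewrite kE; have := J_ge0 k; lra.
  by have := kmin k'.-1; rewrite lt ltW//= => /(_ isT); lia.
by exists (fun j => iter j nxt 0%N); split => // j; exact: nxtP.
Qed.

End level_selection.

Section level_ranges.
Variable k : nat -> nat.
Hypothesis k_incr : forall j, (k j < k j.+1)%N.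

(** The layers to which the j-th piece is charged. Consecutive ranges share exactly the index
    [(k j.+2).-1], and no three ranges meet. *)
Definition level_range (j i : nat) : bool := ((k j.+1).-1 <= i < k j.+2)%N.

Lemma level_ge j : (j <= k j)%N.
Proof. by elim: j => // j IH; have := k_incr j; lia. Qed.

Lemma level_range_bound j i : level_range j i -> (j < i.+2)%N.
Proof. by have := level_ge j.+1; rewrite /level_range; lia. Qed.

Lemma le_levels i j : (i <= j)%N -> (k i <= k j)%N.
Proof.
move=> /subnK <-; elim: (j - i)%N => // m IH; rewrite addSn.
by apply: leq_trans IH (ltnW (k_incr _)).
Qed.

Lemma level_range_count i m : (\sum_(j < m) level_range j i <= 2)%N.
Proof.
(* The two extra terms reserve the occurrences of i still possible in later ranges. *)
suff : (\sum_(j < m) level_range j i + (k m.+1 <= i) + (k m.+1 <= i.+1) <= 2)%N.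
  by lia.
elim: m => [|m IH]; first by rewrite big_ord0; case: (k 1 <= i)%N; case: (k 1 <= i.+1)%N.
rewrite big_ord_recr/=; apply: leq_trans IH.
have := k_incr m.+1; have := k_incr m; rewrite /level_range.
case: (leqP (k m.+2) i) => h1; case: (leqP (k m.+2) i.+1) => h2;
  case: (leqP (k m.+1) i) => h3; case: (leqP (k m.+1) i.+1) => h4;
  case: (leqP (k m.+1).-1 i) => h5 //=; lia.
Qed.

End level_ranges.

(** * Action of the operator on the pieces *)

Section bounded_operator.
Context (R : realType) (n : nat) (n_gt0 : (0 < n)%N).
Local Notation mu := (lebesgue_Rn R n).
Local Notation L1 := (L1 mu).
Variables (Q0 : cube R n) (T : (Rn R n -> R) -> (Rn R n -> R)) (C1 C2 : R).
Implicit Types (Q : cube R n) (f g : Rn R n -> R).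
Hypothesis T_L1 : forall f, L1 (cube_set Q0) f -> L1 (cube_set Q0) (T f).
Hypothesis T_lin : forall (a : R) f g, L1 (cube_set Q0) f -> L1 (cube_set Q0) g ->
  exists c : R, {ae mu, forall x, cube_set Q0 x ->
    T (fun y => a * f y + g y) x = a * T f x + T g x + c}.
Hypothesis C1_gt0 : 0 < C1.
Hypothesis T_quotient : forall f, L1 (cube_set Q0) f ->
  (L1_quotient_norm Q0 (T f) <= C1%:E * L1_quotient_norm Q0 f)%E.
Hypothesis C2_gt0 : 0 < C2.
Hypothesis T_BMO : forall f, in_BMO Q0 f ->
  (BMO_norm Q0 (T f) <= C2%:E * BMO_norm Q0 f)%E.

(** [T] is additive up to a constant and a null set, and [mosc] sees neither. *)
Lemma mosc_T_add f g Q : L1 (cube_set Q0) f -> L1 (cube_set Q0) g ->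
  subcube Q Q0 ->
  mosc (T (fun x => f x + g x)) Q <= mosc (T f) Q + mosc (T g) Q.
Proof.
move=> Lf Lg QQ0; have [c Tc] := T_lin 1 Lf Lg.
rewrite (_ : (fun y => 1 * f y + g y) = (fun x => f x + g x)) in Tc; last first.
  by apply/funext => x; rewrite mul1r.
have LTf : L1 (cube_set Q) (T f) by apply: L1S (T_L1 Lf).
have LTg : L1 (cube_set Q) (T g) by apply: L1S (T_L1 Lg).
have LTfg : L1 (cube_set Q) (fun x => T f x + T g x) by exact: L1D.
have LT : L1 (cube_set Q) (T (fun x => f x + g x)).
  by apply: (L1S _ _ QQ0) => //; apply: T_L1; exact: L1D.
rewrite (@mosc_ae _ _ _ (fun x => T f x + T g x + c) Q LT).
- by rewrite mosc_addc//; exact: moscD.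
- by apply: L1D => //; exact: L1_cst.
- by apply: filterS Tc => x Tx /QQ0/Tx ->; rewrite mul1r.
Qed.

Lemma T_quotient_le f (a : R) : L1 (cube_set Q0) f ->
  \int[mu]_(x in cube_set Q0) `|f x| <= a ->
  (L1_quotient_norm Q0 (T f) <= (C1 * a)%:E)%E.
Proof.
move=> Lf fa; apply: le_trans (T_quotient Lf) _.
rewrite EFinM lee_pmul2l//; apply: le_trans (L1_quotient_norm_le Lf) _.
by rewrite lee_fin.
Qed.

Lemma mosc_T_L1 f (a : R) Q : L1 (cube_set Q0) f -> subcube Q Q0 ->
  \int[mu]_(x in cube_set Q0) `|f x| <= a -> mosc (T f) Q <= 2 * (C1 * a).
Proof.
move=> Lf QQ0 fa; apply: mosc_le_L1_quotient QQ0 _; first exact: T_L1.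
exact: T_quotient_le.
Qed.

Lemma mosc_T_BMO f (B : R) : L1 (cube_set Q0) f ->
  (forall Q, subcube Q Q0 -> mosc f Q <= B * volume Q) ->
  forall Q, subcube Q Q0 -> mosc (T f) Q <= C2 * B * volume Q.
Proof.
move=> Lf /(BMO_norm_le _ Lf) fB; apply/(BMO_norm_le _ (T_L1 Lf)).
have fBMO : in_BMO Q0 f by split => //; apply: le_lt_trans fB _; rewrite ltry.
by apply: le_trans (T_BMO fBMO) _; rewrite EFinM lee_pmul2l.
Qed.

Lemma layered_majorant_T f (a B B0 D eps : R) (s : seq nat) (lam bet : nat -> R) :
  L1 (cube_set Q0) f -> 0 < D -> 0 < eps -> 0 < B0 ->
  \int[mu]_(x in cube_set Q0) `|f x| <= a ->
  (forall Q, subcube Q Q0 -> mosc f Q <= B * volume Q) ->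
  (forall i, 0 <= lam i) -> (forall i, 0 <= bet i) ->
  (forall i, i \in s -> B0 <= lam i) -> (forall i, i \notin s -> bet i = 0) ->
  C2 * B <= D * B0 -> (C1 + 1) * a <= D * \sum_(i <- s) lam i * bet i ->
  exists A : nat -> set (Rn R n),
    [/\ forall i, measurable (A i), forall i, A i `<=` cube_set Q0,
        forall i, (mu (A i) <= (bet i)%:E)%E &
        forall Q, subcube Q Q0 -> mosc (T f) Q <=
          D * (5 * majorant_const R n) *
            \int[mu]_(x in cube_set Q) layers lam s A x + eps * volume Q].
Proof.
move=> Lf D0 eps0 B00 fa fB lam0 bet0 B0lam bets CB Ca; have LTf := T_L1 Lf.
have K4 := majorant_const_ge4 R n.
(* Here the sum of lam i * bet i may vanish, which [layered_majorant] excludes; but [T f] then has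
   no oscillation and empty sets suffice. *)
have [a0|a0] := leP a 0.
  exists (fun=> set0); split.
  - by move=> i; exact: measurable0.
  - by move=> i; exact: sub0set.
  - by move=> i; rewrite measure0 lee_fin.
  move=> Q QQ0; apply: (@le_trans _ _ 0).
    by apply: le_trans (mosc_T_L1 Lf QQ0 fa) _; rewrite pmulr_rle0// pmulr_rle0.
  rewrite addr_ge0//; last by rewrite mulr_ge0// ltW.
  rewrite mulr_ge0 ?mulr_ge0 ?(ltW D0)//; first by lra.
  by apply: Rintegral_ge0 => x _; exact: layers_ge0.
(* C1 + 1 leaves room for an actual constant [c], the infimum over constants being only
   approached. *)
have [|c Tc] := @L1_quotient_norm_lt _ _ Q0 (T f) ((C1 + 1) * a) LTf.
  by apply: le_lt_trans (T_quotient_le Lf fa) _; rewrite lte_fin; lra.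
have LTc : L1 (cube_set Q0) (fun x => T f x + - c).
  by apply: L1D => //; exact: L1_cst.
pose h x := D^-1 * (T f x + - c).
have Lh : L1 (cube_set Q0) h by exact: L1Z.
have hT Q : subcube Q Q0 -> mosc (T f) Q = D * mosc h Q.
  move=> QQ0; have LTfQ : L1 (cube_set Q) (T f) by exact: L1S LTf.
  rewrite moscZ; last by apply: L1D => //; exact: L1_cst.
  rewrite mosc_addc// ger0_norm ?invr_ge0 ?(ltW D0)//.
  by rewrite mulrA mulfV ?mul1r// gt_eqF.
have [|||A [mA AQ muA hA]] := @layered_majorant _ _ n_gt0 Q0 h B0 (eps / D) s lam bet
    B00 (divr_gt0 eps0 D0) Lh _ lam0 bet0 B0lam bets.
- move=> Q QQ0; rewrite -(ler_pM2l D0) -hT//.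
  apply: le_trans (mosc_T_BMO Lf fB QQ0) _.
  by rewrite mulrA ler_wpM2r.
- by rewrite -(pmulr_rgt0 _ D0); apply: lt_le_trans Ca; rewrite mulr_gt0// ltr_wpDr.
- have -> : \int[mu]_(x in cube_set Q0) `|h x| =
      D^-1 * \int[mu]_(x in cube_set Q0) `|T f x - c|.
    rewrite -RintegralZl//; last exact: L1_norm_sub.
    by apply: eq_Rintegral => x _; rewrite normrM ger0_norm// invr_ge0 ltW.
  by rewrite ler_pdivrMl//; exact: le_trans Tc Ca.
exists A; split => // Q QQ0; rewrite hT//.
apply: le_trans (_ : D * (5 * majorant_const R n *
  \int[mu]_(x in cube_set Q) layers lam s A x + eps / D * volume Q) <= _).
  by rewrite ler_pM2l//; exact: hA.
by rewrite le_eqVlt; apply/orP; left; apply/eqP; field; rewrite gt_eqF.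
Qed.

End bounded_operator.

Section layer_mass.
Context (R : realType) (n : nat).
Local Notation mu := (lebesgue_Rn R n).
Local Notation L1 := (L1 mu).
Variables (Q0 : cube R n) (gam : Rn R n -> R) (l0 : R).
Hypothesis l0_gt0 : 0 < l0.
Hypothesis Lgam : L1 (cube_set Q0) gam.

Local Notation lam := (dyadic_level l0).
Local Notation J i := (tail Q0 gam (lam i)).

(** On the layer [gam] is at most lam (i + 1) = 2 lam i. *)
Lemma tail_layer i :
  J i - J i.+1 <= 2 * (lam i * fine (mu (dyadic_layer Q0 gam l0 i))).
Proof.
have mgam := L1_measurable Lgam.
have mB := measurable_dyadic_layer l0 i mgam.
have mS := measurable_superlevel (lam i.+1) mgam.
have le2 := le_dyadic_level l0_gt0 (leqnSn i).
have setE : superlevel Q0 gam (lam i) =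
    dyadic_layer Q0 gam l0 i `|` superlevel Q0 gam (lam i.+1).
  apply/seteqP; split => x.
    move=> [Qx lx]; have [le|lt] := leP (gam x) (lam i.+1); [left|right] => //.
    by split => //; apply/andP.
  move=> [[Qx /andP[lx _]]|[Qx lx]]; split => //.
  exact: le_lt_trans lx.
have LB : L1 (dyadic_layer Q0 gam l0 i) gam.
  by apply: L1S Lgam => //; exact: subIsetl.
have finB : mu (dyadic_layer Q0 gam l0 i) \is a fin_num.
  by apply: (@fin_num_mu_subcube _ _ Q0) => //; exact: subIsetl.
have -> : J i = \int[mu]_(x in dyadic_layer Q0 gam l0 i) gam x + J i.+1.
  rewrite {1}/tail setE Rintegral_setU//.
  - apply: L1S Lgam => //; first exact: measurableU.
    by move=> x [|] [].
  - apply/disj_setPS => x [[_ /andP[_ xl]] [_ lx]].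
    by move: lx; rewrite /= ltNge xl.
rewrite addrK mulrA -dyadic_levelS -Rintegral_cst//.
apply: le_Rintegral => //; last by move=> x [_ /andP[]].
by apply: L1_cst => //; rewrite -ge0_fin_numE.
Qed.

Lemma tail_layers lo hi : (lo <= hi)%N -> J lo - J hi <=
  2 * \sum_(lo <= i < hi) lam i * fine (mu (dyadic_layer Q0 gam l0 i)).
Proof.
move=> lohi; rewrite mulr_sumr.
have -> : J lo - J hi = \sum_(lo <= i < hi) (J i - J i.+1).
  have := telescope_sumr (fun i => - J i) lohi.
  by rewrite opprK addrC => <-; apply: eq_bigr => i _; rewrite opprK addrC.
by apply: ler_sum => i _; exact: tail_layer.
Qed.

End layer_mass.

(** Sized for both requirements of [layered_majorant_T]: 32 = 2 * 16, from the L^1 norm 2 c J of a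
    piece and J <= 16 times the available mass; 4 from its BMO bound 4 c lam. *)
Definition piece_const (R : realType) (n : nat) (C1 C2 : R) : R :=
  32 * cz_const R n * (C1 + 1) + 4 * cz_const R n * C2.

Section layer_unions.
Context (R : realType) (n : nat).
Local Notation mu := (lebesgue_Rn R n).
Local Notation L1 := (L1 mu).

Lemma in_space_L1 (Q0 : cube R n) N u : is_ri_space Q0 N ->
  in_space Q0 N u -> L1 (cube_set Q0) u.
Proof.
move=> N_ri Nu; have [bfs _ _] := N_ri; have [CE CEP] := bfs_L1_embed bfs.
apply: L1_of_norm (CEP _ Nu) _ => //; first exact: Nu.1.
have Nu0 := bfs_ge0 bfs Nu.
have Nfin : N u \is a fin_num by rewrite ge0_fin_numE//; exact: Nu.2.
by rewrite -(fineK Nfin) -EFinM ltry.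
Qed.

(** Each level occurs in at most two pieces, so the pieces can be merged into one set per level at
    the cost of a factor 2. *)
Lemma sum_layers_le (k : nat -> nat) (lam : nat -> R)
    (A : nat -> nat -> set (Rn R n)) m x :
  (forall j, (k j < k j.+1)%N) -> (forall i, 0 <= lam i) ->
  \sum_(j < m) layers lam (index_iota (k j.+1).-1 (k j.+2)) (A j) x <=
  2 * layers lam (iota 0 (k m.+1))
    (fun i => \big[setU/set0]_(j < i.+2)
       (if level_range k j i then A j i else set0)) x.
Proof.
move=> k_incr lam0; set AU := fun i : nat => _.
have layersE (j : 'I_m) : layers lam (index_iota (k j.+1).-1 (k j.+2)) (A j) x =
    \sum_(0 <= i < k m.+1) (level_range k j i)%:R * (lam i * \1_(A j i) x).
  have hi : (k j.+2 <= k m.+1)%N by apply: le_levels => //; rewrite ltnS.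
  rewrite /layers (big_nat_widen _ _ _ _ _ hi) (big_nat_widenl _ _ _ _ _ (leq0n _)).
  rewrite big_mkcond/=; apply: eq_bigr => i _; rewrite /level_range andbC.
  by case: ifP => _; rewrite ?mul1r ?mul0r.
under eq_bigr do rewrite layersE.
rewrite exchange_big/= /layers -[k m.+1]subn0 -/(index_iota 0 (k m.+1)) subn0 mulr_sumr.
apply: ler_sum => i _.
apply: (@le_trans _ _ (\sum_(j < m) (level_range k j i)%:R * (lam i * \1_(AU i) x))).
  apply: ler_sum => j _; case lr : (level_range k j i); last by rewrite !mul0r.
  rewrite ler_wpM2l// ler_wpM2l// !indicE ler_nat.
  have [xA|//] := boolP (x \in A j i); rewrite mem_set//.
  rewrite /AU -bigcup_seq.
  exists (Ordinal (level_range_bound k_incr lr)); first by rewrite /= mem_index_enum.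
  by rewrite /= lr; exact/set_mem.
rewrite -mulr_suml ler_wpM2r ?mulr_ge0// -natr_sum ler_nat.
exact: level_range_count.
Qed.

Lemma mu_layer_union (k : nat -> nat) (A : nat -> nat -> set (Rn R n)) (b : R) i :
  (forall j, (k j < k j.+1)%N) -> (forall j, measurable (A j i)) -> 0 <= b ->
  (forall j, level_range k j i -> (mu (A j i) <= (b / 2)%:E)%E) ->
  (mu (\big[setU/set0]_(j < i.+2) (if level_range k j i then A j i else set0)) <=
   b%:E)%E.
Proof.
move=> k_incr mA b0 muA; apply: le_trans (measure_bigsetU_le _ _ _) _.
  by move=> j; case: ifP.
apply: (@le_trans _ _ (\sum_(j < i.+2) ((level_range k j i)%:R * (b / 2))%:E)%E).
  apply: lee_sum => j _; case: ifPn => lr; first by rewrite mul1r muA.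
  by rewrite measure0 mul0r.
rewrite sumEFin -mulr_suml lee_fin -natr_sum.
have : ((\sum_(j < i.+2) level_range k j i)%:R <= 2 :> R).
  by rewrite ler_nat; exact: level_range_count.
by nra.
Qed.

End layer_unions.

Local Notation mu := (lebesgue_Rn _ _).
Local Notation L1mu := (L1 (lebesgue_Rn _ _)).

(** A single [u] serves all cubes. The added constant accounts for the first good part, whose BMO
    bound is a multiple of |gam|_1 + eps, and for the approximation errors. *)
Lemma mosc_T_le (R : realType) (n : nat) (n_gt0 : (0 < n)%N)
    (Q0 : cube R n) (N : (Rn R n -> R) -> \bar R)
    (T : (Rn R n -> R) -> (Rn R n -> R)) (C1 C2 : R)
    (f gam : Rn R n -> R) (eps : R) :
  is_ri_space Q0 N ->
  (forall f, L1mu (cube_set Q0) f -> L1mu (cube_set Q0) (T f)) ->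
  (forall (a : R) f g, L1mu (cube_set Q0) f -> L1mu (cube_set Q0) g ->
     exists c : R, {ae mu, forall x, cube_set Q0 x ->
       T (fun y => a * f y + g y) x = a * T f x + T g x + c}) ->
  0 < C1 ->
  (forall f, L1mu (cube_set Q0) f ->
     (L1_quotient_norm Q0 (T f) <= C1%:E * L1_quotient_norm Q0 f)%E) ->
  0 < C2 ->
  (forall f, in_BMO Q0 f -> (BMO_norm Q0 (T f) <= C2%:E * BMO_norm Q0 f)%E) ->
  0 < eps -> L1mu (cube_set Q0) f -> in_space Q0 N gam ->
  (forall x, cube_set Q0 x -> 0 <= gam x) ->
  (forall Q, subcube Q Q0 -> mosc f Q <= \int[mu]_(x in cube_set Q) gam x) ->
  exists u, [/\ in_space Q0 N u, (N u <= N gam)%E &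
    forall Q, subcube Q Q0 -> mosc (T f) Q <=
      \int[mu]_(x in cube_set Q)
        (20 * piece_const n C1 C2 * majorant_const R n * u x +
        (C2 * cz_const R n * (\int[mu]_(x in cube_set Q0) gam x + eps) + eps))].
Proof.
move=> N_ri T_L1 T_lin C1_gt0 T_quotient C2_gt0 T_BMO.
move=> eps0 Lf Ngam gam0 fgam; have Lgam := in_space_L1 N_ri Ngam.
set c := cz_const R n; set D := piece_const n C1 C2.
have c1 : 1 <= c := cz_const_ge1 R n.
have c0 : 0 < c by lra.
have cC1 : 0 < c * (C1 + 1) by apply: mulr_gt0 => //; rewrite addr_gt0.
have cC2 : 0 < c * C2 by rewrite mulr_gt0.
have D0 : 0 < D by rewrite /D /piece_const -/c; lra.
have K4 := majorant_const_ge4 R n.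
set l0 := \int[mu]_(x in cube_set Q0) gam x + eps.
have l00 : 0 < l0.
  by rewrite ltr_wpDl//; apply: Rintegral_ge0.
pose lam := dyadic_level l0; pose J i := tail Q0 gam (lam i).
have lam_gt0 i : 0 < lam i by exact: dyadic_level_gt0.
have lam_ge0 i : 0 <= lam i by exact: ltW.
have J_ge0 i : 0 <= J i by exact: tail_ge0.
have le_J i j : (i <= j)%N -> J j <= J i.
  by move=> ij; apply: le_tail => //; exact: le_dyadic_level.
have J_small e : 0 < e -> exists k0, forall k, (k0 <= k)%N -> J k <= e.
  move=> e0; have [K KJ] := tail_small Lgam gam0 e0.
  exists (Num.truncn (K%:R / l0)).+1 => k kk; apply: le_trans KJ.
  apply: le_tail => //; rewrite /lam /dyadic_level mulrC -ler_pdivrMr//.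
  apply: (@le_trans _ _ k%:R).
    by rewrite ltW// (lt_le_trans (truncnS_gt _))// ler_nat.
  by rewrite -natrX ler_nat ltnW// ltn_expl.
have [k [k0 kP]] := halving_levels J_ge0 (fun i => le_J _ _ (leqnSn i)) J_small.
have k_incr j : (k j < k j.+1)%N by case: (kP j).
have /choice[g gP] : forall i, exists g, [/\ L1mu (cube_set Q0) g,
    \int[mu]_(x in cube_set Q0) `|f x - g x| <= c * J i &
    forall Q, subcube Q Q0 -> mosc g Q <= c * lam i * volume Q].
  by move=> i; exact: good_bad_decomposition.
have Lg i : L1mu (cube_set Q0) (g i) by case: (gP i).
have fg i : \int[mu]_(x in cube_set Q0) `|f x - g i x| <= c * J i by case: (gP i).
have gB i Q : subcube Q Q0 -> mosc (g i) Q <= c * lam i * volume Q.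
  by case: (gP i) => _ _; exact.
pose bet i := fine (mu (dyadic_layer Q0 gam l0 i)).
have mgam := L1_measurable Lgam.
have finB i : mu (dyadic_layer Q0 gam l0 i) \is a fin_num.
  apply: (@fin_num_mu_subcube _ _ Q0); last exact: subIsetl.
  exact: measurable_dyadic_layer.
have bet_ge0 i : 0 <= bet i by exact: fine_ge0.
pose piece j x := g (k j.+1) x - g (k j) x.
have Lp j : L1mu (cube_set Q0) (piece j) by exact: L1B.
pose s j := index_iota (k j.+1).-1 (k j.+2).
have sE j i : (i \in s j) = level_range k j i by rewrite mem_index_iota.
(* Half of the layer, because two pieces may draw on it. *)
pose b j i := if level_range k j i then bet i / 2 else 0.
have b_ge0 j i : 0 <= b j i by rewrite /b; case: ifP => // _; rewrite divr_ge0.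
pose e j := eps / 2 ^+ j.+1.
have e_gt0 j : 0 < e j by rewrite divr_gt0// exprn_gt0.
have /choice[A AP] : forall j, exists A : nat -> set (Rn R n),
    [/\ forall i, measurable (A i), forall i, A i `<=` cube_set Q0,
        forall i, (mu (A i) <= (b j i)%:E)%E &
        forall Q, subcube Q Q0 -> mosc (T (piece j)) Q <=
          D * (5 * majorant_const R n) *
            \int[mu]_(x in cube_set Q) layers lam (s j) A x + e j * volume Q].
  move=> j; have [kj J2 J2'] := kP j; have [kj' J3 _] := kP j.+1.
  have k_gt0 : (0 < k j.+1)%N by exact: leq_ltn_trans kj.
  (* Two consecutive bad parts give 2 c J (k j). For the oscillation, c lam (k j.+1) is 2 c lam (k
     j.+1).-1 and c lam (k j) is at most c lam (k j.+1).-1, together below the bound with 4 c. *)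
  apply: (@layered_majorant_T _ _ n_gt0 Q0 T C1 C2 T_L1 C1_gt0 T_quotient C2_gt0
    T_BMO (piece j) (2 * c * J (k j)) (4 * c * lam (k j.+1).-1) (lam (k j.+1).-1)) => //.
  - apply: (@le_trans _ _ (\int[mu]_(x in cube_set Q0)
        (`|f x - g (k j.+1) x| + `|f x - g (k j) x|))).
      apply: le_Rintegral => //; first exact: L1_norm.
        by apply: L1D => //; apply: L1_norm; exact: L1B.
      move=> x _; rewrite /piece (distrC (f x)) (le_trans _ (ler_normD _ _))//.
      by rewrite subrKA.
    rewrite RintegralD//; try by apply: L1_norm; exact: L1B.
    have := fg (k j.+1); have := fg (k j).
    have : c * J (k j.+1) <= c * J (k j) by rewrite ler_wpM2l ?(ltW c0)// le_J// ltnW.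
    clear; lra.
  - move=> Q QQ0.
    have LgQ i : L1mu (cube_set Q) (g i) by exact: L1S (Lg i).
    have -> : piece j = (fun x => g (k j.+1) x + (-1) * g (k j) x).
      by apply/funext => x; rewrite mulN1r.
    apply: le_trans (moscD _ _) _ => //; first exact: L1Z.
    rewrite moscZ// normrN1 mul1r.
    have := gB (k j.+1) Q QQ0; have := gB (k j) Q QQ0.
    have : lam (k j) <= lam (k j.+1).-1.
      by apply: le_dyadic_level => //; rewrite -ltnS prednK.
    have -> : lam (k j.+1) = 2 * lam (k j.+1).-1.
      by rewrite -dyadic_levelS prednK.
    have v0 := volume_ge0 Q; have lp := lam_ge0 (k j.+1).-1.
    move=> h1 h2 h3.
    have : c * lam (k j) * volume Q <= c * lam (k j.+1).-1 * volume Q.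
      by rewrite ler_wpM2r// ler_wpM2l// ltW.
    have : 0 <= c * lam (k j.+1).-1 * volume Q by rewrite !mulr_ge0// ltW.
    have -> : 4 * c * lam (k j.+1).-1 * volume Q =
        4 * (c * lam (k j.+1).-1 * volume Q) by rewrite !mulrA.
    have e3 : c * (2 * lam (k j.+1).-1) * volume Q =
        2 * (c * lam (k j.+1).-1 * volume Q) by rewrite mulrCA !mulrA.
    rewrite e3 in h3; move: h2 h3; clear.
    by move: (c * lam (k j) * _) (c * lam (k j.+1).-1 * _) => a a'; lra.
  - by move=> i; rewrite sE => /andP[+ _]; exact: le_dyadic_level.
  - by move=> i; rewrite sE /b => /negbTE ->.
  - have : 0 <= c * (C1 + 1) * lam (k j.+1).-1 by rewrite mulr_ge0// ltW.
    rewrite /D /piece_const -/c; clear; lra.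
  - have sumE : \sum_(i <- s j) lam i * b j i =
        2^-1 * \sum_((k j.+1).-1 <= i < k j.+2) lam i * bet i.
      rewrite mulr_sumr [LHS]big_seq [RHS]big_seq; apply: eq_bigr => i.
      by rewrite -/(s j) sE /b => ->; rewrite [LHS]mulrA mulrC.
    have lohi : ((k j.+1).-1 <= k j.+2)%N.
      exact: leq_trans (leq_pred _) (ltnW kj').
    have := tail_layers l00 Lgam lohi.
    rewrite -/lam -/(J _) -/(J _) sumE -/bet => h.
    (* The tail drops by at least J (k j) * (1/2 - 1/4) across the range, and by [tail_layers] at
       most by 4 times the halved sum. *)
    have : J (k j) <= 16 * (2^-1 * \sum_((k j.+1).-1 <= i < k j.+2) lam i * bet i).
      move: h J2 J2' J3; rewrite /bet; clear; lra.
    have := J_ge0 (k j); set M := 2^-1 * _ => Jk JM.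
    have M0 : 0 <= M by move: Jk JM; clear; lra.
    have : c * (C1 + 1) * J (k j) <= c * (C1 + 1) * (16 * M).
      by rewrite ler_wpM2l// ltW.
    have : 0 <= c * C2 * M by rewrite mulr_ge0 ?(ltW cC2).
    rewrite /D /piece_const -/c; clear; lra.
have mA j i : measurable (A j i) by case: (AP j).
pose AU i := \big[setU/set0]_(j < i.+2) (if level_range k j i then A j i else set0).
have mAU i : measurable (AU i) by apply: bigsetU_measurable => j _; case: ifP.
have AUQ i : AU i `<=` cube_set Q0.
  move=> x; rewrite /AU -bigcup_seq => -[j _]; case: ifP => // _.
  by have [_ h _ _] := AP j; exact: h.
have muAU i : (mu (AU i) <= mu (dyadic_layer Q0 gam l0 i))%E.
  rewrite -(fineK (finB i)); apply: mu_layer_union => //.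
    exact: bet_ge0.
  move=> j lr; by have [_ _ /(_ i) + _] := AP j; rewrite /b lr.
have [u [Nu uN u0 uA]] := rearranged_layers n_gt0 N_ri l00 Ngam gam0 mAU AUQ muAU.
exists u; split => // Q QQ0; have Lu := in_space_L1 N_ri Nu.
have LuQ : L1mu (cube_set Q) u by exact: L1S Lu.
have LsA j : L1mu (cube_set Q) (layers lam (s j) (A j)) by apply: L1_layers.
(* 4 = 2 * 2: double use of a level, then the geometric sum of levels below [u]. *)
have layers_u m : \sum_(j < m) \int[mu]_(x in cube_set Q) layers lam (s j) (A j) x <=
    4 * \int[mu]_(x in cube_set Q) u x.
  have LU : L1mu (cube_set Q) (layers lam (iota 0 (k m.+1)) AU) by exact: L1_layers.
  have LS := @L1_sum _ _ _ mu (cube_set Q) _ (index_enum 'I_m)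
    (fun j : 'I_m => layers lam (s j) (A j)) (measurable_cube Q) (fun j => LsA j).
  rewrite -(@Rintegral_sum _ _ _ mu _ _ _ (fun j : 'I_m => layers lam (s j) (A j)))//.
  rewrite -RintegralZl//; apply: (@le_trans _ _ (\int[mu]_(x in cube_set Q)
      (2 * layers lam (iota 0 (k m.+1)) AU x))).
    by apply: le_Rintegral => //; [exact: L1Z|move=> x _; exact: sum_layers_le].
  apply: ae_le_Rintegral => //; try exact: L1Z.
  apply: filterS uA => x /(_ (k m.+1)) + _; rewrite -/lam; clear; lra.
(* Telescoping from k 0 = 0, where the level is l0; the errors eps / 2^(j+1) add up to eps - eps /
   2^m. *)
have Tg m : mosc (T (g (k m))) Q <= C2 * (c * l0) * volume Q +
    D * (5 * majorant_const R n) *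
      \sum_(j < m) \int[mu]_(x in cube_set Q) layers lam (s j) (A j) x +
    (eps - eps / 2 ^+ m) * volume Q.
  elim: m => [|m IH].
    rewrite big_ord0 mulr0 addr0 expr0 divr1 subrr mul0r addr0.
    apply: (@mosc_T_BMO _ _ Q0 T C2 T_L1 C2_gt0 T_BMO _ (c * l0)) => // Q' Q'Q0.
    by have := gB (k 0%N) Q' Q'Q0; rewrite k0 /lam /dyadic_level expr0 mulr1.
  have -> : g (k m.+1) = (fun x => piece m x + g (k m) x).
    by apply/funext => x; rewrite /piece subrK.
  apply: le_trans (mosc_T_add T_L1 T_lin (Lp m) (Lg (k m)) QQ0) _.
  have [_ _ _ /(_ Q QQ0) h] := AP m.
  have eE : e m = eps / 2 ^+ m - eps / 2 ^+ m.+1.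
    by rewrite /e exprS; field; rewrite expf_neq0.
  rewrite eE in h; apply: le_trans (lerD h IH) _; rewrite big_ord_recr/=.
  move: (eps / 2 ^+ m) (eps / 2 ^+ m.+1) => a a'.
  by rewrite le_eqVlt; apply/orP; left; apply/eqP; ring.
have LuC : L1mu (cube_set Q) (fun x => 20 * D * majorant_const R n * u x) by exact: L1Z.
rewrite RintegralD//; last exact: L1_cst.
rewrite Rintegral_cube_cst RintegralZl//.
(* The remaining bad part f - g (k m) has an image of oscillation at most 2 C1 c J (k m), which
   falls below any d; the other bounds do not depend on m. *)
apply/ler_addgt0Pr => d d0.
have d'0 : 0 < d / (2 * C1 * c) by rewrite divr_gt0// !mulr_gt0.
have [m mP] := J_small _ d'0.
have Jd : 2 * (C1 * (c * J (k m))) <= d.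
  have := mP (k m) (level_ge k_incr m); rewrite ler_pdivlMr ?mulr_gt0//.
  by clear; lra.
have Lb : L1mu (cube_set Q0) (fun x => f x - g (k m) x) by exact: L1B.
have Tb : mosc (T (fun x => f x - g (k m) x)) Q <= 2 * (C1 * (c * J (k m))).
  exact: (mosc_T_L1 T_L1 C1_gt0 T_quotient Lb QQ0).
have -> : f = (fun x => (f x - g (k m) x) + g (k m) x).
  by apply/funext => x; rewrite subrK.
apply: le_trans (mosc_T_add T_L1 T_lin Lb (Lg (k m)) QQ0) _.
have := Tg m; have := layers_u m; set S := \sum_(j < m) _ => Su Tgm.
have DK : D * (5 * majorant_const R n) * S <= 20 * D * majorant_const R n *
    \int[mu]_(x in cube_set Q) u x.
  rewrite (_ : 20 * _ * _ * _ = D * (5 * majorant_const R n) *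
    (4 * \int[mu]_(x in cube_set Q) u x)); last by ring.
  by rewrite ler_wpM2l// mulr_ge0 ?(ltW D0)// mulr_ge0//; apply: le_trans K4.
have e0 : 0 <= eps / 2 ^+ m * volume Q by rewrite !mulr_ge0 ?invr_ge0 ?exprn_ge0// ltW.
have eV : (eps - eps / 2 ^+ m) * volume Q <= eps * volume Q.
  by rewrite mulrBl gerBl.
rewrite mulrA in Tgm; rewrite [X in _ <= _ + X + _]mulrDl.
move: Tgm Tb Jd DK eV; clear; lra.
Qed.

Theorem mainTheorem5 (R : realType) (n : nat) (n_gt0 : (0 < n)%N)
  (Q0 : cube R n) (Q0_vol : lebesgue_Rn R n (cube_set Q0) = 1%E)
  (X : (Rn R n -> R) -> \bar R) (X_ri : is_ri_space Q0 X)
  (T : (Rn R n -> R) -> (Rn R n -> R)) (T_bounded : bounded_on_L1_BMO Q0 T) :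
  bounded_on_GaRo Q0 X T.
Proof.
have [T_L1 T_lin [C1 C1_gt0 T_quo] [C2 C2_gt0 T_BMO]] := T_bounded.
have [bfs _ _] := X_ri.
have [CI CIP] := bfs_Linfty_embed bfs; have [CE CEP] := bfs_L1_embed bfs.
set c := cz_const R n; set D := piece_const n C1 C2; set K := majorant_const R n.
have c1 : 1 <= c := cz_const_ge1 R n.
have K4 : 4 <= K := majorant_const_ge4 R n.
have D0 : 0 < D.
  have cC1 : 0 < c * (C1 + 1) by apply: mulr_gt0; [lra|rewrite addr_gt0].
  have cC2 : 0 < c * C2 by apply: mulr_gt0 => //; lra.
  by rewrite /D /piece_const -/c; lra.
have DK0 : 0 < D * K by apply: mulr_gt0 => //; lra.
have cC2 : 0 <= c * C2 by apply: mulr_ge0; [lra|exact: ltW].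
pose a := 2 * `|CI| * (C2 * c + 1).
have a0 : 0 <= a by rewrite !mulr_ge0//; lra.
(* Twice the constants of [mosc_T_le], the factor 2 being the cost of membership in the class. The
   second summand is the norm of the constant function after |gam|_1 <= |CE| X(gam); [a] collects
   the terms in eps, which is sent to 0. *)
pose C := 40 * (D * K) + 2 * `|CI| * (c * C2) * `|CE|.
have C0 : 0 < C.
  have : 0 <= 2 * `|CI| * (c * C2) * `|CE| by rewrite !mulr_ge0//; lra.
  by rewrite /C; lra.
exists C => // f [Lf _]; rewrite /GaRo_norm -ereal_inf_pZl//.
apply: le_ereal_inf_tmp => _ [_ [g Gg <-] <-].
(* Members of the class outside X impose no bound. *)
have [Xg|] := ltP (X g) +oo%E; last first.
  by rewrite leye_eq => /eqP ->; rewrite gt0_muley ?leey// lte_fin.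
have Lg : L1 (lebesgue_Rn R n) (cube_set Q0) g by case: Gg.
have mg := L1_measurable Lg.
have g_in : in_space Q0 X g by [].
pose gam x := `|g x|.
have gamg : (X gam <= X g)%E.
  apply: (bfs_ideal bfs) => //; first exact: measurableT_comp.
  by apply: aeW => x _; rewrite normr_id.
have gam_in : in_space Q0 X gam.
  by split; [exact: measurableT_comp|exact: le_lt_trans gamg Xg].
have gam_fin : X gam \is a fin_num by rewrite ge0_fin_numE ?gam_in.2// (bfs_ge0 bfs gam_in).
set r := fine (X gam); have rE : X gam = r%:E by rewrite fineK.
have r0 : 0 <= r by rewrite fine_ge0// (bfs_ge0 bfs gam_in).
suff bound eps : 0 < eps ->
    (ereal_inf [set X h | h in Gamma_class Q0 (T f)] <= (C * r + a * eps)%:E)%E.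
  apply: (@le_trans _ _ (C%:E * X gam)%E); last by rewrite lee_pmul2l.
  rewrite rE -EFinM; apply/lee_addgt0Pr => e e0.
  have a10 : 0 < a + 1 by rewrite ltr_wpDl.
  apply: le_trans (bound (e / (a + 1)) _) _; first by rewrite divr_gt0.
  rewrite -EFinD lee_fin lerD2l mulrCA ler_piMr ?(ltW e0)// ler_pdivrMr//.
  by rewrite mul1r lerDl.
move=> eps0.
have [||u [u_in uX Tu]] := @mosc_T_le R n n_gt0 Q0 X T C1 C2 f gam eps X_ri T_L1
    T_lin C1_gt0 T_quo C2_gt0 T_BMO eps0 Lf gam_in.
- by move=> x _; exact: normr_ge0.
- by move=> Q QQ0; exact: (Gamma_class_mosc Lf Gg QQ0).
have Lu := in_space_L1 X_ri u_in; have Lgam := in_space_L1 X_ri gam_in.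
set I := \int[_]_(x in cube_set Q0) gam x in Tu.
have Ir : I <= `|CE| * r.
  have := CEP gam gam_in; rewrite rE.
  under eq_integral do rewrite /gam normr_id.
  rewrite (L1_EFin _ Lgam)// -EFinM lee_fin => /le_trans; apply.
  by rewrite ler_wpM2r// ler_norm.
have I0 : 0 <= I by apply: Rintegral_ge0 => x _; exact: normr_ge0.
pose M := 2 * (C2 * c * (I + eps) + eps).
have M0 : 0 <= M.
  have : 0 <= c * C2 * (I + eps) by rewrite mulr_ge0//; lra.
  by rewrite /M; lra.
pose h1 x := 40 * (D * K) * u x.
have Xh1 : X h1 = ((40 * (D * K))%:E * X u)%E.
  by rewrite (bfs_scale bfs)// ger0_norm//; lra.
have h1_in : in_space Q0 X h1.
  split; first by apply: measurable_funM => //; exact: u_in.1.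
  rewrite Xh1; apply: lte_mul_pinfty => //; first by rewrite lee_fin; lra.
  exact: u_in.2.
have XM : (X (fun=> M) <= (`|CI| * M)%:E)%E.
  apply: (@le_trans _ _ (CI * M)%:E).
    by apply: CIP => //; apply: aeW => x _; rewrite ger0_norm.
  by rewrite lee_fin ler_wpM2r// ler_norm.
have M_in : in_space Q0 X (fun=> M).
  by split => //; apply: le_lt_trans XM _; rewrite ltry.
have LM : L1 (lebesgue_Rn R n) (cube_set Q0) (fun x => h1 x + M).
  by apply: L1D => //; [exact: L1Z|exact: L1_cst].
apply: ge_ereal_inf; exists (X (fun x => h1 x + M)).
  exists (fun x => h1 x + M) => //; apply: mosc_Gamma_class => //.
    exact: T_L1.
  move=> Q QQ0; have LuQ : L1 (lebesgue_Rn R n) (cube_set Q) u by exact: L1S Lu.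
  rewrite (_ : (fun x => h1 x + M) = (fun x => 2 * (20 * D * K * u x +
      (C2 * c * (I + eps) + eps)))); last first.
    by apply/funext => x; rewrite /h1 /M; ring.
  rewrite RintegralZl//; last by apply: L1D => //; [exact: L1Z|exact: L1_cst].
  by rewrite ler_pM2l//; exact: Tu.
apply: le_trans (bfs_triangle bfs h1_in M_in) _.
apply: (@le_trans _ _ ((40 * (D * K) * r)%:E + (`|CI| * M)%:E)%E).
  apply: leeD => //; rewrite Xh1 [leRHS]EFinM -rE; apply: lee_wpmul2l => //.
  by rewrite lee_fin; lra.
rewrite -EFinD lee_fin.
have : `|CI| * (c * C2) * I <= `|CI| * (c * C2) * (`|CE| * r).
  by rewrite ler_wpM2l// mulr_ge0.
rewrite /M /a /C; clear; lra.
Qed.
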